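(* Fix a constant $t$. There is an algorithm that, given a weighted directed graph $G=(V,E,\mathsf{wt})$ with $n$ nodes and treewidth at most $t$, together with a balanced, binary tree-decomposition $\mathrm{Tree}(G)$ of $G$ of width at most a constant (depending only on $t$) with $O(n)$ bags, uses $O(n)$ time and $O(\log n)$ additional space and returns a value $c$ with the following properties, where $c^{\ast}=\min_{C}\mathsf{wt}(C)$ over all simple cycles $C$ of $G$: (1) if $G$ has no negative cycles, then $c=c^{\ast}$; (2) if $G$ has a negative cycle, then (a) $c\le c^{\ast}$, and (b) $|c|=|c^{\ast}|\cdot n^{O(1)}$ (the constant in the exponent being independent of $G$).
   Context: A weighted directed graph $G=(V,E,\mathsf{wt})$ has finite node set $V$ ($|V|=n$), edge set $E\subseteq V\times V$ and weight function $\mathsf{wt}:E\to\mathbb{Z}$; every node has at least one outgoing edge. A path $(u_1,\dots,u_j)$ has weight $\sum_{i<j}\mathsf{wt}(u_i,u_{i+1})$; it is a cycle if $j>1$ and $u_1=u_j$, and a simple cycle if moreover $(u_2,\dots,u_j)$ has no repeated node. The minimum of the empty set is $\infty$. A tree-decomposition of $G$ is a tree whose nodes (bags) are subsets of $V$ such that every node of $G$ lies in some bag, both endpoints of every edge lie in a common bag, and for all bags $B_i,B_j$ every bag on the tree path between them contains $B_i\cap B_j$. Its width is the maximum bag size minus $1$; the treewidth of $G$ is the minimum width over all tree-decompositions. It is binary if every bag has at most two children, and balanced if its height is $O(\log n')$ where $n'$ is the number of bags. Time is measured in arithmetic and logical operations, space in machine words. *)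

(* Defs.v *)
From HB Require Import structures.
From mathcomp Require Import all_boot all_order all_algebra.
Set Implicit Arguments.
Unset Strict Implicit.
Unset Printing Implicit Defensive.

(* [wt] is total but only its values on edges are ever used. *)
Record wdigraph (n : nat) := WDigraph {
  edge : rel 'I_n;
  wt : 'I_n -> 'I_n -> int;
  edge_out : forall u, exists v, edge u v }.

(* The path (u_1, ..., u_j) is given by its head u = u_1 and its tail
   p = (u_2, ..., u_j). *)
Fixpoint path_weight (n : nat) (G : wdigraph n) (u : 'I_n) (p : seq 'I_n)
    : int :=
  if p is v :: q then (wt G u v + path_weight G v q)%R else 0%R.

Definition is_cycle (n : nat) (G : wdigraph n) (u : 'I_n) (p : seq 'I_n) :=
  [/\ path (edge G) u p, p <> [::] & last u p = u].

Definition is_simple_cycle (n : nat) (G : wdigraph n) (u : 'I_n)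
    (p : seq 'I_n) :=
  is_cycle G u p /\ uniq p.

Definition has_negative_cycle (n : nat) (G : wdigraph n) :=
  exists u p, is_cycle G u p /\ (path_weight G u p < 0)%R.

(* Extended integers are [option int], with [None] for infinity. *)
Definition is_min_simple_cycle_weight (n : nat) (G : wdigraph n)
    (c : option int) : Prop :=
  if c is Some z then
    (exists u p, is_simple_cycle G u p /\ path_weight G u p = z) /\
    (forall u p, is_simple_cycle G u p -> (z <= path_weight G u p)%R)
  else forall u p, ~ is_simple_cycle G u p.

Definition max_abs_weight (n : nat) (G : wdigraph n) : nat :=
  \max_(u < n) \max_(v < n | edge G u v) absz (wt G u v).

Definition simple_path (m : nat) (adj : rel 'I_m) (i j : 'I_m)
    (p : seq 'I_m) :=
  [/\ path adj i p, last i p = j & uniq (i :: p)].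

Definition is_tree (m : nat) (adj : rel 'I_m) :=
  [/\ 0 < m, symmetric adj, irreflexive adj &
      forall i j, exists! p, simple_path adj i j p].

(* The bags form a family indexed by the nodes of the tree, so that the same
   subset may occur at several nodes. *)
Definition is_tree_decomposition (n : nat) (G : wdigraph n) (m : nat)
    (adj : rel 'I_m) (bag : 'I_m -> {set 'I_n}) :=
  [/\ is_tree adj,
      forall u, exists i, u \in bag i,
      forall u v, edge G u v -> exists i, (u \in bag i) && (v \in bag i) &
      forall i j p k, simple_path adj i j p -> k \in i :: p ->
        bag i :&: bag j \subset bag k].

(* The predecessor only truncates when all bags are empty, that is for n = 0. *)
Definition width (n m : nat) (bag : 'I_m -> {set 'I_n}) : nat :=
  (\max_(i < m) #|bag i|).-1.

Definition is_treewidth (n : nat) (G : wdigraph n) (k : nat) :=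
  (exists m (adj : rel 'I_m) bag,
     is_tree_decomposition G adj bag /\ width bag = k) /\
  (forall m (adj : rel 'I_m) bag,
     is_tree_decomposition G adj bag -> k <= width bag).

Record btree (m : nat) := BTree {
  bt_root : 'I_m;
  bt_left : 'I_m -> option 'I_m;
  bt_right : 'I_m -> option 'I_m }.

Definition child (m : nat) (T : btree m) : rel 'I_m :=
  fun i j => (bt_left T i == Some j) || (bt_right T i == Some j).

Definition tree_adj (m : nat) (T : btree m) : rel 'I_m :=
  fun i j => child T i j || child T j i.

(* A unique downward walk (not assumed simple) from the root to each node:
   all nodes are reachable, the root has no parent, and every other node has
   exactly one. *)
Definition is_rooted (m : nat) (T : btree m) :=
  (forall i, bt_left T i <> None -> bt_left T i <> bt_right T i) /\
  (forall i, exists! p, path (child T) (bt_root T) p /\ last (bt_root T) p = i).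

Definition height_at_most (m : nat) (T : btree m) (h : nat) :=
  forall p, path (child T) (bt_root T) p -> size p <= h.

(* [trunc_log 2 m] vanishes at m = 1, hence the successor in this and the
   other logarithmic bounds. *)
Definition is_balanced (beta : nat) (m : nat) (T : btree m) :=
  height_at_most T (beta * (trunc_log 2 m).+1).

(* Structured programs over a read-only input, made of finitely many arrays,
   and a read-write memory. Comparisons and connectives return 0 or 1. *)
Inductive binop :=
  OpAdd | OpSub | OpMul | OpDiv | OpMod | OpLe | OpEq | OpAnd | OpOr.

Definition eval_binop (o : binop) (x y : int) : int :=
  match o with
  | OpAdd => (x + y)%R
  | OpSub => (x - y)%R
  | OpMul => (x * y)%R
  | OpDiv => divz x y
  | OpMod => modz x y
  | OpLe => Posz (x <= y)%R
  | OpEq => Posz (x == y)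
  | OpAnd => Posz ((x != 0%R) && (y != 0%R))
  | OpOr => Posz ((x != 0%R) || (y != 0%R))
  end.

Inductive expr :=
  | Const of int
  | Cell of expr           (* working memory cell at the given address *)
  | Input of nat & expr    (* input array number, index in that array *)
  | Op of binop & expr & expr.

Inductive cmd :=
  | Skip
  | Store of expr & expr   (* address, value *)
  | Seq of cmd & cmd
  | If of expr & cmd & cmd
  | While of expr & cmd.

Definition lookup (s : seq int) (a : int) : option int :=
  if a is Posz k then onth s k else None.

Definition word (b : nat) (z : int) : option int :=
  if absz z <= b then Some z else None.

(* [b] is the largest absolute value that a machine word can hold. Evaluation
   fails on a value that does not fit in a word, and on an address out of
   range. *)
Fixpoint eval (b : nat) (inp : seq (seq int)) (mem : seq int) (e : expr)
    : option int :=
  obind (word b)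
    match e with
    | Const z => Some z
    | Cell e1 => obind (lookup mem) (eval b inp mem e1)
    | Input a e1 => obind (lookup (nth [::] inp a)) (eval b inp mem e1)
    | Op o e1 e2 =>
        obind (fun x => omap (eval_binop o x) (eval b inp mem e2))
              (eval b inp mem e1)
    end.

Fixpoint expr_cost (e : expr) : nat :=
  match e with
  | Const _ => 1
  | Cell e1 => (expr_cost e1).+1
  | Input _ e1 => (expr_cost e1).+1
  | Op _ e1 e2 => (expr_cost e1 + expr_cost e2).+1
  end.

(* [exec b inp c mem time mem'] : started on the memory [mem], [c] terminates
   without failure after [time] operations on the memory [mem']. The size of
   the memory never changes. *)
Inductive exec (b : nat) (inp : seq (seq int))
    : cmd -> seq int -> nat -> seq int -> Prop :=
  | exec_skip mem :
      exec b inp Skip mem 1 mem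
  | exec_store mem ea ev k z :
      eval b inp mem ea = Some (Posz k) -> k < size mem ->
      eval b inp mem ev = Some z ->
      exec b inp (Store ea ev) mem (expr_cost ea + expr_cost ev).+1
        (set_nth 0%R mem k z)
  | exec_seq mem mem' mem'' c1 c2 t1 t2 :
      exec b inp c1 mem t1 mem' -> exec b inp c2 mem' t2 mem'' ->
      exec b inp (Seq c1 c2) mem (t1 + t2) mem''
  | exec_if_true mem mem' e c1 c2 z t1 :
      eval b inp mem e = Some z -> z <> 0%R -> exec b inp c1 mem t1 mem' ->
      exec b inp (If e c1 c2) mem (expr_cost e + t1).+1 mem'
  | exec_if_false mem mem' e c1 c2 t2 :
      eval b inp mem e = Some 0%R -> exec b inp c2 mem t2 mem' ->
      exec b inp (If e c1 c2) mem (expr_cost e + t2).+1 mem'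
  | exec_while_true mem mem' mem'' e c z t1 t2 :
      eval b inp mem e = Some z -> z <> 0%R -> exec b inp c mem t1 mem' ->
      exec b inp (While e c) mem' t2 mem'' ->
      exec b inp (While e c) mem (expr_cost e + t1 + t2).+1 mem''
  | exec_while_false mem e c :
      eval b inp mem e = Some 0%R ->
      exec b inp (While e c) mem (expr_cost e).+1 mem.

(* Cell 0 tells whether the result is finite, cell 1 holds its value. *)
Definition output (mem : seq int) : option int :=
  if nth 0%R mem 0 == 0%R then None else Some (nth 0%R mem 1).

(* The working memory has [space] words, initially 0. *)
Definition computes (P : cmd) (inp : seq (seq int)) (b space time : nat)
    (c : option int) :=
  exists mem, exec b inp P (nseq space 0%R) time mem /\ output mem = c.

(* A sequence of lists is stored as the array of the starting positions of the
   lists (plus the total length), next to the array of all their items. *)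
Definition offsets (T : Type) (ss : seq (seq T)) : seq int :=
  [seq Posz (sumn (take i (shape ss))) | i <- iota 0 (size ss).+1].

Definition out_edges (n : nat) (G : wdigraph n) : seq (seq ('I_n * 'I_n)) :=
  [seq [seq (u, v) | v <- enum 'I_n & edge G u v] | u <- enum 'I_n].

Definition in_edges (n : nat) (G : wdigraph n) : seq (seq ('I_n * 'I_n)) :=
  [seq [seq (u, v) | u <- enum 'I_n & edge G u v] | v <- enum 'I_n].

Definition bag_lists (n m : nat) (bag : 'I_m -> {set 'I_n})
    : seq (seq 'I_n) :=
  [seq enum (bag i) | i <- enum 'I_m].

Definition child_word (m : nat) (o : option 'I_m) : int :=
  if o is Some j then Posz j else (-1)%R.

(* The graph is given by its adjacency lists, of successors (arrays 1-3) and
   of predecessors (arrays 4-6), and the decomposition by the contents of the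
   bags (arrays 7-8) and their children (arrays 9-10). *)
Definition encode (n : nat) (G : wdigraph n) (m : nat) (T : btree m)
    (bag : 'I_m -> {set 'I_n}) : seq (seq int) :=
  [:: [:: Posz n; Posz m; Posz (bt_root T)];
      offsets (out_edges G);
      [seq Posz (nat_of_ord e.2) | e <- flatten (out_edges G)];
      [seq wt G e.1 e.2 | e <- flatten (out_edges G)];
      offsets (in_edges G);
      [seq Posz (nat_of_ord e.1) | e <- flatten (in_edges G)];
      [seq wt G e.1 e.2 | e <- flatten (in_edges G)];
      offsets (bag_lists bag);
      [seq Posz (nat_of_ord u) | u <- flatten (bag_lists bag)];
      [seq child_word (bt_left T i) | i <- enum 'I_m];
      [seq child_word (bt_right T i) | i <- enum 'I_m]].

(* Words of O(log n + log W) bits, W being the largest absolute weight. *)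
Definition word_bound (Kb n : nat) (G : wdigraph n) : nat :=
  (n + max_abs_weight G + 2) ^ Kb.

(* Main.v *)
Require Import Defs.
From HB Require Import structures.
From mathcomp Require Import all_boot all_order all_algebra.
From mathcomp Require Import zify.
Set Implicit Arguments.
Unset Strict Implicit.
Unset Printing Implicit Defensive.
Import Order.TTheory GRing.Theory Num.Theory.

(* The vertices are eliminated bottom-up along the tree: a vertex is forgotten
   at the topmost node [i] whose bag contains it, by means of the update
   [D x y := min (D x y) (D x u + D u y)] for [x] and [y] in the bag of [i], after
   [D u u] has been offered as a cycle weight. By the separation property of tree
   decompositions all neighbours of [u] which are not yet eliminated lie in that
   bag, so that [D x y] is at most the weight of every path from [x] to [y] whose
   inner vertices are distinct and eliminated. Hence the last vertex eliminated on
   a simple cycle sees the weight of this cycle, which gives [c <= cstar] whatever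
   the signs of the weights. Conversely every entry is the weight of a walk, whose
   length grows by a constant factor at each level, hence is polynomial in [n] as
   the tree is balanced; since a closed walk splits into at most as many simple
   cycles as it has edges, [c] is [cstar] without negative cycles and at least
   [n ^ d * cstar] otherwise. The edges of a vertex are read only at the node where
   it is forgotten, which keeps the time linear, and the tables of a single branch
   of the tree are stored at any time. *)

(** With negative cycles the entries of a table have no canonical value: the updates are made in
    place, so that one may use entries lowered earlier in the same pass, and the outcome depends on
    their order. Hence the entries are never characterized. Two independent facts are carried
    instead: an upper bound by the weights of certain paths ([path_cover], [cycle_cover]), and the
    existence of a short walk having the entry as its weight ([sound], [csound]). Both survive
    updates in any order. An update in place at most doubles the bound on the lengths; a node makes
    at most [N ^ 3] of them when bags have at most [N] vertices, whence the factor [2 ^ (N ^ 3)] for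
    each level. The same bound is what makes the arithmetic succeed: the entries stay below a
    polynomial in [n] times the largest weight and so fit in a word. Since the language has no
    recursion, the traversal is one loop over an explicit stack, and a statement about a subtree
    concerns a stretch of the iterations of this loop. *)

Lemma not_uniq_split (A : eqType) (s : seq A) :
  ~~ uniq s -> exists p1 v p2 p3, s = p1 ++ v :: p2 ++ v :: p3.
Proof.
elim: s => [//|x s IH] /=; rewrite negb_and negbK; case: (boolP (x \in s)).
  by move=> /splitPr[p2 p3] _; exists [::], x, p2, p3.
by move=> _ /IH[p1 [v [p2 [p3 ->]]]]; exists (x :: p1), v, p2, p3.
Qed.

(** * Closed walks and simple cycles *)

Section Walks.
Variables (n : nat) (G : wdigraph n).
Implicit Types (u v x y : 'I_n) (p q s : seq 'I_n).

Lemma path_weight_cat u p q :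
  path_weight G u (p ++ q) = (path_weight G u p + path_weight G (last u p) q)%R.
Proof. by elim: p u => [|v p IH] u /=; [rewrite add0r | rewrite IH addrA]. Qed.

Lemma max_abs_weightP u v : edge G u v -> absz (wt G u v) <= max_abs_weight G.
Proof.
move=> uv; apply: leq_trans (leq_bigmax (F := fun u => \max_(v < n | edge G u v) _) u).
exact: (leq_bigmax_cond (F := fun v => absz (wt G u v))).
Qed.

Lemma path_weight_bound u p : path (edge G) u p ->
  absz (path_weight G u p) <= size p * max_abs_weight G.
Proof.
elim: p u => [//|v p IH] u /= /andP[/max_abs_weightP uv /IH]; lia.
Qed.

(** The stretch between two occurrences of [v] is itself a closed walk, and cutting it out leaves a
    closed walk from [u]. *)
Lemma cycle_split u p : is_cycle G u p -> ~~ uniq p ->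
  exists v q r, [/\ is_cycle G u q, is_cycle G v r,
    path_weight G u p = (path_weight G u q + path_weight G v r)%R
    & size p = size q + size r].
Proof.
move=> [pp _ lp] /not_uniq_split[p1 [v [p2 [p3 ep]]]]; move: pp lp; rewrite ep.
rewrite cat_path last_cat /= cat_path last_cat /= => /and3P[h1 h2 /and3P[h3 h4 h5]] lp.
exists v, (p1 ++ v :: p3), (rcons p2 v); split.
- by split; [rewrite cat_path /= h1 h2 | case: (p1) | rewrite last_cat].
- by split; [rewrite rcons_path h3 | case: (p2) | rewrite last_rcons].
- by rewrite -cats1 !path_weight_cat /= !path_weight_cat /=; lia.
- by rewrite size_rcons !size_cat /= size_cat /=; lia.
Qed.

(** Strong induction on the length through [cycle_split]. A simple cycle has at least one edge, so
    that [z <= 0] gives [z * size p <= z]; the length stands in for the number of simple pieces,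
    which need not be counted. *)
Lemma cycle_weight_ge (z : int) : (z <= 0)%R ->
  (forall u p, is_simple_cycle G u p -> (z <= path_weight G u p)%R) ->
  forall u p, is_cycle G u p -> (z * (size p)%:Z <= path_weight G u p)%R.
Proof.
move=> z0 zmin u p; have [k] := ubnP (size p); elim: k u p => [//|k IH] u p lk cp.
case: (boolP (uniq p)) => [up|nup].
  have := zmin u p (conj cp up); case: cp => _; case: (p) => [//|x p' _ _] /=; nia.
have [v [q [r [cq cr -> sz]]]] := cycle_split cp nup.
have sq : 0 < size q by case: cq => _; case: (q).
have sr : 0 < size r by case: cr => _; case: (r).
have := IH u q _ cq; have := IH v r _ cr; rewrite sz; nia.
Qed.

(** The piece cut out by [cycle_split] has nonnegative weight here, so dropping it does not increase
    the weight. *)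
Lemma simple_cycle_below u p : ~ has_negative_cycle G -> is_cycle G u p ->
  exists v q, is_simple_cycle G v q /\ (path_weight G v q <= path_weight G u p)%R.
Proof.
move=> nneg; have [k] := ubnP (size p); elim: k u p => [//|k IH] u p lk cp.
case: (boolP (uniq p)) => [up|nup]; first by exists u, p.
have [v [q [r [cq cr -> sz]]]] := cycle_split cp nup.
have sr : 0 < size r by case: cr => _; case: (r).
have [|v' [q' [sq' le']]] := IH u q _ cq; first by lia.
exists v', q'; split=> //; suff : (0 <= path_weight G v r)%R by lia.
by rewrite leNgt; apply/negP => lt0; apply: nneg; exists v, r.
Qed.

Lemma simple_cycle_size u p : is_simple_cycle G u p -> size p <= n.
Proof. by case=> _ /card_uniqP <-; rewrite -[leqRHS]card_ord max_card. Qed.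

(** As simple cycles have length at most [n], they form a decidable part of a finite type of triples
    (start, length, tuple of that length), on which a minimum is reached. *)
Lemma min_simple_cycle_weight_exists : exists c, is_min_simple_cycle_weight G c.
Proof.
pose I := {x : 'I_n * 'I_n.+1 & (x.2).-tuple 'I_n}.
pose ok (i : I) := [&& path (edge G) (tag i).1 (tagged i), tval (tagged i) != [::],
  last (tag i).1 (tagged i) == (tag i).1 & uniq (tagged i)].
have okP (i : I) : ok i -> is_simple_cycle G (tag i).1 (tagged i).
  by case/and4P => ? /eqP ? /eqP ? ?; split.
have okI u p : is_simple_cycle G u p ->
    exists2 i : I, ok i & (tag i).1 = u /\ tval (tagged i) = p.
  move=> sp; have sz : size p < n.+1 by rewrite ltnS; apply: simple_cycle_size sp.
  exists (existT (fun x : 'I_n * 'I_n.+1 => (x.2).-tuple 'I_n)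
    (u, Ordinal sz) (in_tuple p)) => //.
  by case: sp => [[h1 /eqP h2 h3] h4]; rewrite /ok /= h1 h2 h3 eqxx h4.
case: (pickP ok) => [i0 ok0|none]; last first.
  by exists None => u p /okI[i]; rewrite none.
pose F (i : I) := path_weight G (tag i).1 (tagged i).
case: (@arg_minP _ _ _ i0 ok F ok0) => i oki imin; exists (Some (F i)); split.
  by exists (tag i).1, (tagged i); split=> //; apply: okP.
by move=> u p /okI[j okj [<- <-]]; apply: imin.
Qed.

End Walks.

(** * The rooted tree and its subtrees *)

Lemma path_crossing (A : eqType) (e : rel A) (P : pred A) x p :
  path e x p -> P x -> ~~ P (last x p) ->
  exists a b, [/\ e a b, P a, ~~ P b, a \in x :: p & b \in x :: p].
Proof.
elim: p x => [|y p IH] x /=; first by move=> _ ->.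
move=> /andP[xy py] Px nPl; case: (boolP (P y)) => Py; last first.
  by exists x, y; split=> //; rewrite !inE eqxx ?orbT.
have [a [b [ab Pa nPb ia ib]]] := IH y py Py nPl.
by exists a, b; split; rewrite // inE ?ia ?ib orbT.
Qed.

Lemma sum_disjointU (I : finType) (A B : {set I}) (F : I -> nat) :
  [disjoint A & B] ->
  \sum_(x in A :|: B) F x = \sum_(x in A) F x + \sum_(x in B) F x.
Proof. by move=> dAB; rewrite -bigU //; apply: eq_bigl => x; rewrite !inE. Qed.

Section Tree.
Variables (m : nat) (T : btree m).
Hypothesis rootedT : is_rooted T.
Implicit Types i j k : 'I_m.

Definition subtree i : pred 'I_m := connect (child T) i.

Lemma root_path i : exists p, path (child T) (bt_root T) p /\ last (bt_root T) p = i.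
Proof. by have [p [h _]] := rootedT.2 i; exists p. Qed.

(** The source of the shape of the tree: uniqueness of parents, acyclicity and disjointness of
    sibling subtrees are each obtained by exhibiting two walks from the root with the same end. *)
Lemma root_path_uniq p q : path (child T) (bt_root T) p ->
  path (child T) (bt_root T) q -> last (bt_root T) p = last (bt_root T) q -> p = q.
Proof.
move=> pp pq e; have [r [_ u]] := rootedT.2 (last (bt_root T) q).
by rewrite -(u p) ?(u q).
Qed.

Lemma subtree_refl i : subtree i i. Proof. exact: connect0. Qed.

Lemma subtree_root i : subtree (bt_root T) i.
Proof. by have [p [pp <-]] := root_path i; apply/connectP; exists p. Qed.

Lemma parent_uniq i i' j : child T i j -> child T i' j -> i = i'.
Proof.
move=> ij i'j; have [p [pp lp]] := root_path i; have [q [pq lq]] := root_path i'.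
have e : rcons p j = rcons q j.
  by apply: root_path_uniq; rewrite ?rcons_path ?pp ?pq ?lp ?lq // !last_rcons.
by case/rcons_inj: e => e; rewrite -lp -lq e.
Qed.

Lemma subtree_acyclic i j : child T i j -> ~~ subtree j i.
Proof.
move=> ij; apply/negP => /connectP[q pq lq]; have [p [pp lp]] := root_path i.
suff /(congr1 size): p = p ++ j :: q by rewrite size_cat /=; lia.
by apply: root_path_uniq; rewrite ?cat_path ?pp ?lp /= ?ij // last_cat /= -lq.
Qed.

Lemma subtree_disjoint i l r k :
  child T i l -> child T i r -> subtree l k -> subtree r k -> l = r.
Proof.
move=> il ir /connectP[q pq lq] /connectP[q' pq' lq'].
have [p [pp lp]] := root_path i.
have /eqP : p ++ l :: q = p ++ r :: q'.
  apply: root_path_uniq; rewrite ?cat_path ?pp ?lp /= ?il ?ir //.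
  by rewrite !last_cat /= -lq -lq'.
by rewrite eqseq_cat // eqxx /= eqseq_cons => /andP[/eqP].
Qed.

Lemma subtree_child i j k : child T i j -> subtree j k -> subtree i k.
Proof. by move=> ij; apply: connect_trans; apply: connect1. Qed.

Lemma subtreeP i k : subtree i k -> k = i \/ exists2 j, child T i j & subtree j k.
Proof.
case/connectP=> [[|j p] /=]; first by move=> _ ->; left.
by case/andP=> ij pj ->; right; exists j => //; apply/connectP; exists p.
Qed.

(** If the walk from [c] to [a] were not empty, its last step would come from the parent of [a],
    that is from [b], and [b] would lie below [c]. *)
Lemma subtree_entry c a b : child T b a -> subtree c a -> ~~ subtree c b -> a = c.
Proof.
move=> ba /connectP[p]; case/lastP: p => [|p x]; first by move=> _ ->.
rewrite rcons_path last_rcons => /andP[pp lx] e nb; subst x.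
by case/negP: nb; rewrite (parent_uniq ba lx); apply/connectP; exists p.
Qed.

Lemma bt_children_neq i j : bt_left T i = Some j -> bt_right T i <> Some j.
Proof. by move=> e e'; have := rootedT.1 i; rewrite e e'; apply. Qed.

Lemma childE i j : child T i j = (bt_left T i == Some j) || (bt_right T i == Some j).
Proof. by []. Qed.

Definition ofold (A : Type) (z : A) (f : 'I_m -> A) (o : option 'I_m) : A :=
  if o is Some j then f j else z.

(** With [sum_inner], the recursion that the running time of the traversal follows. *)
Lemma card_subtree i : #|subtree i| =
  (ofold 0 (fun j => #|subtree j|) (bt_left T i) +
   ofold 0 (fun j => #|subtree j|) (bt_right T i)).+1.
Proof.
pose A o := [set k | ofold false (fun j => subtree j k) o].
have cA o : #|A o| = ofold 0 (fun j => #|subtree j|) o.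
  by case: o => [j|]; rewrite cardsE //; apply: eq_card0.
have eI : [set k | subtree i k] = i |: (A (bt_left T i) :|: A (bt_right T i)).
  apply/setP => k; rewrite !inE; apply/idP/idP.
    case/subtreeP => [->|[j]]; first by rewrite eqxx.
    by rewrite childE => /orP[]/eqP-> /= ->; rewrite ?orbT.
  case/orP => [/eqP->|]; first exact: subtree_refl.
  case/orP; case e : (bt_left T i) => [j|] //=; case e' : (bt_right T i) => [j'|] //=;
    by apply: subtree_child; rewrite childE ?e ?e' eqxx ?orbT.
have dI : [disjoint A (bt_left T i) & A (bt_right T i)].
  rewrite -setI_eq0; apply/eqP/setP => k; rewrite !inE; apply/negP => /andP[].
  case e : (bt_left T i) => [j|] //; case e' : (bt_right T i) => [j'|] //= s s'.
  have ejj' : j = j'.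
    by apply: (subtree_disjoint (i := i) _ _ s s'); rewrite childE ?e ?e' eqxx ?orbT.
  by apply: (bt_children_neq e); rewrite e' ejj'.
rewrite -cardsE eI cardsU1 cardsU.
move: dI; rewrite -setI_eq0 => /eqP ->; rewrite cards0 subn0 !cA !inE.
have -> : ~~ (ofold false (subtree^~ i) (bt_left T i) ||
              ofold false (subtree^~ i) (bt_right T i)).
  apply/negP => /orP[]; case e : (_ T i) => [j|] //=; apply/negP;
  by apply: subtree_acyclic; rewrite childE e eqxx ?orbT.
by rewrite add1n.
Qed.

(** * Separation properties of the bags *)

Section Bags.
Variables (n : nat) (G : wdigraph n) (bag : 'I_m -> {set 'I_n}).
Hypothesis decT : is_tree_decomposition G (tree_adj T) bag.
Implicit Types (x y : 'I_n) (pb : {set 'I_n}).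

(** The tree path from [j] to [k] leaves the subtree of [c], which is possible only along the edge
    from [c] to its parent [i]; both ends of this edge are on the path, so their bags contain
    [x]. *)
Lemma bag_separation i c j k x : child T i c -> subtree c j -> ~~ subtree c k ->
  x \in bag j -> x \in bag k -> (x \in bag c) && (x \in bag i).
Proof.
case: decT => -[_ _ _ up] _ _ conn ic cj nck xj xk.
have [p [sp _]] := up j k; have [pp lp _] := sp.
have [|a [b [ab sa nsb ina inb]]] := path_crossing pp cj; first by rewrite lp.
have ba : child T b a.
  by case/orP: ab => // ab; case/negP: nsb; apply: connect_trans sa (connect1 ab).
have ea : a = c by apply: subtree_entry ba sa nsb.
have eb : b = i by apply: (parent_uniq ba); rewrite ea.
have hx z : z \in j :: p -> x \in bag z.
  by move=> zi; apply: (subsetP (conn _ _ _ _ sp zi)); rewrite inE xj xk.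
by rewrite -ea -eb !hx.
Qed.

(* [pb] plays the role of the bag of the parent of [i], or of the empty set when
   [i] is the root. *)
Definition parent_bag i pb :=
  (forall j k x, subtree i j -> ~~ subtree i k -> x \in bag j -> x \in bag k ->
     (x \in bag i) && (x \in pb)) /\
  (forall x, x \in pb -> exists2 k, ~~ subtree i k & x \in bag k).

Lemma parent_bag_root : parent_bag (bt_root T) set0.
Proof. by split=> [j k x _|x]; rewrite ?subtree_root // inE. Qed.

Lemma parent_bag_child i c : child T i c -> parent_bag c (bag i).
Proof.
move=> ic; split=> [j k x|x xi]; first exact: bag_separation.
by exists i => //; apply: subtree_acyclic.
Qed.

(** The vertices that are eliminated once the whole subtree of [i] has been processed. *)
Definition inner i := [set x | [forall k, (x \in bag k) ==> subtree i k]].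

Lemma innerP i x : reflect (forall k, x \in bag k -> subtree i k) (x \in inner i).
Proof.
by rewrite inE; apply: (iffP forallP) => h k; [apply/implyP | apply/implyP; apply: h].
Qed.

Lemma inner_root x : x \in inner (bt_root T).
Proof. by apply/innerP => k _; apply: subtree_root. Qed.

Lemma inner_bag i x : x \in inner i -> exists2 k, subtree i k & x \in bag k.
Proof.
by case: decT => _ cov _ _ /innerP h; have [k xk] := cov x; exists k => //; apply: h.
Qed.

Lemma inner_notin_parent i pb x : parent_bag i pb -> x \in inner i -> x \notin pb.
Proof.
move=> [_ hp] /innerP xi; apply/negP => /hp[k /negP nk xk]; exact/nk/xi.
Qed.

Lemma inner_child i j x : child T i j -> x \in inner j -> (x \in inner i) && (x \notin bag i).
Proof.
move=> ij xj; apply/andP; split; last exact: inner_notin_parent (parent_bag_child ij) xj.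
by apply/innerP => k /(innerP _ _ xj); apply: subtree_child.
Qed.

Lemma forgotten_inner i pb x : parent_bag i pb -> x \in bag i -> x \notin pb -> x \in inner i.
Proof.
move=> [hp _] xi /negP npb; apply/innerP => k xk; case: (boolP (subtree i k)) => // nk.
by case/andP: (hp i k x (subtree_refl i) nk xi xk).
Qed.

(** A vertex met in the subtree of a child [j] without being inner to [j] also occurs outside this
    subtree, and separation then puts it in the bag of [i]. *)
Lemma inner_cases i pb x : parent_bag i pb -> x \in inner i ->
  (x \in bag i) && (x \notin pb) \/ exists2 j, child T i j & x \in inner j.
Proof.
move=> hp xi; rewrite (inner_notin_parent hp xi) andbT.
have [k /subtreeP[->|[j ij jk]] xk] := inner_bag xi; first by left.
case: (boolP (x \in inner j)) => [|nj]; first by right; exists j.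
left; move: nj; rewrite inE negb_forall => /existsP[k']; rewrite negb_imply => /andP[xk' nk'].
by case/andP: (bag_separation ij jk nk' xk xk').
Qed.

Definition adjacent x y := edge G x y || edge G y x.

Lemma adjacent_bag x y : adjacent x y -> exists2 k, x \in bag k & y \in bag k.
Proof.
case: decT => _ _ cov _ /orP[]/cov[k /andP[]]; by exists k.
Qed.

(** The bag that covers the edge contains [x], hence lies below [i]; if [y] occurs elsewhere too,
    separation puts it in the bag of [i] and in that of the parent. *)
Lemma inner_adjacent i pb x y : parent_bag i pb -> adjacent x y -> x \in inner i ->
  y \in inner i \/ (y \in bag i) && (y \in pb).
Proof.
move=> [hp _] /adjacent_bag[k xk yk] /innerP xi.
case: (boolP (y \in inner i)) => [|ni]; first by left.
right; move: ni; rewrite inE negb_forall => /existsP[k']; rewrite negb_imply => /andP[yk' nk'].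
exact: (hp k k' y (xi k xk) nk').
Qed.

Lemma inner_siblings_adjacent i l r x y : child T i l -> child T i r ->
  x \in inner l -> y \in inner r -> adjacent x y -> l = r.
Proof.
move=> il ir /innerP xl /innerP yr /adjacent_bag[k xk yk].
exact: subtree_disjoint il ir (xl k xk) (yr k yk).
Qed.

Lemma inner_siblings_disjoint i l r x : child T i l -> child T i r ->
  x \in inner l -> x \in inner r -> l = r.
Proof.
move=> il ir xl /innerP xr; have [k lk xk] := inner_bag xl.
exact: subtree_disjoint il ir lk (xr k xk).
Qed.

Definition oinner (o : option 'I_m) : {set 'I_n} := ofold set0 inner o.

(** Every vertex is forgotten at exactly one node. With the degree for [F], this makes the total
    time spent on adjacency lists linear in their length. *)
Lemma sum_inner i pb (F : 'I_n -> nat) : parent_bag i pb ->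
  \sum_(x in inner i) F x = \sum_(x in bag i :\: pb) F x +
    (\sum_(x in oinner (bt_left T i)) F x + \sum_(x in oinner (bt_right T i)) F x).
Proof.
move=> hp.
have oin c (x : 'I_n) : c = bt_left T i \/ c = bt_right T i -> x \in oinner c ->
    exists2 j, child T i j & c = Some j /\ x \in inner j.
  case: c => [j|]; last by rewrite inE.
  by move=> h xj; exists j => //; rewrite childE; case: h => <-; rewrite eqxx ?orbT.
have -> : inner i = (bag i :\: pb) :|: (oinner (bt_left T i) :|: oinner (bt_right T i)).
  apply/setP => x; rewrite !in_setU in_setD; apply/idP/idP.
    case/(inner_cases hp) => [/andP[-> ->] //|[j]].
    by rewrite childE => /orP[]/eqP-> /= ->; rewrite ?orbT.
  case/orP=> [/andP[npb xi]|/orP[]]; first exact: forgotten_inner hp xi npb.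
    by case/(oin _ x (or_introl (erefl _)))=> j ij [_ /(inner_child ij)/andP[]].
  by case/(oin _ x (or_intror (erefl _)))=> j ij [_ /(inner_child ij)/andP[]].
rewrite sum_disjointU; last first.
  rewrite disjoint_sym -setI_eq0; apply/eqP/setP => x; rewrite !(inE, in_setI, in_setU).
  apply/negP => /andP[xo /andP[_ xi]].
  have [j ij xj] : exists2 j, child T i j & x \in inner j.
    by case/orP: xo => h; [have [j ij [_ xj]] := oin _ x (or_introl (erefl _)) h
      | have [j ij [_ xj]] := oin _ x (or_intror (erefl _)) h]; exists j.
  by case/andP: (inner_child ij xj) => _ /negP.
rewrite sum_disjointU // -setI_eq0; apply/eqP/setP => x; rewrite in_setI in_set0.
apply/negP => /andP[/(oin _ x (or_introl (erefl _)))[j ij [ej xj]]].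
move=> /(oin _ x (or_intror (erefl _)))[j' ij' [ej' xj']].
apply: (@bt_children_neq i j) => //; rewrite ej'.
by rewrite (inner_siblings_disjoint ij ij' xj xj').
Qed.

End Bags.
End Tree.

(** * A program logic with running times *)

Definition seqs (cs : seq cmd) : cmd := foldr Seq Skip cs.

(** A loop unrolled in the program text: the lists depend only on [N], so the size of the program
    does as well. *)
Definition forc (A : Type) (l : seq A) (f : A -> cmd) : cmd := seqs [seq f x | x <- l].

Section WP.
Variables (b : nat) (inp : seq (seq int)).
Implicit Types (mem : seq int) (Q : seq int -> Prop).

(** Total correctness with an upper bound on the time, rather than its exact value, so that costs
    can be rounded up on the way. *)
Definition wp (c : cmd) (t : nat) Q mem :=
  exists t' mem', [/\ exec b inp c mem t' mem', t' <= t & Q mem'].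

Lemma wp_mono c t t' Q Q' mem : wp c t Q mem -> t <= t' ->
  (forall mem', Q mem' -> Q' mem') -> wp c t' Q' mem.
Proof.
move=> [t0 [mem' [ex le q]]] le' sub; exists t0, mem'; split=> //; last exact: sub.
exact: leq_trans le le'.
Qed.

Lemma wp_skip Q mem : Q mem -> wp Skip 1 Q mem.
Proof. by move=> q; exists 1, mem; split=> //; apply: exec_skip. Qed.

Lemma wp_store ea ev k z Q mem : eval b inp mem ea = Some (Posz k) -> k < size mem ->
  eval b inp mem ev = Some z -> Q (set_nth 0%R mem k z) ->
  wp (Store ea ev) (expr_cost ea + expr_cost ev).+1 Q mem.
Proof. by move=> ha hk hv q; do 2!eexists; split; [exact: exec_store ha hk hv|by []|]. Qed.

Lemma wp_seq c1 c2 t1 t2 Q mem : wp c1 t1 (wp c2 t2 Q) mem -> wp (Seq c1 c2) (t1 + t2) Q mem.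
Proof.
move=> [t1' [mem1 [e1 l1 [t2' [mem2 [e2 l2 q]]]]]].
by do 2!eexists; split; [apply: exec_seq e1 e2|lia|].
Qed.

Lemma wp_if e c1 c2 z t Q mem : eval b inp mem e = Some z ->
  (z <> 0%R -> wp c1 t Q mem) -> (z = 0%R -> wp c2 t Q mem) ->
  wp (If e c1 c2) (expr_cost e + t).+1 Q mem.
Proof.
move=> he h1 h2; case: (eqVneq z 0%R) => [z0|/eqP z0].
  have [t' [mem' [ex l q]]] := h2 z0; subst z.
  by do 2!eexists; split; [apply: exec_if_false he ex|lia|].
have [t' [mem' [ex l q]]] := h1 z0.
by do 2!eexists; split; [apply: exec_if_true he z0 ex|lia|].
Qed.

Lemma wp_forc (A : Type) (f : A -> cmd) (t : A -> nat) (I : seq A -> seq int -> Prop)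
    (l : seq A) mem :
  (forall l1 x l2 mem, l = l1 ++ x :: l2 -> I l1 mem ->
     wp (f x) (t x) (I (rcons l1 x)) mem) ->
  I [::] mem -> wp (forc l f) (\sum_(x <- l) t x).+1 (I l) mem.
Proof.
move=> h; suff gen l0 l' mem0 : l = l0 ++ l' -> I l0 mem0 ->
    wp (forc l' f) (\sum_(x <- l') t x).+1 (I l) mem0 by exact: (gen [::]).
elim: l' l0 mem0 => [|x l' IH] l0 mem0 e i0.
  by rewrite big_nil; apply: wp_skip; rewrite e cats0.
rewrite big_cons -addnS; apply: wp_seq.
apply: wp_mono (h l0 x l' mem0 e i0) _ _ => // mem' i1.
by apply: IH i1; rewrite cat_rcons.
Qed.

Lemma wp_forc_const (A : Type) (f : A -> cmd) (t : nat) (I : seq A -> seq int -> Prop)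
    (l : seq A) mem :
  (forall l1 x l2 mem, l = l1 ++ x :: l2 -> I l1 mem -> wp (f x) t (I (rcons l1 x)) mem) ->
  I [::] mem -> wp (forc l f) (size l * t).+1 (I l) mem.
Proof.
move=> h i0; apply: wp_mono (wp_forc (t := fun=> t) h i0) _ _ => //.
by rewrite big_const_seq count_predT iter_addn_0 mulnC.
Qed.

Lemma wp_while_count e c (t d : nat) (I : nat -> seq int -> Prop) k mem :
  (forall k mem, k < d -> I k mem ->
     (exists2 z, eval b inp mem e = Some z & z <> 0%R) /\ wp c t (I k.+1) mem) ->
  (forall mem, I d mem -> eval b inp mem e = Some 0%R) -> k <= d -> I k mem ->
  wp (While e c) ((d - k) * (expr_cost e + t).+1 + (expr_cost e).+1) (I d) mem.
Proof.
move=> h h0; move er: (d - k) => r; elim: r k mem er => [|r IH] k mem er kd i0.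
  have e0 : k = d by lia.
  by subst k; do 2!eexists; split; [apply/exec_while_false/h0|lia|].
have [|[z hz z0] [t1 [mem1 [e1 l1 i1]]]] := h k mem _ i0; first lia.
have [||t2 [mem2 [e2 l2 i2]]] := IH k.+1 mem1 _ _ i1; [lia|lia|].
by do 2!eexists; split; [apply: exec_while_true hz z0 e1 e2|lia|].
Qed.

(* A partial execution of a loop, in continuation form: such executions compose,
   which an [exec] of the whole loop does not. *)
Definition steps (e : expr) (c : cmd) (t : nat) Q mem :=
  exists t1 mem', [/\ t1 <= t, Q mem' & forall t2 mem'',
    exec b inp (While e c) mem' t2 mem'' -> exec b inp (While e c) mem (t1 + t2) mem''].

Lemma steps_refl e c Q mem : Q mem -> steps e c 0 Q mem.
Proof. by move=> q; exists 0, mem. Qed.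

Lemma steps_mono e c t t' Q Q' mem : steps e c t Q mem -> t <= t' ->
  (forall mem', Q mem' -> Q' mem') -> steps e c t' Q' mem.
Proof.
move=> [t0 [mem' [le q ex]]] le' sub; exists t0, mem'; split=> //; last exact: sub.
exact: leq_trans le le'.
Qed.

Lemma steps_trans e c t1 t2 Q mem :
  steps e c t1 (steps e c t2 Q) mem -> steps e c (t1 + t2) Q mem.
Proof.
move=> [t1' [mem1 [l1 [t2' [mem2 [l2 q h2]]] h1]]]; exists (t1' + t2'), mem2.
by split=> // [|t mem3 /h2/h1]; [lia|rewrite addnA].
Qed.

Lemma steps_iter e c z t Q mem : eval b inp mem e = Some z -> z <> 0%R ->
  wp c t Q mem -> steps e c (expr_cost e + t).+1 Q mem.
Proof.
move=> hz z0 [t1 [mem1 [e1 l1 q]]]; exists (expr_cost e + t1).+1, mem1; split=> //; first by lia.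
by move=> t2 mem2 e2; rewrite addSn; apply: exec_while_true hz z0 e1 e2.
Qed.

Lemma wp_while_steps e c t Q mem : steps e c t Q mem ->
  (forall mem', Q mem' -> eval b inp mem' e = Some 0%R) ->
  wp (While e c) (t + (expr_cost e).+1) Q mem.
Proof.
move=> [t1 [mem1 [l1 q h]]] h0; do 2!eexists; split; last exact: q.
  by apply: h; apply/exec_while_false/h0.
by lia.
Qed.

Lemma eval_const mem z : absz z <= b -> eval b inp mem (Const z) = Some z.
Proof. by rewrite /= /word => ->. Qed.

Lemma lookup_nth (s : seq int) k : k < size s -> lookup s (Posz k) = Some (nth 0%R s k).
Proof. by elim: s k => [|x s IH] [|k] //=; apply: IH. Qed.

Lemma eval_cell mem e k : eval b inp mem e = Some (Posz k) -> k < size mem ->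
  absz (nth 0%R mem k) <= b -> eval b inp mem (Cell e) = Some (nth 0%R mem k).
Proof. by move=> /= -> /= /lookup_nth /= -> /=; rewrite /word => ->. Qed.

Lemma eval_input mem a e k : eval b inp mem e = Some (Posz k) ->
  k < size (nth [::] inp a) -> absz (nth 0%R (nth [::] inp a) k) <= b ->
  eval b inp mem (Input a e) = Some (nth 0%R (nth [::] inp a) k).
Proof. by move=> /= -> /= /lookup_nth /= -> /=; rewrite /word => ->. Qed.

Lemma eval_op mem o e1 e2 x y : eval b inp mem e1 = Some x ->
  eval b inp mem e2 = Some y -> absz (eval_binop o x y) <= b ->
  eval b inp mem (Op o e1 e2) = Some (eval_binop o x y).
Proof. by move=> /= -> -> /=; rewrite /word => ->. Qed.

Hypothesis b_gt0 : 0 < b.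

Lemma eval_eq mem e1 e2 x y : eval b inp mem e1 = Some x -> eval b inp mem e2 = Some y ->
  eval b inp mem (Op OpEq e1 e2) = Some (Posz (x == y)).
Proof. by move=> h1 h2; apply: eval_op h1 h2 _ => /=; case: eqP. Qed.

Lemma eval_le mem e1 e2 x y : eval b inp mem e1 = Some x -> eval b inp mem e2 = Some y ->
  eval b inp mem (Op OpLe e1 e2) = Some (Posz (x <= y)%R).
Proof. by move=> h1 h2; apply: eval_op h1 h2 _ => /=; case: (_ <= _)%R. Qed.

Lemma eval_and mem e1 e2 x y : eval b inp mem e1 = Some x -> eval b inp mem e2 = Some y ->
  eval b inp mem (Op OpAnd e1 e2) = Some (Posz ((x != 0%R) && (y != 0%R))).
Proof. by move=> h1 h2; apply: eval_op h1 h2 _ => /=; case: (_ && _). Qed.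

Lemma eval_or mem e1 e2 x y : eval b inp mem e1 = Some x -> eval b inp mem e2 = Some y ->
  eval b inp mem (Op OpOr e1 e2) = Some (Posz ((x != 0%R) || (y != 0%R))).
Proof. by move=> h1 h2; apply: eval_op h1 h2 _ => /=; case: (_ || _). Qed.

End WP.

Arguments eval : simpl never.

Lemma Posz_boolE (c : bool) : (Posz c != 0%R) = c.
Proof. by case: c. Qed.

Lemma Posz_bool_neq0 (c : bool) : Posz c <> 0%R -> c.
Proof. by case: c. Qed.

Lemma Posz_bool_eq0 (c : bool) : Posz c = 0%R -> c = false.
Proof. by case: c. Qed.

Lemma set_nth_id (mem : seq int) k : k < size mem -> set_nth 0%R mem k (nth 0%R mem k) = mem.
Proof.
move=> km; apply: (@eq_from_nth _ 0%R); rewrite size_set_nth; first exact/maxn_idPr.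
by move=> i _; rewrite nth_set_nth /=; case: eqP => // ->.
Qed.

Lemma size_set_nth_lt (mem : seq int) k z : k < size mem -> size (set_nth 0%R mem k z) = size mem.
Proof. by move=> km; rewrite size_set_nth; apply/maxn_idPr. Qed.

(** * Extended integers *)

Definition omin (x y : option int) : option int :=
  match x, y with
  | Some x', Some y' => Some (if (y' <= x')%R then y' else x')
  | Some _, None => x
  | None, _ => y
  end.

Definition oadd (x y : option int) : option int :=
  match x, y with Some x', Some y' => Some (x' + y')%R | _, _ => None end.

Definition ole (x : option int) (z : int) : bool :=
  if x is Some x' then (x' <= z)%R else false.

(* Infinity is the word 0, which the odd words never meet. *)
Definition encz (x : option int) : int := if x is Some z then (2 * z + 1)%R else 0%R.

Lemma ole_omin x y z : ole (omin x y) z = ole x z || ole y z.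
Proof. by case: x y => [x|] [y|] //=; rewrite ?orbF //; case: ifP; lia. Qed.

Lemma omin_cases x y : omin x y = x \/ omin x y = y.
Proof. by case: x y => [x|] [y|] /=; auto; case: ifP; auto. Qed.

Lemma ole_oadd x y z z' : ole x z -> ole y z' -> ole (oadd x y) (z + z').
Proof. by case: x y => [x|] [y|] //=; lia. Qed.

Lemma encz_eq0 x : (encz x == 0%R) = (x == None).
Proof. by case: x => [z|] //=; apply/negbTE; lia. Qed.

(** Encoded words can be compared directly, since [2 * z + 1] increases with [z]; only infinity
    needs separate tests, for the new value by the conjunction and for the old one by the
    disjunction. *)
Definition mergec (ax ey : expr) : cmd :=
  If (Op OpAnd ey (Op OpOr (Op OpEq (Cell ax) (Const 0%R)) (Op OpLe ey (Cell ax))))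
     (Store ax ey) Skip.

Definition mergec_cost (ax ey : expr) : nat :=
  (expr_cost ax + expr_cost ey) * 5 + 12.

Lemma wp_mergec b inp ax ey k x y mem (Q : seq int -> Prop) : 0 < b ->
  eval b inp mem ax = Some (Posz k) -> k < size mem -> nth 0%R mem k = encz x ->
  absz (encz x) <= b -> eval b inp mem ey = Some (encz y) ->
  Q (set_nth 0%R mem k (encz (omin x y))) -> wp b inp (mergec ax ey) (mergec_cost ax ey) Q mem.
Proof.
move=> b0 hax km hx bx hey q.
have hcx : eval b inp mem (Cell ax) = Some (encz x) by rewrite -hx; apply: eval_cell; rewrite ?hx.
have h0 : eval b inp mem (Const 0%R) = Some 0%R by apply: eval_const.
have h1 := eval_and b0 hey (eval_or b0 (eval_eq b0 hcx h0) (eval_le b0 hey hcx)).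
apply: wp_mono (wp_if (Q := Q) (t := (expr_cost ax + expr_cost ey).+1) h1 _ _) _ _ => //.
- move=> /Posz_bool_neq0 z0; apply: (wp_store hax km hey).
  have <- : omin x y = y; last by [].
  move: z0; rewrite !encz_eq0; case: (x) (y) => [x'|] [y'|] //= z0; congr Some.
  by case: ifP => // lt; exfalso; move: z0; lia.
- move=> /Posz_bool_eq0 z0; apply: wp_mono (wp_skip _ _ (Q := Q) _) _ _ => //.
  rewrite -(set_nth_id km) hx; have <- : omin x y = x; last by [].
  move: z0; rewrite !encz_eq0; case: (x) (y) => [x'|] [y'|] //= z0; congr Some.
  by case: ifP => // le; exfalso; move: z0; lia.
- by rewrite /mergec_cost /=; lia.
Qed.

(** * The program *)

Section Program.
Variable N : nat.

(* Cell 1 holds the encoded minimum found so far, cell 2 the address of the top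
   frame of the stack, and cells 3 and 4 delimit the part of an adjacency list
   which remains to be read. A frame consists of a node of the tree, the number
   of its children already visited, [N] vertices, and an [N] by [N] table. *)
Definition off_v (a : nat) : nat := 2 + a.
Definition off_t (a b : nat) : nat := 2 + N + (a * N + b).
Definition fsize : nat := 2 + N + N * N.

(** All accesses are relative to the stack pointer in cell 2: [cur] reads the top frame, [par] the
    frame of the parent node below it, and [nxt] addresses the frame about to be pushed. *)
Definition adr (k : int) : expr := Op OpAdd (Cell (Const 2%:Z)) (Const k).
Definition cur (k : nat) : expr := Cell (adr (Posz k)).
Definition padr (k : nat) : expr := adr (Posz k - Posz fsize)%R.
Definition par (k : nat) : expr := Cell (padr k).
Definition nxt (k : nat) : expr := adr (Posz (fsize + k)).

Definition slots : seq nat := iota 0 N.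
Definition pairs : seq (nat * nat) := [seq (a, b) | a <- slots, b <- slots].

(** Vertices are stored plus one, so that 0 marks the empty slots of a bag with fewer than [N]
    vertices. The test compares offsets to decide whether the bag has an item number [a]. *)
Definition load_slot (a : nat) : cmd :=
  let j := Cell (nxt 0) in
  If (Op OpLe (Op OpAdd (Input 7 j) (Const (Posz a.+1))) (Input 7 (Op OpAdd j (Const 1%:Z))))
    (Store (nxt (off_v a))
       (Op OpAdd (Input 8 (Op OpAdd (Input 7 j) (Const (Posz a)))) (Const 1%:Z)))
    (Store (nxt (off_v a)) (Const 0%:Z)).

(** The stack pointer moves last, because the [nxt] addresses are relative to its old value. The
    table must be cleared, as a popped frame may have left its entries there. *)
Definition push (e : expr) : cmd :=
  Seq (Store (nxt 0) e) (Seq (Store (nxt 1) (Const 0%:Z))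
  (Seq (forc slots load_slot)
  (Seq (forc pairs (fun ab => Store (nxt (off_t ab.1 ab.2)) (Const 0%:Z)))
       (Store (Const 2%:Z) (nxt 0))))).

(** The new state is recorded before the push, while [cur] still designates the node itself. A
    missing child is the word -1, hence the sign test. *)
Definition visit (arr : nat) (s : int) : cmd :=
  Seq (Store (adr 1%:Z) (Const s))
      (If (Op OpLe (Const 0%:Z) (Input arr (cur 0))) (push (Input arr (cur 0))) Skip).

(** Nonzero when slot [a] is occupied by a vertex absent from the parent frame, the subtraction
    serving as a test for difference. Below the frame of the root lies a frame with empty slots
    only, so the root forgets its whole bag. *)
Definition forgotten (a : nat) : expr :=
  foldr (fun p e => Op OpAnd (Op OpSub (cur (off_v a)) (par (off_v p))) e)
    (cur (off_v a)) slots.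

(** [tl q] is the table entry of the edge joining the scanned vertex to slot [q]: row or column
    according to the direction of the edges. *)
Definition scan_slot (at' aw : nat) (tl : nat -> nat * nat) (q : nat) : cmd :=
  If (Op OpEq (Op OpAdd (Input at' (Cell (Const 3%:Z))) (Const 1%:Z)) (cur (off_v q)))
     (mergec (adr (Posz (off_t (tl q).1 (tl q).2)))
        (Op OpAdd (Op OpMul (Const 2%:Z) (Input aw (Cell (Const 3%:Z)))) (Const 1%:Z)))
     Skip.

Definition scan_body (at' aw : nat) (tl : nat -> nat * nat) : cmd :=
  Seq (forc slots (scan_slot at' aw tl))
      (Store (Const 3%:Z) (Op OpAdd (Cell (Const 3%:Z)) (Const 1%:Z))).

Definition scan_cond : expr := Op OpSub (Cell (Const 4%:Z)) (Cell (Const 3%:Z)).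

(** Since slots hold the vertex plus one, the word in the slot is the index of the end of the list,
    and its predecessor the index of the start. *)
Definition scan (ao at' aw : nat) (tl : nat -> nat * nat) (a : nat) : cmd :=
  Seq (Store (Const 3%:Z) (Input ao (Op OpSub (cur (off_v a)) (Const 1%:Z))))
  (Seq (Store (Const 4%:Z) (Input ao (cur (off_v a))))
       (While scan_cond (scan_body at' aw tl))).

Definition scan_edges (a : nat) : cmd :=
  If (forgotten a)
     (Seq (scan 1 2 3 (fun q => (a, q)) a) (scan 4 5 6 (fun q => (q, a)) a)) Skip.

(** For finite entries, [l + r - 1] is the encoding of the sum. Infinity has to be tested apart, its
    word being 0. *)
Definition relax (a : nat) (xy : nat * nat) : cmd :=
  let l := cur (off_t xy.1 a) in let r := cur (off_t a xy.2) in
  If (Op OpAnd l r)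
     (mergec (adr (Posz (off_t xy.1 xy.2))) (Op OpSub (Op OpAdd l r) (Const 1%:Z))) Skip.

Definition eliminate (a : nat) : cmd :=
  If (forgotten a)
     (Seq (mergec (Const 1%:Z) (cur (off_t a a))) (forc pairs (relax a))) Skip.

(** Two empty slots match as well; this is harmless because [sound] forces the entries of an empty
    slot to be infinite. *)
Definition merge_parent (x : (nat * nat) * (nat * nat)) : cmd :=
  let: ((a, b), (p, q)) := x in
  If (Op OpAnd (Op OpEq (cur (off_v a)) (par (off_v p)))
               (Op OpEq (cur (off_v b)) (par (off_v q))))
     (mergec (padr (off_t p q)) (cur (off_t a b))) Skip.

(** All edges of the forgotten vertices have to be in the table before the first elimination, which
    combines them. The last store pops the frame. *)
Definition finalize : cmd :=
  Seq (forc slots scan_edges) (Seq (forc slots eliminate)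
  (Seq (forc [seq (x, y) | x <- pairs, y <- pairs] merge_parent)
       (Store (Const 2%:Z) (adr (- Posz fsize)%R)))).

(** Address 5 is that of the dummy frame under the root, so the loop stops when the frame of the
    root is popped. *)
Definition loop_cond : expr := Op OpSub (Cell (Const 2%:Z)) (Const 5%:Z).

Definition loop_body : cmd :=
  If (Op OpEq (cur 1) (Const 2%:Z)) finalize
     (If (Op OpEq (cur 1) (Const 1%:Z)) (visit 10 2%:Z) (visit 9 1%:Z)).

Definition program : cmd :=
  Seq (Store (Const 2%:Z) (Const 5%:Z))
  (Seq (push (Input 0 (Const 2%:Z)))
  (Seq (While loop_cond loop_body)
       (If (Cell (Const 1%:Z))
           (Seq (Store (Const 0%:Z) (Const 1%:Z))
                (Store (Const 1%:Z)
                   (Op OpDiv (Op OpSub (Cell (Const 1%:Z)) (Const 1%:Z)) (Const 2%:Z))))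
           Skip))).

End Program.

Lemma mem_slots N a : (a \in slots N) = (a < N).
Proof. by rewrite mem_iota add0n. Qed.

Lemma mem_pairs N a b : ((a, b) \in pairs N) = (a < N) && (b < N).
Proof.
apply/allpairsP/andP => [[[x y] /= [ix iy [-> ->]]]|[la lb]].
  by rewrite -!mem_slots.
by exists (a, b); rewrite !mem_slots.
Qed.

(** * Memory states *)

Section State.
Variables (n N : nat).

Definition encv (x : option 'I_n) : int := if x is Some v then Posz v.+1 else 0%R.

Record frame := Frame {
  fnode : int; fstate : int; fvs : nat -> option 'I_n; ftab : nat -> nat -> option int }.

Definition set_tab (f : frame) (a b : nat) (z : option int) : frame :=
  Frame (fnode f) (fstate f) (fvs f)
    (fun a' b' => if (a' == a) && (b' == b) then z else ftab f a' b').

Definition set_state (f : frame) (s : int) : frame :=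
  Frame (fnode f) s (fvs f) (ftab f).

Local Notation offt := (off_t N).
Local Notation fsz := (fsize N).
Implicit Types (mem : seq int) (f pf cf : frame) (c z : option int) (B : nat).

Definition is_frame mem B f :=
  [/\ nth 0%R mem B = fnode f, nth 0%R mem B.+1 = fstate f,
      forall a, a < N -> nth 0%R mem (B + off_v a) = encv (fvs f a)
    & forall a b, a < N -> b < N -> nth 0%R mem (B + offt a b) = encz (ftab f a b)].

Lemma off_v_lt a : a < N -> off_v a < 2 + N.
Proof. by rewrite /off_v; lia. Qed.

Lemma off_t_bounds a b : a < N -> b < N -> 2 + N <= offt a b < fsz.
Proof. by rewrite /off_t /fsize; nia. Qed.

Lemma off_t_inj a b a' b' : b < N -> b' < N -> offt a b = offt a' b' -> a = a' /\ b = b'.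
Proof.
rewrite /off_t => lb lb' /addnI e; have N0 : 0 < N by lia.
have := congr1 (fun x => x %/ N) e; have := congr1 (fun x => x %% N) e.
by rewrite /= !modnMDl !modn_small // !divnMDl // !divn_small // !addn0.
Qed.

Lemma is_frame_ext mem mem' B f :
  (forall k, B <= k < B + fsz -> nth 0%R mem' k = nth 0%R mem k) ->
  is_frame mem B f -> is_frame mem' B f.
Proof.
move=> h [h1 h2 h3 h4]; have F : 1 < fsz by rewrite /fsize; lia.
have F' : 2 + N <= fsz by rewrite /fsize; lia.
split=> [||a la|a b la lb].
- by rewrite h //; lia.
- by rewrite h //; lia.
- by rewrite h; [apply: h3|have := off_v_lt la; lia].
- by rewrite h; [apply: h4|have := off_t_bounds la lb; lia].
Qed.

Lemma nth_set_nth_neq mem i k (z : int) : k <> i -> nth 0%R (set_nth 0%R mem i z) k = nth 0%R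
  mem k.
Proof. by move=> ne; rewrite nth_set_nth /=; case: eqP. Qed.

Lemma nth_set_nth_eq mem i (z : int) : nth 0%R (set_nth 0%R mem i z) i = z.
Proof. by rewrite nth_set_nth /= eqxx. Qed.

Lemma is_frame_set_tab mem B f a b z : a < N -> b < N -> is_frame mem B f ->
  is_frame (set_nth 0%R mem (B + offt a b) (encz z)) B (set_tab f a b z).
Proof.
move=> la lb [h1 h2 h3 h4]; have ob := off_t_bounds la lb.
split=> [||a' la'|a' b' la' lb'].
- by rewrite nth_set_nth_neq //; lia.
- by rewrite nth_set_nth_neq //; lia.
- by rewrite nth_set_nth_neq; [apply: h3|have := off_v_lt la'; lia].
rewrite nth_set_nth /=; case: eqP => [/addnI e|ne].
  by have [-> ->] := off_t_inj lb' lb e; rewrite !eqxx.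
rewrite ifN; first exact: h4.
by apply/negP => /andP[/eqP e1 /eqP e2]; apply: ne; rewrite e1 e2.
Qed.

(* The cells below the frame at [B] are those of [mem0], except for the
   variables. *)
Record top mem0 B c f mem : Prop := Top {
  top_size : size mem = size mem0;
  top_fits : B + fsz <= size mem;
  top_low : 5 <= B;
  top_c : nth 0%R mem 1 = encz c;
  top_B : nth 0%R mem 2 = Posz B;
  top_f : is_frame mem B f;
  top_rest : forall k, k = 0 \/ 5 <= k < B -> nth 0%R mem k = nth 0%R mem0 k }.

(** The commands of a node work on its own frame [cf] and on the frame [pf] of its parent, so both
    are described, together with the two scan variables. *)
Record top2 mem0 B c (e3 e4 : int) pf cf mem : Prop := Top2 {
  top2_size : size mem = size mem0;
  top2_fits : B + fsz + fsz <= size mem;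
  top2_low : 5 <= B;
  top2_c : nth 0%R mem 1 = encz c;
  top2_B : nth 0%R mem 2 = Posz (B + fsz);
  top2_3 : nth 0%R mem 3 = e3;
  top2_4 : nth 0%R mem 4 = e4;
  top2_pf : is_frame mem B pf;
  top2_cf : is_frame mem (B + fsz) cf;
  top2_rest : forall k, k = 0 \/ 5 <= k < B -> nth 0%R mem k = nth 0%R mem0 k }.

Lemma fsize_gt1 : 1 < fsz. Proof. by rewrite /fsize; lia. Qed.

Lemma top2_set_cur mem0 B c e3 e4 pf cf mem a b z : a < N -> b < N ->
  top2 mem0 B c e3 e4 pf cf mem ->
  top2 mem0 B c e3 e4 pf (set_tab cf a b z)
    (set_nth 0%R mem (B + fsz + offt a b) (encz z)).
Proof.
move=> la lb [h0 h1 h2 h3 h4 h5 h6 h7 h8 h9]; have ob := off_t_bounds la lb.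
have sz : size (set_nth 0%R mem (B + fsz + offt a b) (encz z)) = size mem.
  by apply: size_set_nth_lt; lia.
have nn k : k < B + fsz ->
    nth 0%R (set_nth 0%R mem (B + fsz + offt a b) (encz z)) k = nth 0%R mem k.
  by move=> lk; apply: nth_set_nth_neq; lia.
split; rewrite ?sz ?nn //; try (by lia).
- by apply: is_frame_ext h7 => k hk; rewrite nn //; lia.
- exact: is_frame_set_tab.
- by move=> k hk; rewrite nn; [apply: h9|lia].
Qed.

Lemma top2_set_par mem0 B c e3 e4 pf cf mem a b z : a < N -> b < N ->
  top2 mem0 B c e3 e4 pf cf mem ->
  top2 mem0 B c e3 e4 (set_tab pf a b z) cf (set_nth 0%R mem (B + offt a b) (encz z)).
Proof.
move=> la lb [h0 h1 h2 h3 h4 h5 h6 h7 h8 h9]; have ob := off_t_bounds la lb.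
have sz : size (set_nth 0%R mem (B + offt a b) (encz z)) = size mem.
  by apply: size_set_nth_lt; lia.
have nn k : k < B \/ B + fsz <= k ->
    nth 0%R (set_nth 0%R mem (B + offt a b) (encz z)) k = nth 0%R mem k.
  by move=> lk; apply: nth_set_nth_neq; lia.
split; rewrite ?sz ?nn //; try (by lia).
- exact: is_frame_set_tab.
- by apply: is_frame_ext h8 => k hk; rewrite nn //; lia.
- by move=> k hk; rewrite nn; [apply: h9|lia].
Qed.

Lemma top2_set_c mem0 B c e3 e4 pf cf mem z :
  top2 mem0 B c e3 e4 pf cf mem ->
  top2 mem0 B z e3 e4 pf cf (set_nth 0%R mem 1 (encz z)).
Proof.
move=> [h0 h1 h2 h3 h4 h5 h6 h7 h8 h9].
have sz : size (set_nth 0%R mem 1 (encz z)) = size mem by apply: size_set_nth_lt; lia.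
have nn k : k <> 1 -> nth 0%R (set_nth 0%R mem 1 (encz z)) k = nth 0%R mem k.
  exact: nth_set_nth_neq.
split; rewrite ?sz ?nth_set_nth_eq ?nn //.
- by apply: is_frame_ext h7 => k hk; rewrite nn //; lia.
- by apply: is_frame_ext h8 => k hk; rewrite nn //; lia.
- by move=> k hk; rewrite nn; [apply: h9|lia].
Qed.

Lemma top2_set_3 mem0 B c e3 e4 pf cf mem (z : int) :
  top2 mem0 B c e3 e4 pf cf mem -> top2 mem0 B c z e4 pf cf (set_nth 0%R mem 3 z).
Proof.
move=> [h0 h1 h2 h3 h4 h5 h6 h7 h8 h9].
have sz : size (set_nth 0%R mem 3 z) = size mem by apply: size_set_nth_lt; lia.
have nn k : k <> 3 -> nth 0%R (set_nth 0%R mem 3 z) k = nth 0%R mem k.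
  exact: nth_set_nth_neq.
split; rewrite ?sz ?nth_set_nth_eq ?nn //.
- by apply: is_frame_ext h7 => k hk; rewrite nn //; lia.
- by apply: is_frame_ext h8 => k hk; rewrite nn //; lia.
- by move=> k hk; rewrite nn; [apply: h9|lia].
Qed.

Lemma top2_set_4 mem0 B c e3 e4 pf cf mem (z : int) :
  top2 mem0 B c e3 e4 pf cf mem -> top2 mem0 B c e3 z pf cf (set_nth 0%R mem 4 z).
Proof.
move=> [h0 h1 h2 h3 h4 h5 h6 h7 h8 h9].
have sz : size (set_nth 0%R mem 4 z) = size mem by apply: size_set_nth_lt; lia.
have nn k : k <> 4 -> nth 0%R (set_nth 0%R mem 4 z) k = nth 0%R mem k.
  exact: nth_set_nth_neq.
split; rewrite ?sz ?nth_set_nth_eq ?nn //.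
- by apply: is_frame_ext h7 => k hk; rewrite nn //; lia.
- by apply: is_frame_ext h8 => k hk; rewrite nn //; lia.
- by move=> k hk; rewrite nn; [apply: h9|lia].
Qed.

Lemma top2_pop mem0 B c e3 e4 pf cf mem :
  top2 mem0 B c e3 e4 pf cf mem -> top mem0 B c pf (set_nth 0%R mem 2 (Posz B)).
Proof.
move=> [h0 h1 h2 h3 h4 h5 h6 h7 h8 h9].
have sz : size (set_nth 0%R mem 2 (Posz B)) = size mem by apply: size_set_nth_lt; lia.
have nn k : k <> 2 -> nth 0%R (set_nth 0%R mem 2 (Posz B)) k = nth 0%R mem k.
  exact: nth_set_nth_neq.
split; rewrite ?sz ?nth_set_nth_eq ?nn //; first by lia.
- by apply: is_frame_ext h7 => k hk; rewrite nn //; lia.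
- by move=> k hk; rewrite nn; [apply: h9|lia].
Qed.

(** While a child of the node is processed, only the variables and the cells from address [B + fsz]
    on may change; the frame [pf] lies in the part left intact. *)
Lemma top2_return mem0 mem B c c' e3 e4 pf cf cf' mem' :
  top2 mem0 B c e3 e4 pf cf mem -> top mem (B + fsz) c' cf' mem' ->
  top2 mem0 B c' (nth 0%R mem' 3) (nth 0%R mem' 4) pf cf' mem'.
Proof.
move=> [h0 h1 h2 h3 h4 h5 h6 h7 h8 h9] [g0 g1 g2 g3 g4 g5 g6].
split=> //; first by rewrite g0.
- by apply: is_frame_ext h7 => k hk; apply: g6; lia.
- by move=> k hk; rewrite g6; [apply: h9|lia].
Qed.

Lemma top2_top mem0 B c e3 e4 pf cf mem :
  top2 mem0 B c e3 e4 pf cf mem -> top mem (B + fsz) c cf mem.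
Proof. by case=> *; split=> //; lia. Qed.

Lemma top2_set_state mem0 B c e3 e4 pf cf mem s :
  top2 mem0 B c e3 e4 pf cf mem ->
  top2 mem0 B c e3 e4 pf (set_state cf s) (set_nth 0%R mem (B + fsz).+1 s).
Proof.
move=> [h0 h1 h2 h3 h4 h5 h6 h7 h8 h9]; have F := fsize_gt1.
have sz : size (set_nth 0%R mem (B + fsz).+1 s) = size mem.
  by apply: size_set_nth_lt; lia.
have nn k : k <> (B + fsz).+1 ->
    nth 0%R (set_nth 0%R mem (B + fsz).+1 s) k = nth 0%R mem k.
  exact: nth_set_nth_neq.
split; rewrite ?sz ?nn //; try (by lia).
- by apply: is_frame_ext h7 => k hk; rewrite nn //; lia.
- case: h8 => g1 g2 g3 g4; split=> [||a la|a b la lb].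
  + by rewrite nn //; lia.
  + exact: nth_set_nth_eq.
  + by rewrite nn; [apply: g3|rewrite /off_v; lia].
  + by rewrite nn; [apply: g4|rewrite /off_t; lia].
- by move=> k hk; rewrite nn; [apply: h9|lia].
Qed.

End State.

Lemma encv_inj n : injective (@encv n).
Proof. by move=> [x|] [y|] //= [] /val_inj ->. Qed.

(** * Execution of the elementary table operations *)

Section Commands.
Variables (n N b M sp : nat) (inp : seq (seq int)).
Local Notation offt := (off_t N).
Local Notation fsz := (fsize N).
Hypothesis b_sp : sp + 2 * fsz + 10 <= b.
(** [relax] forms the sum of two encoded entries, of absolute value up to [4 * M + 2], before
    subtracting 1. *)
Hypothesis b_M : 4 * M + 4 <= b.
Hypothesis b_n : n + 2 <= b.
Implicit Types (f pf cf : frame n) (Q : seq int -> Prop).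

Let b_gt0 : 0 < b. Proof. by lia. Qed.

Definition bounded f :=
  forall a b z, a < N -> b < N -> ftab f a b = Some z -> absz z <= M.

Definition obounded (c : option int) := forall z, c = Some z -> absz z <= M.

Lemma encz_fits c : obounded c -> absz (encz c) <= b.
Proof. by case: c => [z|] //= /(_ z (erefl _)); lia. Qed.

Lemma encv_range (x : option 'I_n) : (0 <= encv x <= Posz n)%R.
Proof. by case: x => [v|] //=; have := ltn_ord v; lia. Qed.

Lemma encv_fits (x : option 'I_n) : absz (encv x) <= b.
Proof. by have := encv_range x; lia. Qed.

Section TwoFrames.
Variables (mem0 mem : seq int) (B : nat) (c : option int) (e3 e4 : int) (pf cf : frame n).
Hypothesis szm : size mem0 = sp.
Hypothesis H : top2 N mem0 B c e3 e4 pf cf mem.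

Let szmem : size mem = sp. Proof. by rewrite (top2_size H). Qed.
Let fits : B + fsz + fsz <= sp. Proof. by rewrite -szmem (top2_fits H). Qed.
Let low : 5 <= B. Proof. exact: top2_low H. Qed.

Lemma eval_var k z : nth 0%R mem k = z -> k < 5 -> absz z <= b ->
  eval b inp mem (Cell (Const (Posz k))) = Some z.
Proof.
move=> <- lk hz; apply: eval_cell => //; last by lia.
by apply: eval_const => /=; lia.
Qed.

Lemma eval_adr (k : int) j : (Posz (B + fsz) + k)%R = Posz j -> absz k <= b -> j <= b ->
  eval b inp mem (adr k) = Some (Posz j).
Proof.
move=> e hk hj; rewrite /adr (@eval_op _ _ _ OpAdd _ _ (Posz (B + fsz)) k) /= ?e //.
  by apply: eval_var => //=; [rewrite (top2_B H)|lia].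
exact: eval_const.
Qed.

Lemma eval_adr_nat k : k <= fsz + fsz -> eval b inp mem (adr (Posz k)) = Some (Posz (B + fsz +
  k)).
Proof. by move=> hk; apply: eval_adr => /=; lia. Qed.

Lemma eval_cur k z : k < fsz -> nth 0%R mem (B + fsz + k) = z -> absz z <= b ->
  eval b inp mem (cur k) = Some z.
Proof.
move=> hk <- hz; apply: eval_cell => //; last by lia.
by apply: eval_adr_nat; lia.
Qed.

Lemma eval_padr k : k < fsz -> eval b inp mem (padr N k) = Some (Posz (B + k)).
Proof. by move=> hk; apply: eval_adr => /=; lia. Qed.

Lemma eval_par k z : k < fsz -> nth 0%R mem (B + k) = z -> absz z <= b ->
  eval b inp mem (par N k) = Some z.
Proof.
move=> hk <- hz; apply: eval_cell => //; last by lia.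
exact: eval_padr.
Qed.

Lemma eval_cur_node : absz (fnode cf) <= b -> eval b inp mem (cur 0) = Some (fnode cf).
Proof.
have F := fsize_gt1 N; move=> h; apply: eval_cur => //.
by rewrite addn0; case: (top2_cf H).
Qed.

Lemma eval_cur_state : absz (fstate cf) <= b -> eval b inp mem (cur 1) = Some (fstate cf).
Proof.
have F := fsize_gt1 N; move=> h; apply: eval_cur => //.
by rewrite addn1; case: (top2_cf H).
Qed.

Lemma eval_cur_v a : a < N -> eval b inp mem (cur (off_v a)) = Some (encv (fvs cf a)).
Proof.
move=> la; apply: eval_cur; first by rewrite /off_v /fsize; lia.
  by case: (top2_cf H) => _ _ ->.
exact: encv_fits.
Qed.

Lemma eval_par_v a : a < N -> eval b inp mem (par N (off_v a)) = Some (encv (fvs pf a)).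
Proof.
move=> la; apply: eval_par; first by rewrite /off_v /fsize; lia.
  by case: (top2_pf H) => _ _ ->.
exact: encv_fits.
Qed.

Lemma eval_cur_t x y : x < N -> y < N -> bounded cf ->
  eval b inp mem (cur (offt x y)) = Some (encz (ftab cf x y)).
Proof.
move=> lx ly bd; have ot := off_t_bounds lx ly; apply: eval_cur; first by lia.
  by case: (top2_cf H) => _ _ _ ->.
by apply: encz_fits => z; apply: bd.
Qed.

Definition forgottenb (a : nat) : bool :=
  (fvs cf a != None) && all (fun p => fvs cf a != fvs pf p) (slots N).

Lemma eval_forgotten a : a < N ->
  exists2 z, eval b inp mem (forgotten N a) = Some z & (z != 0%R) = forgottenb a.
Proof.
move=> la; rewrite /forgottenb /forgotten.
have : all (fun p => p < N) (slots N) by apply/allP => p; rewrite mem_slots.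
elim: (slots N) => [_|p l IH] /=.
  exists (encv (fvs cf a)); first exact: eval_cur_v.
  by rewrite andbT; case: (fvs cf a).
case/andP=> lp /IH[z hz z0]; eexists.
  apply: (eval_and b_gt0 _ hz); apply: (eval_op (o := OpSub)); first exact: eval_cur_v.
    exact: eval_par_v.
  by have := encv_range (fvs cf a); have := encv_range (fvs pf p) => /=; lia.
rewrite z0 /= subr_eq0 (inj_eq (@encv_inj n)).
by rewrite Posz_boolE andbCA.
Qed.

Lemma wp_merge_cur ey x y z Q : x < N -> y < N -> bounded cf ->
  eval b inp mem ey = Some (encz z) ->
  (forall mem', top2 N mem0 B c e3 e4 pf (set_tab cf x y (omin (ftab cf x y) z)) mem' ->
     Q mem') ->
  wp b inp (mergec (adr (Posz (offt x y))) ey) (mergec_cost (adr 0%R) ey) Q mem.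
Proof.
move=> lx ly bd hey q; have ot := off_t_bounds lx ly.
apply: (wp_mergec (k := B + fsz + offt x y) (x := ftab cf x y) b_gt0) hey _; [|lia| | |].
- by apply: eval_adr_nat; lia.
- by case: (top2_cf H) => _ _ _ ->.
- by apply: encz_fits => z'; apply: bd.
- exact/q/top2_set_cur.
Qed.

Lemma wp_merge_par ey x y z Q : x < N -> y < N -> bounded pf ->
  eval b inp mem ey = Some (encz z) ->
  (forall mem', top2 N mem0 B c e3 e4 (set_tab pf x y (omin (ftab pf x y) z)) cf mem' ->
     Q mem') ->
  wp b inp (mergec (padr N (offt x y)) ey) (mergec_cost (adr 0%R) ey) Q mem.
Proof.
move=> lx ly bd hey q; have ot := off_t_bounds lx ly.
apply: (wp_mergec (k := B + offt x y) (x := ftab pf x y) b_gt0) hey _; [|lia| | |].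
- by apply: eval_padr; lia.
- by case: (top2_pf H) => _ _ _ ->.
- by apply: encz_fits => z'; apply: bd.
- exact/q/top2_set_par.
Qed.

Lemma wp_merge_c ey z Q : obounded c -> eval b inp mem ey = Some (encz z) ->
  (forall mem', top2 N mem0 B (omin c z) e3 e4 pf cf mem' -> Q mem') ->
  wp b inp (mergec (Const 1%:Z) ey) (mergec_cost (Const 1%:Z) ey) Q mem.
Proof.
move=> bd hey q.
apply: (wp_mergec (k := 1) (x := c) b_gt0) hey _; [|lia| | |].
- by apply: eval_const => /=; lia.
- exact: top2_c H.
- exact: encz_fits.
- by apply: q; apply: top2_set_c H.
Qed.

Definition relax_frame (a x y : nat) : frame n :=
  set_tab cf x y (omin (ftab cf x y) (oadd (ftab cf x a) (ftab cf a y))).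

Definition relax_cost : nat := 200.

(** The new table is given pointwise: when nothing is stored, the frame agrees with [relax_frame]
    only extensionally. *)
Lemma wp_relax a x y Q : a < N -> x < N -> y < N -> bounded cf ->
  (forall cf' mem', fnode cf' = fnode cf -> fstate cf' = fstate cf -> fvs cf' = fvs cf ->
     (forall x' y', ftab cf' x' y' = ftab (relax_frame a x y) x' y') ->
     top2 N mem0 B c e3 e4 pf cf' mem' -> Q mem') ->
  wp b inp (relax N a (x, y)) relax_cost Q mem.
Proof.
move=> la lx ly bd q; have hl := eval_cur_t lx la bd; have hr := eval_cur_t la ly bd.
apply: wp_mono (wp_if (t := 100) (Q := Q) (eval_and b_gt0 hl hr) _ _) _ _ => //.
  move=> /Posz_bool_neq0; rewrite !encz_eq0.
  case el : (ftab cf x a) hl => [zl|] // hl; case er : (ftab cf a y) hr => [zr|] // hr _.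
  apply: wp_mono (wp_merge_cur (ey := _) (z := oadd (ftab cf x a) (ftab cf a y)) (Q := Q)
    lx ly bd _ _) _ _ => //.
    rewrite el er /=.
    have -> : (2 * (zl + zr) + 1)%R = eval_binop OpSub (encz (Some zl) + encz (Some zr))%R 1%R.
      by rewrite /=; lia.
    have bl := bd x a _ lx la el; have br := bd a y _ la ly er.
    apply: eval_op; last by rewrite /=; lia.
      by apply: (eval_op (o := OpAdd) hl hr) => /=; lia.
    by apply: eval_const => /=; lia.
  by move=> mem' h'; apply: (q _ _ _ _ _ _ h').
move=> /Posz_bool_eq0; rewrite !encz_eq0 => h0.
apply: wp_mono (wp_skip _ _ (Q := Q) _) _ _ => //; apply: (q cf) => // x' y'.
rewrite /relax_frame /=; case: ifP => // /andP[/eqP-> /eqP->].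
by move: h0; case: (ftab cf x a) => [?|]; case: (ftab cf a y) => [?|] //=;
  case: (ftab cf x y).
Qed.

Definition merge_frame (a b' p q : nat) : frame n :=
  if (fvs cf a == fvs pf p) && (fvs cf b' == fvs pf q)
  then set_tab pf p q (omin (ftab pf p q) (ftab cf a b')) else pf.

Lemma wp_merge_parent x y p q Q : x < N -> y < N -> p < N -> q < N ->
  bounded cf -> bounded pf ->
  (forall mem', top2 N mem0 B c e3 e4 (merge_frame x y p q) cf mem' -> Q mem') ->
  wp b inp (merge_parent N ((x, y), (p, q))) 200 Q mem.
Proof.
move=> lx ly lp lq bc bp hq.
have h1 := eval_eq b_gt0 (eval_cur_v lx) (eval_par_v lp).
have h2 := eval_eq b_gt0 (eval_cur_v ly) (eval_par_v lq).
apply: wp_mono (wp_if (t := 100) (Q := Q) (eval_and b_gt0 h1 h2) _ _) _ _ => //.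
  move=> /Posz_bool_neq0; rewrite !Posz_boolE !(inj_eq (@encv_inj n)) => h0.
  apply: wp_mono (wp_merge_par (Q := Q) lp lq bp (eval_cur_t lx ly bc) _) _ _ => //.
  move=> mem' h'; by apply: hq; rewrite /merge_frame h0.
move=> /Posz_bool_eq0; rewrite !Posz_boolE !(inj_eq (@encv_inj n)) => h0.
apply: wp_mono (wp_skip _ _ (Q := Q) _) _ _ => //; by apply: hq; rewrite /merge_frame h0.
Qed.

End TwoFrames.
End Commands.

(** * Soundness and completeness of the tables *)

Section Tables.
Variables (n N : nat) (G : wdigraph n).
Implicit Types (f g : frame n) (x y u v : 'I_n) (s p : seq 'I_n) (U Fs : {set 'I_n}).
Implicit Types (c : option int) (z : int) (l : nat).
Local Notation pw := (path_weight G).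
Local Notation W := (max_abs_weight G).

(** Walks are nonempty, so that a diagonal entry is the weight of a genuine closed walk; accordingly
    the diagonal starts at infinity and not at 0. *)
Definition walk l x y z :=
  exists p, [/\ path (edge G) x p, p <> [::], last x p = y, pw x p = z & size p <= l].

Lemma walk_bound l x y z : walk l x y z -> absz z <= l * W.
Proof.
move=> [p [pp _ _ <- sz]]; apply: leq_trans (path_weight_bound pp) _.
by rewrite leq_mul2r sz orbT.
Qed.

Lemma walk_mono l l' x y z : l <= l' -> walk l x y z -> walk l' x y z.
Proof. by move=> ll' [p [h1 h2 h3 h4 h5]]; exists p; split=> //; apply: leq_trans ll'. Qed.

Lemma walk_cat l l' x y v z z' :
  walk l x y z -> walk l' y v z' -> walk (l + l') x v (z + z').
Proof.
move=> [p [h1 h2 h3 h4 h5]] [q [g1 g2 g3 g4 g5]]; exists (p ++ q); split.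
- by rewrite cat_path h1 h3.
- by case: (p) h2.
- by rewrite last_cat h3.
- by rewrite path_weight_cat h3 h4 g4.
- by rewrite size_cat leq_add.
Qed.

Lemma walk_edge x y : edge G x y -> walk 1 x y (wt G x y).
Proof. by move=> xy; exists [:: y]; split=> //=; rewrite ?xy ?addr0. Qed.

Definition sound l f := forall a b z, a < N -> b < N -> ftab f a b = Some z ->
  exists x y, [/\ fvs f a = Some x, fvs f b = Some y & walk l x y z].

Definition csound l c := forall z, c = Some z -> exists x, walk l x x z.

Lemma sound_mono l l' f : l <= l' -> sound l f -> sound l' f.
Proof.
move=> ll' h a b z la lb e; have [x [y [ex ey w]]] := h a b z la lb e.
by exists x, y; split=> //; apply: walk_mono w.
Qed.

Lemma sound_bounded l M f : l * W <= M -> sound l f -> bounded N M f.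
Proof.
move=> lM h a b z la lb /(h a b z la lb)[x [y [_ _ /walk_bound w]]].
exact: leq_trans w lM.
Qed.

Lemma csound_bounded l M c : l * W <= M -> csound l c -> obounded M c.
Proof. by move=> lM h z /h[x /walk_bound w]; apply: leq_trans w lM. Qed.

Lemma sound_set_tab l f a b o : sound l f ->
  (forall z, o = Some z ->
     exists x y, [/\ fvs f a = Some x, fvs f b = Some y & walk l x y z]) ->
  sound l (set_tab f a b (omin (ftab f a b) o)).
Proof.
move=> sf so a' b' z la lb /=; case: ifP => [/andP[/eqP ea /eqP eb]|_]; last exact: sf.
by subst a' b'; case: (omin_cases (ftab f a b) o) => ->; [apply: sf|apply: so].
Qed.

(** All that later steps need to know about a changed table: upper bounds persist when entries
    decrease. *)
Definition improves f g := [/\ fnode g = fnode f, fstate g = fstate f, fvs g = fvs f &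
  forall a b z, ole (ftab f a b) z -> ole (ftab g a b) z].

Lemma improves_trans f g h : improves f g -> improves g h -> improves f h.
Proof.
move=> [f1 f2 f3 f4] [g1 g2 g3 g4]; split; rewrite ?g1 ?g2 ?g3 // => a b z.
by move/f4/g4.
Qed.

Lemma improves_set_tab f a b o : improves f (set_tab f a b (omin (ftab f a b) o)).
Proof.
by split=> // a' b' z /=; case: ifP => [/andP[/eqP-> /eqP->]|] //; rewrite ole_omin => ->.
Qed.

Definition covers f x y z := exists a b, [/\ a < N, b < N, fvs f a = Some x,
  fvs f b = Some y & ole (ftab f a b) z].

Lemma covers_improves f g x y z : improves f g -> covers f x y z -> covers g x y z.
Proof.
by move=> [_ _ ev h] [a [b [la lb ea eb /h o]]]; exists a, b; rewrite ev.
Qed.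

(* A path [x :: rcons s y] runs through the eliminated vertices [U]; a single
   edge is only accounted for if it touches [Fs]. *)
Definition path_cover U Fs f := forall x y s, x \notin U -> y \notin U ->
  all (mem U) s -> uniq s -> path (edge G) x (rcons s y) ->
  [|| s != [::], x \in Fs | y \in Fs] -> covers f x y (pw x (rcons s y)).

Definition cycle_cover U c := forall x s, uniq (x :: s) -> all (mem U) (x :: s) ->
  path (edge G) x (rcons s x) -> ole c (pw x (rcons s x)).

Lemma path_cover_improves U Fs f g : improves f g -> path_cover U Fs f -> path_cover U Fs g.
Proof. by move=> i h x y s *; apply: covers_improves i _; apply: h. Qed.

Lemma cycle_cover_mono U c c' : (forall z, ole c z -> ole c' z) ->
  cycle_cover U c -> cycle_cover U c'.
Proof. by move=> i h x s *; apply: i; apply: h. Qed.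

Lemma path_weight_through x s1 u s2 y :
  pw x (rcons (s1 ++ u :: s2) y) = (pw x (rcons s1 u) + pw u (rcons s2 y))%R.
Proof. by rewrite rcons_cat /= -cat_rcons path_weight_cat last_rcons. Qed.

Lemma path_through (e : rel 'I_n) x s1 u s2 y :
  path e x (rcons (s1 ++ u :: s2) y) = path e x (rcons s1 u) && path e u (rcons s2 y).
Proof. by rewrite rcons_cat /= -cat_rcons cat_path last_rcons. Qed.

Lemma all_mem_setU1 u U s : u \notin s -> all (mem (u |: U)) s -> all (mem U) s.
Proof.
move=> us /allP h; apply/allP => x xs; have := h x xs; rewrite /= in_setU1.
by case: eqP => // ex; move: us; rewrite -ex xs.
Qed.

(** The inner vertices being distinct, a path meets [u] at most once. Cut there, it gives two paths
    with inner vertices in [U], which are covered even if they are single edges, because [u] belongs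
    to [Fs]. *)
Lemma path_cover_eliminate U Fs f g u : path_cover U Fs f -> u \in Fs -> u \notin U ->
  improves f g ->
  (forall x y z z', covers f x u z -> covers f u y z' -> covers g x y (z + z')) ->
  path_cover (u |: U) Fs g.
Proof.
move=> cov uF uU imp step x y s; rewrite !in_setU1 !negb_or => /andP[xu xU] /andP[yu yU].
move=> sU us ps cond; case: (boolP (u \in s)) => [|nu]; last first.
  by apply: (covers_improves imp); apply: cov => //; apply: all_mem_setU1 sU.
move=> /splitPr es; case: es sU us ps {cond} => s1 s2.
rewrite all_cat cat_uniq /= path_through => /and3P[sU1 _ sU2] /and4P[us1 ns nu us2].
case/andP=> p1 p2; rewrite path_weight_through; apply: step; apply: cov => //.
- by apply: all_mem_setU1 sU1; move: ns; rewrite negb_or => /andP[].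
- by rewrite uF !orbT.
- exact: all_mem_setU1 sU2.
- by rewrite uF !orbT.
Qed.

Lemma cycle_rotate u x s : u \in x :: s -> path (edge G) x (rcons s x) ->
  exists s', [/\ perm_eq (u :: s') (x :: s), path (edge G) u (rcons s' u)
    & pw u (rcons s' u) = pw x (rcons s x)].
Proof.
rewrite inE => /orP[/eqP->|]; first by exists s.
case/splitPr=> s1 s2; rewrite path_through => /andP[p1 p2]; exists (s2 ++ x :: s1); split.
- exact/permPl/(perm_catC (u :: s2) (x :: s1)).
- by rewrite path_through p1 p2.
- by rewrite !path_weight_through addrC.
Qed.

(** A cycle through [u], rotated so as to start there, is a path from [u] to [u] with inner vertices
    in [U], hence already bounded by the diagonal entry of [u]. *)
Lemma cycle_cover_eliminate U Fs f c c' u : path_cover U Fs f -> u \in Fs -> u \notin U ->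
  cycle_cover U c -> (forall z, ole c z -> ole c' z) ->
  (forall z, covers f u u z -> ole c' z) -> cycle_cover (u |: U) c'.
Proof.
move=> cov uF uU ccov mono step x s us sU ps.
case: (boolP (u \in x :: s)) => [ui|nu]; last first.
  by apply: mono; apply: ccov => //; apply: all_mem_setU1 sU.
have [s' [pe p' <-]] := cycle_rotate ui ps.
move: us sU; rewrite -(perm_uniq pe) -(perm_all _ pe) /= => /andP[nus us] /andP[_ sU].
apply: step; apply: cov => //; first exact: all_mem_setU1 sU.
by rewrite uF !orbT.
Qed.

Definition separated U U' :=
  forall x y, x \in U -> y \in U' -> ~~ adjacent G x y.

Lemma separated_sym U U' : separated U U' -> separated U' U.
Proof. by move=> h x y xU yU; rewrite /adjacent orbC; apply: h. Qed.

Lemma separated_path U U' x s : separated U U' -> path (edge G) x s ->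
  all (mem (U :|: U')) s -> x \in U -> all (mem U) s.
Proof.
move=> sep; elim: s x => //= y s IH x /andP[xy ps] /andP[yU sU] xU.
have yU' : y \in U.
  case/setUP: yU => // yU; case/negP: (sep x y xU yU); by rewrite /adjacent xy.
by rewrite yU' (IH y).
Qed.

Lemma separated_path_cases U U' x s : separated U U' -> path (edge G) x s ->
  all (mem (U :|: U')) (x :: s) -> all (mem U) (x :: s) \/ all (mem U') (x :: s).
Proof.
move=> sep ps /= /andP[/setUP[xU|xU] sU]; [left|right]; rewrite xU.
  exact: separated_path sep ps sU xU.
by apply: separated_path (separated_sym sep) ps _ xU; rewrite setUC.
Qed.

Lemma cycle_cover_union U U' c : separated U U' ->
  cycle_cover U c -> cycle_cover U' c -> cycle_cover (U :|: U') c.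
Proof.
move=> sep h h' x s us sU ps.
have ps' : path (edge G) x s by move: ps; rewrite rcons_path => /andP[].
by case: (separated_path_cases sep ps' sU) => {}sU; [apply: h|apply: h'].
Qed.

(** No edge joins the two sides, so a nonempty list of inner vertices stays on one of them; only the
    single edges touching [Fs] are new. *)
Lemma path_cover_union U U' Fs f : separated U U' ->
  path_cover U set0 f -> path_cover U' set0 f ->
  (forall x y, edge G x y -> x \notin U :|: U' -> y \notin U :|: U' ->
     (x \in Fs) || (y \in Fs) -> covers f x y (wt G x y)) ->
  path_cover (U :|: U') Fs f.
Proof.
move=> sep h h' he x y [|v s] xU yU sU us ps cond.
  move: ps cond => /= /andP[xy _] cond; rewrite addr0; exact: he.
have ps' : path (edge G) v s by move: ps; rewrite /= rcons_path => /and3P[].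
move: xU yU; rewrite !in_setU !negb_or => /andP[xU xU'] /andP[yU yU'].
by case: (separated_path_cases sep ps' sU) => {}sU; [apply: h|apply: h'].
Qed.

Definition represents f (A : {set 'I_n}) :=
  [/\ forall a b x, a < N -> b < N -> fvs f a = Some x -> fvs f b = Some x -> a = b,
      forall a x, a < N -> fvs f a = Some x -> x \in A
    & forall x, x \in A -> exists2 a, a < N & fvs f a = Some x].

Lemma forgottenbP pf cf A pb a x : represents pf pb -> represents cf A -> a < N ->
  fvs cf a = Some x -> forgottenb N pf cf a = (x \in A :\: pb).
Proof.
move=> [_ p2 p3] [_ c2 _] la ex; rewrite /forgottenb ex /= in_setD (c2 a x la ex) andbT.
apply/allP/negP => [h xp|h p].
  by have [p lp ep] := p3 x xp; have := h p; rewrite mem_slots ep eqxx => /(_ lp).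
by rewrite mem_slots => lp; apply/eqP => e; apply: h; apply: (p2 p x lp).
Qed.

Lemma forgottenb_some pf cf a : forgottenb N pf cf a -> exists x, fvs cf a = Some x.
Proof. by rewrite /forgottenb; case: (fvs cf a) => // x _; exists x. Qed.

End Tables.

(** * Processing of a bag *)

Lemma split_mem (A : eqType) (l l1 l2 : seq A) x : l = l1 ++ x :: l2 -> x \in l.
Proof. by move=> ->; rewrite mem_cat mem_head orbT. Qed.

Lemma size_split (A : Type) (l l1 l2 : seq A) x : l = l1 ++ x :: l2 -> size l1 < size l.
Proof. by move=> ->; rewrite size_cat /=; lia. Qed.

Lemma size_slots N : size (slots N) = N. Proof. by rewrite size_iota. Qed.

Lemma size_pairs N : size (pairs N) = N * N.
Proof. by rewrite size_allpairs !size_slots. Qed.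

Section Lists.
Variables (A : Type) (ss : seq (seq A)).

Definition list_start u := sumn (take u (shape ss)).

Lemma flatten_row u : u < size ss ->
  flatten ss = flatten (take u ss) ++ nth [::] ss u ++ flatten (drop u.+1 ss).
Proof.
by move=> lu; rewrite -{1}(cat_take_drop u ss) flatten_cat (drop_nth [::]).
Qed.

Lemma list_start_flatten u : list_start u = size (flatten (take u ss)).
Proof. by rewrite /list_start /shape -map_take size_flatten. Qed.

Lemma list_startS u : u < size ss -> list_start u.+1 = list_start u + size (nth [::] ss u).
Proof.
by move=> lu; rewrite !list_start_flatten (take_nth [::]) // flatten_rcons size_cat.
Qed.

Lemma list_start_le u : list_start u <= size (flatten ss).
Proof.
by rewrite list_start_flatten -{2}(cat_take_drop u ss) flatten_cat size_cat leq_addr.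
Qed.

Lemma row_entry x0 u r : u < size ss -> r < size (nth [::] ss u) ->
  list_start u + r < size (flatten ss) /\
  nth x0 (flatten ss) (list_start u + r) = nth x0 (nth [::] ss u) r.
Proof.
move=> lu lr; rewrite list_start_flatten; split.
  by rewrite (flatten_row lu) !size_cat; lia.
by rewrite (flatten_row lu) nth_cat ltnNge leq_addr /= addKn nth_cat lr.
Qed.

Lemma eval_list_start b inp ao mem e u : nth [::] inp ao = offsets ss ->
  size (flatten ss) + 2 <= b -> u <= size ss -> eval b inp mem e = Some (Posz u) ->
  eval b inp mem (Input ao e) = Some (Posz (list_start u)).
Proof.
move=> inp_o b_ss lu he.
have enth : nth 0%R (nth [::] inp ao) u = Posz (list_start u).
  by rewrite inp_o /offsets (nth_map 0) ?size_iota // nth_iota.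
rewrite -enth; apply: eval_input he _ _; first by rewrite inp_o size_map size_iota.
by rewrite enth /=; have := list_start_le u; lia.
Qed.

End Lists.

Lemma forgotten_cost N a : expr_cost (forgotten N a) <= N * 15 + 10.
Proof.
rewrite /forgotten -[N in leqRHS](size_slots N).
by elim: (slots N) => [|p s IH]; [|rewrite /= in IH *; lia].
Qed.

Lemma double_fits (b M V : nat) (z : int) : 4 * M + 4 <= b -> V <= M -> absz z <= V ->
  absz (2 * z)%R <= b /\ absz (2 * z + 1)%R <= b.
Proof. by move=> *; split; lia. Qed.

Section Bag.
Variables (n N b M sp Lm : nat) (G : wdigraph n) (inp : seq (seq int)).
Local Notation fsz := (fsize N).
Local Notation W := (max_abs_weight G).
Local Notation sound := (sound N G).
Local Notation csound := (csound G).
Hypothesis b_sp : sp + 2 * fsz + 10 <= b.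
Hypothesis b_M : 4 * M + 4 <= b.
Hypothesis b_n : n + 2 <= b.
Hypothesis Lm_gt0 : 0 < Lm.
(** [Lm] bounds the lengths of all walks behind the entries; through this inequality the length
    bounds exclude overflows. *)
Hypothesis L_M : Lm * W <= M.
Implicit Types (f pf cf : frame n) (Q : seq int -> Prop) (mem : seq int).

Let b_gt0 : 0 < b. Proof. by lia. Qed.
Let W_M : W <= M. Proof. exact: leq_trans (leq_pmull _ Lm_gt0) L_M. Qed.
Variables (mem0 : seq int) (B : nat).
Hypothesis szm : size mem0 = sp.
Local Notation top2 := (top2 N mem0 B).

Lemma sound_Lm l f : l <= Lm -> sound l f -> bounded N M f.
Proof. by move=> lL; apply: sound_bounded; apply: leq_trans L_M; rewrite leq_mul2r lL orbT. Qed.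

Section Eliminate.
Variables (e3 e4 : int) (pf : frame n).

Lemma sound_relax l cf cf' a x y : sound l cf -> a < N -> x < N -> y < N ->
  fvs cf' = fvs cf ->
  (forall x' y', ftab cf' x' y' = ftab (relax_frame cf a x y) x' y') ->
  sound (l * 2) cf'.
Proof.
move=> sf la lx ly ev et.
have sf2 : sound (l * 2) cf by apply: sound_mono sf; lia.
have := @sound_set_tab _ _ G (l * 2) cf x y (oadd (ftab cf x a) (ftab cf a y)) sf2.
move=> h a' b' z la' lb'; rewrite et ev; apply: h => // {}z.
case e1 : (ftab cf x a) => [z1|] //; case e2 : (ftab cf a y) => [z2|] //= [<-].
have [x1 [u [ex eu w1]]] := sf _ _ _ lx la e1.
have [u' [y1 [eu' ey w2]]] := sf _ _ _ la ly e2.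
have euu : u = u' by move: eu'; rewrite eu => -[].
by subst u'; exists x1, y1; split=> //; rewrite muln2 -addnn; apply: walk_cat w1 w2.
Qed.

(** The entries read may have been lowered earlier in the pass. The upper bounds therefore refer to
    the initial table, while the length bound doubles with each of the [N * N] updates. *)
Lemma wp_relax_all l c cf mem a : l * 2 ^ (N * N) <= Lm -> a < N ->
  sound l cf -> top2 c e3 e4 pf cf mem ->
  wp b inp (forc (pairs N) (relax N a)) (N * N * relax_cost).+1
    (fun mem' => exists cf', [/\ top2 c e3 e4 pf cf' mem', improves cf cf',
       sound (l * 2 ^ (N * N)) cf' & forall x y z z', x < N -> y < N ->
       ole (ftab cf x a) z -> ole (ftab cf a y) z' -> ole (ftab cf' x y) (z + z')]) mem.
Proof.
move=> lL la sf H.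
pose J (l1 : seq (nat * nat)) (mem' : seq int) := exists cf',
  [/\ top2 c e3 e4 pf cf' mem', improves cf cf',
      sound (l * 2 ^ size l1) cf' & forall x y z z', (x, y) \in l1 ->
      ole (ftab cf x a) z -> ole (ftab cf a y) z' -> ole (ftab cf' x y) (z + z')].
rewrite -{1}size_pairs; apply: wp_mono (@wp_forc_const _ _ _ _ _ J _ _ _ _) _ _ => //.
- move=> l1 [x y] l2 mem1 el [cf1 [H1 i1 s1 r1]].
  have := split_mem el; rewrite mem_pairs => /andP[lx ly].
  have le1 : l * 2 ^ size l1 <= Lm.
    apply: leq_trans lL; rewrite leq_mul2l leq_exp2l // -size_pairs.
    by rewrite (ltnW (size_split el)) orbT.
  apply: (wp_relax inp b_sp b_M b_n szm H1) => //; first exact: sound_Lm s1.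
  move=> cf2 mem2 n2 st2 v2 t2 H2.
  have i2 : improves cf1 cf2.
    by split=> // x' y' z; rewrite t2; case: (improves_set_tab cf1 x y (oadd (ftab cf1 x a)
      (ftab cf1 a y))) => _ _ _; apply.
  exists cf2; split=> //; first exact: improves_trans i1 i2.
    by rewrite size_rcons expnSr mulnA; apply: sound_relax s1 _ _ _ v2 t2.
  move=> x' y' z z'; rewrite mem_rcons inE => /orP[/eqP[-> ->] h h'|hin h h'].
    (* The current entries are at most the initial ones, hence so is their sum. *)
    rewrite t2 /= !eqxx /= ole_omin; apply/orP; right; case: i1 => _ _ _ i1.
    by apply: ole_oadd; apply: i1.
  by case: i2 => _ _ _; apply; apply: r1.
- by exists cf; split=> //; rewrite muln1.
move=> mem' [cf' [H' i' s' r']]; exists cf'; split=> //; first by rewrite -size_pairs.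
by move=> x y z z' lx ly; apply: r'; rewrite mem_pairs lx.
Qed.

Definition eliminate_cost : nat := N * 30 + N * N * relax_cost + 200.

Definition eliminated (Fs : {set 'I_n}) cf (l : seq nat) : {set 'I_n} :=
  [set u in Fs | has (fun a => fvs cf a == Some u) l].

Definition eliminate_inv (U0 Fs : {set 'I_n}) l cf c0 (l1 : seq nat) (mem' : seq int) :=
  exists c cf', [/\ top2 c e3 e4 pf cf' mem', improves cf cf' /\ csound Lm c,
    sound (l * 2 ^ (size l1 * (N * N))) cf', (forall z, ole c0 z -> ole c z) &
    path_cover N G (U0 :|: eliminated Fs cf l1) Fs cf' /\
    cycle_cover G (U0 :|: eliminated Fs cf l1) c].

(** Slots are treated one after the other; the invariant covers paths and cycles through [U0] and
    the vertices forgotten in the slots already seen. *)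
Lemma wp_eliminate_all (U0 A pb : {set 'I_n}) l cf c0 mem :
  represents N pf pb -> represents N cf A -> [disjoint U0 & A] ->
  l * 2 ^ (N * (N * N)) <= Lm -> sound l cf -> csound Lm c0 ->
  top2 c0 e3 e4 pf cf mem ->
  path_cover N G U0 (A :\: pb) cf -> cycle_cover G U0 c0 ->
  wp b inp (forc (slots N) (eliminate N)) (N * eliminate_cost).+1
    (eliminate_inv U0 (A :\: pb) l cf c0 (slots N)) mem.
Proof.
move=> rp rc dis lL sf sc H pcov ccov.
apply: wp_mono (@wp_forc_const _ _ _ _ eliminate_cost
  (eliminate_inv U0 (A :\: pb) l cf c0) _ _ _ _) _ (fun _ q => q);
  last (by rewrite size_slots); last first.
  rewrite /eliminate_inv; have -> : eliminated (A :\: pb) cf [::] = set0.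
    by apply/setP => u; rewrite !inE andbF.
  by exists c0, cf; split=> //; rewrite ?setU0 ?muln1.
move=> l1 a l2 mem1 el [c1 [cf1 [H1 [i1 sc1] s1 m1 [pc1 cc1]]]].
have la : a < N by rewrite -mem_slots; apply: split_mem el.
have ev1 : fvs cf1 = fvs cf by case: i1.
have le0 : l * 2 ^ (size l1 * (N * N)) * 2 ^ (N * N) <= Lm.
  rewrite -mulnA -expnD -mulSnr; apply: leq_trans lL.
  rewrite leq_mul2l leq_exp2l // leq_mul2r.
  by have := size_split el; rewrite size_slots => ->; rewrite !orbT.
have le1 : l * 2 ^ (size l1 * (N * N)) <= Lm.
  by apply: leq_trans le0; rewrite leq_pmulr // expn_gt0.
have bd1 : bounded N M cf1 by apply: sound_Lm s1.
have [z hz zb] := eval_forgotten inp b_sp b_M b_n szm H1 la.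
apply: wp_mono (wp_if (t := N * N * relax_cost + 150) (Q := eliminate_inv U0 (A :\: pb) l cf c0
  (rcons l1 a)) hz _ _) _ _ => //;
  last by rewrite /eliminate_cost; have := forgotten_cost N a; lia.
- move/eqP; rewrite zb => fg.
  have [u eu] := forgottenb_some fg.
  have rc1 : represents N cf1 A by case: rc => r1 r2 r3; split; rewrite ev1.
  have uF : u \in A :\: pb by rewrite -(forgottenbP rp rc1 la eu).
  (* Each vertex occupies a single slot, so [u] has not been eliminated at an earlier one. *)
  have uU : u \notin U0 :|: eliminated (A :\: pb) cf l1.
    rewrite in_setU negb_or; apply/andP; split.
      apply/negP => uU; move: dis; rewrite disjoint_subset => /subsetP/(_ u uU).
      by rewrite !inE; move: uF; rewrite in_setD => /andP[_ ->].
    rewrite inE uF /=; apply/hasPn => a' a'l; apply/eqP => ea'.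
    have ua : uniq (slots N) by apply: iota_uniq.
    have a'N : a' < N by rewrite -mem_slots el mem_cat a'l.
    have eaa : a' = a by case: rc => r1 _ _; apply: (r1 a' a u) => //; rewrite -ev1.
    by move: ua; rewrite el cat_uniq /= => /and3P[_ /norP[/negP + _] _]; rewrite -eaa.
  have eE : U0 :|: eliminated (A :\: pb) cf (rcons l1 a) =
            u |: (U0 :|: eliminated (A :\: pb) cf l1).
    rewrite setUCA; congr (_ :|: _); apply/setP => v; rewrite in_setU1 !inE has_rcons.
    rewrite -ev1 eu; case: (eqVneq v u) => [->|ne].
      by move: uF; rewrite in_setD eqxx /= => ->.
    by rewrite (inj_eq (@Some_inj _)) eq_sym (negbTE ne).
  apply: wp_mono (wp_seq (t1 := 100) (t2 := (N * N * relax_cost).+1) _) _ (fun _ q => q); last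
    by lia.
  apply: wp_mono (wp_merge_c b_sp b_M b_n szm H1 _ (eval_cur_t inp b_sp b_M b_n szm H1 la la bd1)
    (fun _ h => h)) _ _.
  + by apply: csound_bounded sc1.
  + by [].
  move=> mem2 H2; apply: wp_mono (wp_relax_all le0 la s1 H2) _ _ => // mem3.
  move=> [cf3 [H3 i3 s3 r3]]; exists (omin c1 (ftab cf1 a a)), cf3.
  have m2 zz : ole c1 zz -> ole (omin c1 (ftab cf1 a a)) zz by rewrite ole_omin => ->.
  split=> //.
  + split; first exact: improves_trans i1 i3.
    move=> zz; case: (omin_cases c1 (ftab cf1 a a)) => ->; first exact: sc1.
    case/(s1 _ _ _ la la) => x [y [ex ey w]]; exists x.
    have exy : x = y by move: ey; rewrite ex => -[].
    by subst y; apply: walk_mono w.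
  + by rewrite size_rcons mulSnr expnD mulnA.
  + by move=> zz /m1/m2.
  (* Slot [a] is the only one holding [u], so the entries that [covers] provides are in row and
     column [a], those used by the update. *)
  have inju a' : a' < N -> fvs cf1 a' = Some u -> a' = a.
    by move=> la' ea'; case: rc1 => r1 _ _; apply: (r1 a' a u).
  rewrite eE; split.
    apply: (path_cover_eliminate pc1 uF uU i3) => x y zz zz'.
    move=> [p [q [lp lq ep eq op]]] [p' [q' [lp' lq' ep' eq' op']]].
    have e1 := inju q lq eq; have e2 := inju p' lp' ep'; subst q p'.
    by case: (i3) => _ _ ev3 _; exists p, q'; rewrite ev3; split=> //; apply: r3.
  apply: (cycle_cover_eliminate pc1 uF uU cc1 m2) => zz [p [q [lp lq ep eq op]]].
  by move: op; rewrite (inju p lp ep) (inju q lq eq) ole_omin => ->; rewrite orbT.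
move=> z0; have {zb} fg : forgottenb N pf cf1 a = false by rewrite -zb z0.
apply: wp_mono (wp_skip _ _ (Q := eliminate_inv U0 (A :\: pb) l cf c0 (rcons l1 a)) _) _ _ =>
  //; last by lia.
exists c1, cf1; have -> : eliminated (A :\: pb) cf (rcons l1 a) = eliminated (A :\: pb) cf l1.
  apply/setP => u; rewrite !inE has_rcons; case: eqP => // eu.
  have rc1 : represents N cf1 A by case: rc => r1 r2 r3; split; rewrite ev1.
  have := forgottenbP rp rc1 la; rewrite ev1 => /(_ _ eu); rewrite fg in_setD => <-.
  by rewrite !andFb.
split=> //; apply: sound_mono s1.
by rewrite leq_mul2l leq_exp2l // leq_mul2r size_rcons leqnSn !orbT.
Qed.

End Eliminate.

Lemma mem_pairs2 x y p q :
  ((x, y), (p, q)) \in [seq (u, v) | u <- pairs N, v <- pairs N] ->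
  [/\ x < N, y < N, p < N & q < N].
Proof.
case/allpairsP=> [[u v] /= [iu iv [eu ev]]]; subst u v.
by move: iu iv; rewrite !mem_pairs => /andP[-> ->] /andP[-> ->].
Qed.

Lemma wp_merge_all l c e3 e4 pf cf mem : l <= Lm -> sound l pf -> sound l cf ->
  top2 c e3 e4 pf cf mem ->
  wp b inp (forc [seq (x, y) | x <- pairs N, y <- pairs N] (merge_parent N))
    (N * N * (N * N) * 200).+1
    (fun mem' => exists pf', [/\ top2 c e3 e4 pf' cf mem', improves pf pf', sound l pf' &
      forall x y p q z, x < N -> y < N -> p < N -> q < N -> fvs cf x = fvs pf p ->
      fvs cf y = fvs pf q -> ole (ftab cf x y) z -> ole (ftab pf' p q) z]) mem.
Proof.
move=> lL sp' sc H.
pose J (l1 : seq ((nat * nat) * (nat * nat))) (mem' : seq int) := exists pf',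
  [/\ top2 c e3 e4 pf' cf mem', improves pf pf', sound l pf' &
    forall x y p q z, ((x, y), (p, q)) \in l1 -> fvs cf x = fvs pf p ->
      fvs cf y = fvs pf q -> ole (ftab cf x y) z -> ole (ftab pf' p q) z].
apply: wp_mono (@wp_forc_const _ _ _ _ 200 J _ _ _ _) _ _ => //.
- move=> l1 [[x y] [p q]] l2 mem1 el [pf1 [H1 i1 s1 r1]].
  have [lx ly lp lq] := mem_pairs2 (split_mem el).
  apply: (wp_merge_parent inp b_sp b_M b_n szm H1) => //; try exact: (sound_Lm lL).
  move=> mem2; set pf2 := merge_frame _ _ _ _ _ _ => H2.
  have ev1 : fvs pf1 = fvs pf by case: i1.
  have i2 : improves pf1 pf2.
    by rewrite /pf2 /merge_frame; case: ifP => _; [apply: improves_set_tab|].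
  exists pf2; split=> //; first exact: improves_trans i1 i2.
    rewrite /pf2 /merge_frame; case: ifP => // /andP[/eqP ex /eqP ey].
    by apply: sound_set_tab => // z; rewrite -ex -ey; apply: sc.
  move=> x' y' p' q' z; rewrite mem_rcons inE => /orP[/eqP[-> -> -> ->]|hin] ex ey o.
    by rewrite /pf2 /merge_frame ev1 ex ey !eqxx /= !eqxx /= ole_omin o orbT.
  by case: i2 => _ _ _; apply; apply: (r1 x' y').
- by exists pf.
- by rewrite size_allpairs size_pairs.
move=> mem' [pf' [H' i' s' r']]; exists pf'; split=> // x y p q z lx ly lp lq.
by apply: r'; apply/allpairsP; exists ((x, y), (p, q)); rewrite /= !mem_pairs lx ly lp lq.
Qed.

Section Scan.
(** One proof serves successors and predecessors: [pr] selects the endpoint stored in the array, and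
    [ss] is the corresponding family of lists. *)
Variables (ao at' aw : nat) (ss : seq (seq ('I_n * 'I_n))) (pr : 'I_n * 'I_n -> 'I_n).
Hypothesis inp_o : nth [::] inp ao = offsets ss.
Hypothesis inp_t : nth [::] inp at' = [seq Posz (nat_of_ord (pr e)) | e <- flatten ss].
Hypothesis inp_w : nth [::] inp aw = [seq wt G e.1 e.2 | e <- flatten ss].
Hypothesis size_ss : size ss = n.
Hypothesis ss_edge : forall e, e \in flatten ss -> edge G e.1 e.2.
Hypothesis b_ss : size (flatten ss) + 2 <= b.

Local Notation start := (list_start ss).

Variables (tl : nat -> nat * nat) (l : nat) (e3 e4 : int) (c : option int) (pf cf : frame n).
Variables (a : nat) (u : 'I_n).
Hypothesis tl_lt : forall q, q < N -> (tl q).1 < N /\ (tl q).2 < N.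
Hypothesis aN : a < N.
Hypothesis cf_a : fvs cf a = Some u.
Let row := nth [::] ss u.
Hypothesis tl_row : forall q e, q < N -> e \in row -> fvs cf q = Some (pr e) ->
  fvs cf (tl q).1 = Some e.1 /\ fvs cf (tl q).2 = Some e.2.
Hypothesis l_gt0 : 0 < l.
Hypothesis l_Lm : l <= Lm.

Definition scanned (es : seq ('I_n * 'I_n)) cf' := forall e q, e \in es -> q < N ->
  fvs cf q = Some (pr e) -> ole (ftab cf' (tl q).1 (tl q).2) (wt G e.1 e.2).

Lemma row_edge e : e \in row -> edge G e.1 e.2.
Proof.
by move=> er; apply: ss_edge; rewrite (@flatten_row _ ss u) ?size_ss // !mem_cat er orbT.
Qed.

Lemma wp_scan_slots r (e5 : int) cf1 mem e : r < size row -> nth (u, u) row r = e ->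
  improves cf cf1 -> sound l cf1 -> top2 c (Posz (start u + r)) e5 pf cf1 mem ->
  scanned (take r row) cf1 ->
  wp b inp (forc (slots N) (scan_slot N at' aw tl)) (N * 200).+1
    (fun mem' => exists cf', [/\ top2 c (Posz (start u + r)) e5 pf cf' mem', improves cf cf',
       sound l cf' & scanned (take r.+1 row) cf']) mem.
Proof.
move=> lr er i1 s1 H1 sc1.
have e_row : e \in row by rewrite -er mem_nth.
have lu : u < size ss by rewrite size_ss.
have [lt_r nth_r] := row_entry (u, u) lu lr.
pose J (l1 : seq nat) (mem' : seq int) := exists cf',
  [/\ top2 c (Posz (start u + r)) e5 pf cf' mem', improves cf cf',
     sound l cf', scanned (take r row) cf' & forall q, q \in l1 -> fvs cf q = Some (pr e) ->
     ole (ftab cf' (tl q).1 (tl q).2) (wt G e.1 e.2)].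
apply: wp_mono (@wp_forc_const _ _ _ _ 200 J _ _ _ _) _ _.
- move=> l1 q l2 mem1 el [cf2 [H2 i2 s2 sc2 r2]].
  have lq : q < N by rewrite -mem_slots; apply: split_mem el.
  have [lx ly] := tl_lt lq; have bd2 := sound_Lm l_Lm s2.
  have ev2 : fvs cf2 = fvs cf by case: i2.
  have h3 : eval b inp mem1 (Cell (Const 3%:Z)) = Some (Posz (start u + r)).
    by apply: (eval_var inp b_sp b_M b_n szm H2) => //=; [apply: top2_3 H2|lia].
  have ht : eval b inp mem1 (Input at' (Cell (Const 3%:Z))) = Some (Posz (pr e)).
    have -> : Posz (pr e) = nth 0%R (nth [::] inp at') (start u + r).
      by rewrite inp_t (nth_map (u, u)) // nth_r er.
    apply: eval_input h3 _ _; rewrite inp_t ?size_map //.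
    by rewrite (nth_map (u, u)) // nth_r -/row er /=; have := ltn_ord (pr e); lia.
  have hw : eval b inp mem1 (Input aw (Cell (Const 3%:Z))) = Some (wt G e.1 e.2).
    have -> : wt G e.1 e.2 = nth 0%R (nth [::] inp aw) (start u + r).
      by rewrite inp_w (nth_map (u, u)) // nth_r er.
    apply: eval_input h3 _ _; rewrite inp_w ?size_map //.
    rewrite (nth_map (u, u)) // nth_r -/row er.
    apply: leq_trans (max_abs_weightP (row_edge e_row)) _; apply: leq_trans W_M _; lia.
  have h1 : eval b inp mem1 (Const 1%:Z) = Some (Posz 1) by apply: eval_const => /=; lia.
  have ht1 : eval b inp mem1 (Op OpAdd (Input at' (Cell (Const 3%:Z))) (Const 1%:Z)) =
      Some (encv (Some (pr e))).
    rewrite (eval_op (o := OpAdd) ht h1) /=; last by have := ltn_ord (pr e); lia.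
    by rewrite addrC.
  have hq := eval_cur_v inp b_sp b_M b_n szm H2 lq.
  apply: wp_mono (wp_if (t := 150) (Q := J (rcons l1 q)) (eval_eq b_gt0 ht1 hq) _ _) _ (fun _ h
    => h) => //.
    move=> /Posz_bool_neq0; rewrite (inj_eq (@encv_inj n)) ev2 => /eqP eq.
    apply: wp_mono (wp_merge_cur b_sp b_M b_n szm H2 (z := Some (wt G e.1 e.2)) (Q := J (rcons
      l1 q)) lx ly bd2 _ _) _ (fun _ h => h) => //.
      have h2 : eval b inp mem1 (Const 2%:Z) = Some (Posz 2) by apply: eval_const => /=; lia.
      have wb := max_abs_weightP (row_edge e_row).
      have [w1 w2] := double_fits b_M W_M wb.
      exact: (eval_op (o := OpAdd) (eval_op (o := OpMul) h2 hw _) h1).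
    move=> mem2 H3; set cf3 := set_tab _ _ _ _ in H3.
    have i3 : improves cf2 cf3 by apply: improves_set_tab.
    have [ex ey] := tl_row lq e_row (esym eq).
    exists cf3; split=> //; first exact: improves_trans i2 i3.
    + apply: sound_set_tab => // z [<-]; exists e.1, e.2; rewrite ev2; split=> //.
      by apply: walk_mono (walk_edge (row_edge e_row)).
    + by move=> e' q' *; case: i3 => _ _ _; apply; apply: sc2.
    move=> q'; rewrite mem_rcons inE => /orP[/eqP-> _|hin h].
      by rewrite /= !eqxx /= ole_omin /= lexx orbT.
    by case: i3 => _ _ _; apply; apply: r2.
  move=> /Posz_bool_eq0; rewrite (inj_eq (@encv_inj n)) ev2 => ne.
  apply: wp_mono (wp_skip _ _ (Q := J (rcons l1 q)) _) _ (fun _ h => h) => //.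
  exists cf2; split=> // q'; rewrite mem_rcons inE => /orP[/eqP-> eq|hin h]; last exact: r2.
  by move: ne; rewrite eq eqxx.
- by exists cf1.
- by rewrite size_slots.
move=> mem' [cf' [H' i' s' sc' r']]; exists cf'; split=> // e' q.
rewrite (take_nth (u, u)) // mem_rcons inE er => /orP[/eqP-> lq h'|h lq h']; last exact: sc'.
by apply: r' => //; rewrite mem_slots.
Qed.

(** The loop condition evaluates to the number of items left, so the loop is a counted one and its
    time is proportional to the length of the list. *)
Lemma wp_scan mem : sound l cf -> top2 c e3 e4 pf cf mem ->
  wp b inp (scan N ao at' aw tl a) (size row * (N * 200 + 100) + 100)
    (fun mem' => exists e3' e4' cf', [/\ top2 c e3' e4' pf cf' mem', improves cf cf',
       sound l cf' & scanned row cf']) mem.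
Proof.
move=> scf H.
have low := top2_low H; have fit := top2_fits H; rewrite (top2_size H) szm in fit.
have h3 memx : eval b inp memx (Const 3%:Z) = Some (Posz 3) by apply: eval_const => /=; lia.
have h4 memx : eval b inp memx (Const 4%:Z) = Some (Posz 4) by apply: eval_const => /=; lia.
have h1 memx : eval b inp memx (Const 1%:Z) = Some (Posz 1) by apply: eval_const => /=; lia.
have lu : u < size ss by rewrite size_ss.
apply: wp_mono (wp_seq (t1 := 20) (t2 := size row * (N * 200 + 100) + 80) _) _ (fun _ h => h);
  last by lia.
have hs : eval b inp mem (Input ao (Op OpSub (cur (off_v a)) (Const 1%:Z))) =
    Some (Posz (start u)).
  apply: (eval_list_start inp_o b_ss (ltnW lu)).
  rewrite (eval_op (o := OpSub) (eval_cur_v inp b_sp b_M b_n szm H aN) (h1 mem)) cf_a /=.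
    by congr Some; lia.
  by lia.
apply: wp_mono (wp_store (h3 mem) _ hs _) _ (fun _ h => h) => //.
  by rewrite (top2_size H) szm; lia.
have {H} := top2_set_3 (Posz (start u)) H; set mem1 := set_nth _ _ _ _ => H.
apply: wp_mono (wp_seq (t1 := 20) (t2 := size row * (N * 200 + 100) + 60) _) _ (fun _ h => h);
  last by lia.
have hs1 : eval b inp mem1 (Input ao (cur (off_v a))) = Some (Posz (start u.+1)).
  by apply: (eval_list_start inp_o b_ss lu); rewrite (eval_cur_v inp b_sp b_M b_n szm H aN) cf_a.
apply: wp_mono (wp_store (h4 mem1) _ hs1 _) _ (fun _ h => h) => //.
  by rewrite (top2_size H) szm; lia.
have {H} := top2_set_4 (Posz (start u.+1)) H; set mem2 := set_nth _ _ _ _ => H.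
pose J r (mem' : seq int) := exists cf', [/\ top2 c (Posz (start u + r)) (Posz (start u.+1)) pf
  cf' mem', improves cf cf',
       sound l cf' & scanned (take r row) cf'].
have hc r memx : r <= size row -> J r memx ->
    eval b inp memx scan_cond = Some (Posz (size row - r)).
  move=> lr [cf' [H' _ _ _]].
  have bb := list_start_le ss u.+1; have es := list_startS lu; rewrite -/row in es; rewrite es
    in bb.
  have g3 := eval_var inp b_sp b_M b_n szm H' (top2_3 H') _ _.
  have g4 := eval_var inp b_sp b_M b_n szm H' (top2_4 H') _ _.
  rewrite /scan_cond (eval_op (o := OpSub) (g4 _ _) (g3 _ _)) //=; rewrite ?es.
  - by congr Some; lia.
  - by lia.
  - by lia.
  - by lia.
apply: wp_mono (wp_while_count (k := 0) (d := size row) (I := J) (t := N * 200 + 50) _ _ _ _) _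
  _ => //.
- move=> r memx lr Jr; split.
    by exists (Posz (size row - r)); [apply: hc => //; apply: ltnW|lia].
  have [cf1 [H1 i1 s1 sc1]] := Jr.
  apply: wp_mono (wp_seq (t1 := (N * 200).+1) (t2 := 20) _) _ (fun _ h => h); last by lia.
  apply: wp_mono (wp_scan_slots lr (erefl _) i1 s1 H1 sc1) _ _ => // memy [cf2 [H2 i2 s2 sc2]].
  have bb := list_start_le ss u.+1; rewrite list_startS // -/row in bb.
  have g3 : eval b inp memy (Cell (Const 3%:Z)) = Some (Posz (start u + r)).
    by apply: (eval_var inp b_sp b_M b_n szm H2 (top2_3 H2)) => //=; lia.
  have ga : eval b inp memy (Op OpAdd (Cell (Const 3%:Z)) (Const 1%:Z)) =
      Some (Posz (start u + r.+1)).
    rewrite (eval_op (o := OpAdd) g3 (h1 memy)) /=; last by lia.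
    by congr Some; lia.
  apply: wp_mono (wp_store (h3 memy) _ ga _) _ (fun _ h => h) => //.
    by rewrite (top2_size H2) szm; lia.
  exists cf2; split=> //; exact: top2_set_3 H2.
- by move=> memx Jd; rewrite (hc (size row)) // subnn.
- by exists cf; split=> //; rewrite ?addn0 // take0.
- by rewrite subn0 /=; lia.
move=> memx [cf' [H' i' s' sc']]; exists (Posz (start u + size row)), (Posz (start u.+1)), cf'.
by rewrite take_size in sc'.
Qed.

End Scan.
End Bag.

Section EdgeLists.
Variables (n : nat) (G : wdigraph n).

Lemma size_out_edges : size (out_edges G) = n.
Proof. by rewrite size_map size_enum_ord. Qed.

Lemma size_in_edges : size (in_edges G) = n.
Proof. by rewrite size_map size_enum_ord. Qed.

Lemma out_row (u : 'I_n) :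
  nth [::] (out_edges G) u = [seq (u, v) | v <- enum 'I_n & edge G u v].
Proof. by rewrite (nth_map u) ?size_enum_ord // nth_ord_enum. Qed.

Lemma in_row (v : 'I_n) :
  nth [::] (in_edges G) v = [seq (u, v) | u <- enum 'I_n & edge G u v].
Proof. by rewrite (nth_map v) ?size_enum_ord // nth_ord_enum. Qed.

Lemma mem_out_row u e : (e \in nth [::] (out_edges G) (nat_of_ord u)) = (e.1 == u) && edge G e.1
  e.2.
Proof.
rewrite out_row; apply/mapP/andP => [[v]|[/eqP <- h]].
  by rewrite mem_filter => /andP[h _] ->.
by exists e.2; [rewrite mem_filter h mem_enum|case: (e)].
Qed.

Lemma mem_in_row v e : (e \in nth [::] (in_edges G) (nat_of_ord v)) = (e.2 == v) && edge G e.1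
  e.2.
Proof.
rewrite in_row; apply/mapP/andP => [[u]|[/eqP <- h]].
  by rewrite mem_filter => /andP[h _] ->.
by exists e.1; [rewrite mem_filter h mem_enum|case: (e)].
Qed.

Lemma out_edges_edge e : e \in flatten (out_edges G) -> edge G e.1 e.2.
Proof.
case/flattenP=> row /mapP[u _ ->] /mapP[v]; rewrite mem_filter => /andP[h _] ->.
exact: h.
Qed.

Lemma in_edges_edge e : e \in flatten (in_edges G) -> edge G e.1 e.2.
Proof.
case/flattenP=> row /mapP[u _ ->] /mapP[v]; rewrite mem_filter => /andP[h _] ->.
exact: h.
Qed.

Definition degree (u : 'I_n) : nat :=
  size (nth [::] (out_edges G) u) + size (nth [::] (in_edges G) u).

End EdgeLists.

(** * The work done at one node *)

Section Node.
Variables (n N b M sp Lm m : nat) (G : wdigraph n) (T : btree m) (bag : 'I_m -> {set 'I_n}).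
Local Notation inp := (encode G T bag).
Local Notation fsz := (fsize N).
Local Notation W := (max_abs_weight G).
Local Notation sound := (sound N G).
Local Notation csound := (csound G).
Hypothesis rootedT : is_rooted T.
Hypothesis decT : is_tree_decomposition G (tree_adj T) bag.
Hypothesis b_sp : sp + 2 * fsz + 10 <= b.
Hypothesis b_M : 4 * M + 4 <= b.
Hypothesis b_n : n + 2 <= b.
Hypothesis b_out : size (flatten (out_edges G)) + 2 <= b.
Hypothesis b_in : size (flatten (in_edges G)) + 2 <= b.
Hypothesis Lm_gt0 : 0 < Lm.
Hypothesis L_M : Lm * W <= M.
Implicit Types (f pf cf : frame n) (Q : seq int -> Prop) (mem : seq int).

Section Scans.
Variables (mem0 : seq int) (B : nat).
Hypothesis szm : size mem0 = sp.
Local Notation top2 := (top2 N mem0 B).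
Variables (l : nat) (c : option int) (pf cf : frame n) (A pb : {set 'I_n}).
Hypothesis rp : represents N pf pb.
Hypothesis rc : represents N cf A.
Hypothesis l_gt0 : 0 < l.
Hypothesis l_Lm : l <= Lm.

Definition slot_degree (a : nat) : nat :=
  if fvs cf a is Some u then (u \in A :\: pb) * degree G u else 0.

(** Distinct slots hold distinct vertices, so the lists of a forgotten vertex are paid for only
    once. *)
Lemma sum_slot_degree :
  \sum_(a <- slots N) slot_degree a <= \sum_(u in A :\: pb) degree G u.
Proof.
have h a : a \in slots N ->
    slot_degree a <= \sum_(u in A :\: pb) (fvs cf a == Some u) * degree G u.
  rewrite /slot_degree; case: (fvs cf a) => [u|] // _; case: (boolP (u \in A :\: pb)) => // uF.
  by rewrite (bigD1 u) //= eqxx leq_addr.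
apply: (@leq_trans (\sum_(a <- slots N) \sum_(u in A :\: pb) (fvs cf a == Some u) * degree G u)).
  by rewrite big_seq [X in _ <= X]big_seq; apply: leq_sum => a; apply: h.
rewrite exchange_big /=; apply: leq_sum => u uF; rewrite -big_distrl /=.
rewrite -[leqRHS]mul1n leq_mul2r; apply/orP; right.
have uA : u \in A by move: uF; rewrite in_setD => /andP[].
case: rc => inj _ ex; have [a la ea] := ex u uA.
have ia : a \in slots N by rewrite mem_slots.
rewrite (bigD1_seq a) ?iota_uniq //= ea eqxx big1_seq ?addn0 // => a' /andP[ne ia'].
case: eqP => // ea'; case/negP: ne; apply/eqP/(inj a' a u) => //.
by rewrite -mem_slots.
Qed.

Definition scan_inv (l1 : seq nat) (mem' : seq int) := exists e3 e4 cf',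
  [/\ top2 c e3 e4 pf cf' mem', improves cf cf', sound l cf' &
    forall a u q v, a \in l1 -> fvs cf a = Some u -> u \in A :\: pb -> q < N ->
      fvs cf q = Some v ->
      (edge G u v -> ole (ftab cf' a q) (wt G u v)) /\
      (edge G v u -> ole (ftab cf' q a) (wt G v u))].

Lemma wp_scan_all e3 e4 mem : sound l cf -> top2 c e3 e4 pf cf mem ->
  wp b inp (forc (slots N) (scan_edges N))
    (N * (N * 15 + 300) + (N * 200 + 100) * \sum_(u in A :\: pb) degree G u).+1
    (scan_inv (slots N)) mem.
Proof.
move=> scf H.
pose t a := N * 15 + 300 + slot_degree a * (N * 200 + 100).
apply: wp_mono (@wp_forc _ _ _ _ t scan_inv _ _ _ _) _ _ => //; last first.
- rewrite ltnS /t big_split /= big_const_seq count_predT iter_addn_0 size_slots mulnC.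
  rewrite leq_add2l -big_distrl /= mulnC leq_mul2l sum_slot_degree; exact: orbT.
- by exists e3, e4, cf.
move=> l1 a l2 mem1 el [f3 [f4 [cf1 [H1 i1 s1 r1]]]].
have la : a < N by rewrite -mem_slots; apply: split_mem el.
have ev1 : fvs cf1 = fvs cf by case: i1.
have rc1 : represents N cf1 A by case: rc => q1 q2 q3; split; rewrite ev1.
have [z hz zb] := eval_forgotten inp b_sp b_M b_n szm H1 la.
apply: wp_mono (wp_if (t := slot_degree a * (N * 200 + 100) + 210)
  (Q := scan_inv (rcons l1 a)) hz _ _) _ (fun _ h => h);
  last by rewrite /t; have := forgotten_cost N a; lia.
  move/eqP; rewrite zb => fg; have [u eu1] := forgottenb_some fg.
  have uF : u \in A :\: pb by rewrite -(forgottenbP rp rc1 la eu1).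
  have eu : fvs cf a = Some u by rewrite -ev1.
  pose ro := nth [::] (out_edges G) u; pose ri := nth [::] (in_edges G) u.
  apply: wp_mono (wp_seq (t1 := size ro * (N * 200 + 100) + 100)
    (t2 := size ri * (N * 200 + 100) + 100) _) _ (fun _ h => h); last first.
    by rewrite /slot_degree eu uF /degree -/ro -/ri; nia.
  apply: wp_mono (@wp_scan _ _ _ _ _ _ G inp b_sp b_M b_n Lm_gt0 L_M _ _ szm 1 2 3
    (out_edges G) snd erefl erefl erefl (size_out_edges G) (@out_edges_edge n G) b_out
    (fun q => (a, q)) l f3 f4 c pf cf1 a u _ la eu1 _ l_gt0 l_Lm mem1 s1 H1) _ _ => //.
    move=> q e lq; rewrite mem_out_row => /andP[/eqP-> _] /= eq; split=> //.
  move=> mem2 [g3 [g4 [cf2 [H2 i2 s2 sc2]]]].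
  have ev2 : fvs cf2 = fvs cf1 by case: i2.
  have eu2 : fvs cf2 a = Some u by rewrite ev2.
  apply: wp_mono (@wp_scan _ _ _ _ _ _ G inp b_sp b_M b_n Lm_gt0 L_M _ _ szm 4 5 6
    (in_edges G) fst erefl erefl erefl (size_in_edges G) (@in_edges_edge n G) b_in
    (fun q => (q, a)) l g3 g4 c pf cf2 a u _ la eu2 _ l_gt0 l_Lm mem2 s2 H2) _ _ => //.
    move=> q e lq; rewrite mem_in_row => /andP[/eqP-> _] /= eq; split=> //.
  move=> mem3 [k3 [k4 [cf3 [H3 i3 s3 sc3]]]].
  exists k3, k4, cf3; split=> //; first exact: improves_trans i1 (improves_trans i2 i3).
  have up2 x y zz : ole (ftab cf2 x y) zz -> ole (ftab cf3 x y) zz by case: i3 => _ _ _; apply.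
  have up1 x y zz : ole (ftab cf1 x y) zz -> ole (ftab cf2 x y) zz by case: i2 => _ _ _; apply.
  move=> a' u' q v; rewrite mem_rcons inE => /orP[/eqP->|hin] ea uF' lq eq; last first.
    by have [h1 h2] := r1 a' u' q v hin ea uF' lq eq; split=> uv; apply/up2/up1; auto.
  have euu : u' = u by move: ea; rewrite eu => -[].
  subst u'; split=> uv.
    apply: up2; apply: (sc2 (u, v) q) => //; last by rewrite ev1.
    by rewrite mem_out_row /= eqxx.
  apply: (sc3 (v, u) q) => //; last by rewrite ev2 ev1.
  by rewrite mem_in_row /= eqxx.
move=> z0; have {zb} fg : forgottenb N pf cf1 a = false by rewrite -zb z0.
apply: wp_mono (wp_skip _ _ (Q := scan_inv (rcons l1 a)) _) _ (fun _ h => h); last by lia.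
exists f3, f4, cf1; split=> // a' u q v; rewrite mem_rcons inE => /orP[/eqP->|hin] ea uF.
  by have := forgottenbP rp rc1 la; rewrite ev1 => /(_ _ ea); rewrite fg uF.
exact: r1.
Qed.

End Scans.

Definition finalize_cost : nat :=
  N * (N * 15 + 300) + N * eliminate_cost N + N * N * (N * N) * 200 + 20.

Lemma separated_children i : separated G (oinner T bag (bt_left T i)) (oinner T bag (bt_right T
  i)).
Proof.
move=> x y; case el : (bt_left T i) => [j|] /=; last by rewrite inE.
case er : (bt_right T i) => [k|] /=; last by move=> _; rewrite inE.
move=> xj yk; apply/negP => axy.
have ij : child T i j by rewrite childE el eqxx.
have ik : child T i k by rewrite childE er eqxx orbT.
apply: (bt_children_neq rootedT el); rewrite er.
by rewrite (inner_siblings_adjacent rootedT decT ij ik xj yk axy).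
Qed.

Lemma oinner_children i x : x \in oinner T bag (bt_left T i) :|: oinner T bag (bt_right T i) <->
  exists2 j, child T i j & x \in inner T bag j.
Proof.
split.
  case/setUP.
    case e : (bt_left T i) => [j|] /=; last by rewrite inE.
    by exists j; rewrite // childE e eqxx.
  case e : (bt_right T i) => [j|] /=; last by rewrite inE.
  by exists j; rewrite // childE e eqxx orbT.
move=> [j]; rewrite childE => /orP[]/eqP e xj; apply/setUP; [left|right]; by rewrite e.
Qed.

(** The forgotten vertices and the inner vertices of the children make up [inner i]. Transferring
    only the pairs found in the parent bag loses nothing: a path with at least one inner vertex, all
    in [inner i], and endpoints outside has both endpoints there. *)
Lemma wp_finalize mem0 B i pb l l' c e3 e4 pf cf mem :
  size mem0 = sp -> top2 N mem0 B c e3 e4 pf cf mem ->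
  parent_bag T bag i pb -> represents N pf pb -> represents N cf (bag i) ->
  0 < l -> l * 2 ^ (N * (N * N)) <= l' -> l' <= Lm -> sound l cf -> sound l' pf ->
  csound Lm c ->
  path_cover N G (oinner T bag (bt_left T i)) set0 cf ->
  path_cover N G (oinner T bag (bt_right T i)) set0 cf ->
  cycle_cover G (oinner T bag (bt_left T i)) c ->
  cycle_cover G (oinner T bag (bt_right T i)) c ->
  wp b inp (finalize N)
    (finalize_cost + (N * 200 + 100) * \sum_(u in bag i :\: pb) degree G u)
    (fun mem' => exists c' pf', [/\ top N mem0 B c' pf' mem', improves pf pf' /\ sound l' pf',
      csound Lm c', forall z, ole c z -> ole c' z &
      path_cover N G (inner T bag i) set0 pf' /\ cycle_cover G (inner T bag i) c']) mem.
Proof.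
move=> szm H hp rp rc l0 ll' l'L sl sl' sc pl pr cl cr.
have le_l : l <= l' by apply: leq_trans ll'; rewrite leq_pmulr // expn_gt0.
pose U0 := oinner T bag (bt_left T i) :|: oinner T bag (bt_right T i).
pose Fs := bag i :\: pb.
have U0i x : x \in U0 -> (x \in inner T bag i) && (x \notin bag i).
  by case/oinner_children=> j ij; apply: (inner_child rootedT decT ij).
have innerE : inner T bag i = U0 :|: Fs.
  apply/setP => x; rewrite in_setU in_setD; apply/idP/idP.
    by case/(inner_cases rootedT decT hp) => [/andP[-> ->]|/oinner_children ->]; rewrite ?orbT.
  by case/orP => [/U0i/andP[]|/andP[np xi]] //; apply: forgotten_inner hp xi np.
pose tot := \sum_(u in Fs) degree G u.
rewrite /finalize; apply: wp_mono (wp_seq (t1 := (N * (N * 15 + 300) + (N * 200 + 100) * tot).+1)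
  (t2 := N * eliminate_cost N + N * N * (N * N) * 200 + 15) _) _ (fun _ h => h);
  last by rewrite /finalize_cost -/Fs -/tot; lia.
apply: wp_mono (wp_scan_all szm rp rc l0 (leq_trans le_l l'L) sl H) _ _ => //.
move=> mem1 [f3 [f4 [cf1 [H1 i1 s1 r1]]]].
have ev1 : fvs cf1 = fvs cf by case: i1.
have rc1 : represents N cf1 (bag i) by case: rc => q1 q2 q3; split; rewrite ev1.
have pc0 : path_cover N G U0 Fs cf1.
  apply: path_cover_union (@separated_children i) _ _ _.
  - exact: path_cover_improves i1 pl.
  - exact: path_cover_improves i1 pr.
  (* The separation property at work: a neighbour of a forgotten vertex which is not yet eliminated
     has a slot in the frame. *)
  have inbag x y : x \in Fs -> y \notin U0 -> adjacent G x y -> y \in bag i.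
    move=> xF yU axy; have xi : x \in inner T bag i by rewrite innerE in_setU xF orbT.
    case: (inner_adjacent decT hp axy xi) => [|/andP[] //].
    by rewrite innerE in_setU (negbTE yU) in_setD => /andP[].
  case: (rc) => _ _ ex x y xy xU yU /orP[xF|yF].
    have yb : y \in bag i by apply: (inbag x y) => //; rewrite /adjacent xy.
    have xb : x \in bag i by move: xF; rewrite in_setD => /andP[].
    have [a la ea] := ex x xb; have [q lq eq] := ex y yb.
    exists a, q; rewrite ev1; split=> //; have ia : a \in slots N by rewrite mem_slots.
    by case: (r1 a x q y ia ea xF lq eq) => + _; apply.
  have xb : x \in bag i by apply: (inbag y x) => //; rewrite /adjacent xy orbT.
  have yb : y \in bag i by move: yF; rewrite in_setD => /andP[].
  have [a la ea] := ex y yb; have [q lq eq] := ex x xb.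
  exists q, a; rewrite ev1; split=> //; have ia : a \in slots N by rewrite mem_slots.
  by case: (r1 a y q x ia ea yF lq eq) => _; apply.
have cc0 : cycle_cover G U0 c by apply: cycle_cover_union (@separated_children i) cl cr.
have dis : [disjoint U0 & bag i].
  by rewrite disjoint_subset; apply/subsetP => x /U0i/andP[].
apply: wp_mono (wp_seq (t1 := (N * eliminate_cost N).+1)
  (t2 := N * N * (N * N) * 200 + 14) _) _ (fun _ h => h); last by lia.
apply: wp_mono (wp_eliminate_all inp b_sp b_M b_n Lm_gt0 L_M szm rp rc1 dis
  (leq_trans ll' l'L) s1 sc H1 pc0 cc0) _ _ => //.
move=> mem2 [c2 [cf2 [H2 [i2 sc2] s2 m2 [pc2 cc2]]]].
have ev2 : fvs cf2 = fvs cf1 by case: i2.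
have eE : U0 :|: eliminated Fs cf1 (slots N) = inner T bag i.
  rewrite innerE; congr (_ :|: _); apply/setP => x; rewrite inE.
  case: (boolP (x \in Fs)) => //= xF; apply/hasP.
  have xb : x \in bag i by move: xF; rewrite in_setD => /andP[].
  by case: rc1 => _ _ /(_ x xb)[a la ea]; exists a; rewrite ?mem_slots // ea.
rewrite eE in pc2 cc2; rewrite size_slots in s2.
apply: wp_mono (wp_seq (t1 := (N * N * (N * N) * 200).+1) (t2 := 13) _) _ (fun _ h => h); last
  by lia.
have s2' : sound l' cf2 by apply: sound_mono s2.
apply: wp_mono (wp_merge_all inp b_sp b_M b_n L_M szm l'L sl' s2' H2) _ _ => //.
move=> mem3 [pf3 [H3 i3 s3 r3]].
have low := top2_low H3; have fit := top2_fits H3; have sz := top2_size H3.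
have ev3 : fvs pf3 = fvs pf by case: i3.
apply: wp_mono (wp_store (k := 2) (z := Posz B) _ _ _ _) _ (fun _ h => h) => //=.
- by apply: eval_const => /=; lia.
- by lia.
- by apply: (eval_adr inp b_sp b_M b_n szm H3); lia.
exists c2, pf3; split=> //; first exact: top2_pop H3.
split=> // x y s xU yU sU us ps; rewrite !inE !orbF => s0.
have := pc2 x y s xU yU sU us ps; rewrite s0 => /(_ isT)[a [q [la lq ea eq o]]].
(* Applied to the first and the last inner vertex of the path; there is one, since single edges are
   not covered when [Fs] is empty. *)
have inpb v v' : v \in inner T bag i -> v' \notin inner T bag i -> adjacent G v v' ->
    v' \in pb.
  by move=> vi v'i avv; case: (inner_adjacent decT hp avv vi) => [h|/andP[]] //; rewrite h in v'i.
have xp : x \in pb.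
  case: (s) s0 sU ps => // v s' _ /= /andP[vi _] /andP[xv _].
  by apply: (inpb v x) => //; rewrite /adjacent xv orbT.
have yp : y \in pb.
  case/lastP: (s) s0 sU ps => // s' v _; rewrite all_rcons /= => /andP[vi _].
  rewrite !rcons_path last_rcons => /andP[_ vy].
  by apply: (inpb v y) => //; rewrite /adjacent vy.
case: (rp) => _ _ ex; have [p lp ep] := ex x xp; have [p' lp' ep'] := ex y yp.
by exists p, p'; rewrite ev3; split=> //; apply: (r3 a q p p') => //; rewrite ?ea ?eq.
Qed.

End Node.

(** * The traversal *)

Section Traversal.
Variables (n N b M sp Lm m : nat) (G : wdigraph n) (T : btree m) (bag : 'I_m -> {set 'I_n}).
Local Notation inp := (encode G T bag).
Local Notation offt := (off_t N).
Local Notation fsz := (fsize N).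
Local Notation W := (max_abs_weight G).
Local Notation sound := (sound N G).
Local Notation csound := (csound G).
Hypothesis rootedT : is_rooted T.
Hypothesis decT : is_tree_decomposition G (tree_adj T) bag.
Hypothesis card_bag : forall i, #|bag i| <= N.
Hypothesis b_sp : sp + 2 * fsz + 10 <= b.
Hypothesis b_M : 4 * M + 4 <= b.
Hypothesis b_n : n + 2 <= b.
Hypothesis b_m : m + 2 <= b.
Hypothesis b_out : size (flatten (out_edges G)) + 2 <= b.
Hypothesis b_in : size (flatten (in_edges G)) + 2 <= b.
Hypothesis b_bag : size (flatten (bag_lists bag)) + N + 2 <= b.
Hypothesis Lm_gt0 : 0 < Lm.
Hypothesis L_M : Lm * W <= M.
Implicit Types (f pf cf : frame n) (Q : seq int -> Prop) (mem : seq int).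

Let b_gt0 : 0 < b. Proof. by lia. Qed.

Definition bag_slot (j : 'I_m) (a : nat) : option 'I_n := onth (enum (bag j)) a.

Definition fresh (j : 'I_m) : frame n :=
  Frame (Posz j) 0%R (bag_slot j) (fun _ _ => None).

Lemma size_bag_lists : size (bag_lists bag) = m.
Proof. by rewrite size_map size_enum_ord. Qed.

Lemma bag_row (j : 'I_m) : nth [::] (bag_lists bag) j = enum (bag j).
Proof. by rewrite (nth_map j) ?size_enum_ord // nth_ord_enum. Qed.

Lemma onth_some (A : Type) (s : seq A) k x0 : k < size s -> onth s k = Some (nth x0 s k).
Proof. by elim: s k => [|y s IH] [|k] //= lk; apply: IH. Qed.

Lemma onth_none (A : Type) (s : seq A) k : size s <= k -> onth s k = None.
Proof. by elim: s k => [|y s IH] [|k] //= lk; apply: IH. Qed.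

Lemma represents_bag j f : fvs f = bag_slot j -> represents N f (bag j).
Proof.
move=> ev; have sl a x : fvs f a = Some x -> a < size (enum (bag j)) /\ nth x (enum (bag j)) a =
  x.
  rewrite ev /bag_slot; case: (ltnP a (size (enum (bag j)))) => la.
    by rewrite (onth_some x la) => -[].
  by rewrite onth_none.
split=> [a a' x la la' /sl[sa na] /sl[sa' na']|a x la /sl[sa na]|x xj].
- by apply/eqP; rewrite -(nth_uniq x sa sa' (enum_uniq _)) na na'.
- by rewrite -mem_enum -na mem_nth.
have xe : x \in enum (bag j) by rewrite mem_enum.
have lt : index x (enum (bag j)) < size (enum (bag j)) by rewrite index_mem.
exists (index x (enum (bag j))).
  by apply: leq_trans lt _; rewrite -cardE.
by rewrite ev /bag_slot (onth_some x lt) nth_index.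
Qed.

Section Push.
Variables (mem : seq int) (B : nat).
Hypothesis szm : size mem = sp.
Hypothesis low : 5 <= B.
Hypothesis fit : B + fsz + fsz <= sp.

(** Holds until the push moves the stack pointer: everything under the new frame is as before. *)
Definition below mem' := size mem' = sp /\
  forall k, k < B + fsz -> nth 0%R mem' k = nth 0%R mem k.

Hypothesis mem_B : nth 0%R mem 2 = Posz B.

Lemma eval_nxt mem' k : below mem' -> k < fsz ->
  eval b inp mem' (nxt N k) = Some (Posz (B + fsz + k)).
Proof.
move=> [sz h] lk; have -> : Posz (B + fsz + k) = eval_binop OpAdd (Posz B) (Posz (fsz + k)).
  by rewrite /=; lia.
apply: eval_op; last by rewrite /=; lia.
  rewrite -mem_B -(h 2); last by lia.
  apply: eval_cell; [by apply: eval_const => /=; lia|by lia|].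
  by rewrite h ?mem_B /=; lia.
by apply: eval_const => /=; lia.
Qed.

Lemma below_store mem' k z : below mem' -> B + fsz <= k -> k < sp ->
  below (set_nth 0%R mem' k z).
Proof.
move=> [sz h] lo hi; split; first by rewrite size_set_nth_lt ?sz.
by move=> k' lk'; rewrite nth_set_nth_neq ?h //; lia.
Qed.

Lemma wp_store_nxt mem' k e z t Q : below mem' -> k < fsz ->
  eval b inp mem' e = Some z -> expr_cost e + 5 <= t ->
  (below (set_nth 0%R mem' (B + fsz + k) z) -> Q (set_nth 0%R mem' (B + fsz + k) z)) ->
  wp b inp (Store (nxt N k) e) t Q mem'.
Proof.
move=> bl lk he ct q.
apply: wp_mono (wp_store (eval_nxt bl lk) _ he (q _)) _ (fun _ h => h).
- by rewrite bl.1; lia.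
- by apply: below_store => //; lia.
- by rewrite /=; lia.
Qed.

Lemma eval_bag_start mem' e (j : nat) : j <= m -> eval b inp mem' e = Some (Posz j) ->
  eval b inp mem' (Input 7 e) = Some (Posz (list_start (bag_lists bag) j)).
Proof.
by move=> lj; apply: eval_list_start => //; rewrite ?size_bag_lists //; lia.
Qed.

Definition push_cost : nat := N * 100 + N * N * 10 + 60.

Lemma wp_push e (j : 'I_m) Q : eval b inp mem e = Some (Posz j) -> expr_cost e <= 20 ->
  (forall mem', size mem' = sp -> (forall k, k <> 2 -> k < B + fsz ->
      nth 0%R mem' k = nth 0%R mem k) -> nth 0%R mem' 2 = Posz (B + fsz) ->
      is_frame N mem' (B + fsz) (fresh j) -> Q mem') ->
  wp b inp (push N e) push_cost Q mem.
Proof.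
move=> he ce q; have F := fsize_gt1 N.
have bl0 : below mem by [].
rewrite /push; apply: wp_mono (wp_seq (t1 := 25) (t2 := N * 100 + N * N * 10 + 35) _) _ (fun _ h
  => h);
  last by rewrite /push_cost; lia.
apply: (wp_store_nxt bl0 _ he) => //; [by lia|].
set mem1 := set_nth _ _ _ _ => bl1.
have n1 : nth 0%R mem1 (B + fsz) = Posz j by rewrite /mem1 addn0 nth_set_nth_eq.
apply: wp_mono (wp_seq (t1 := 6) (t2 := N * 100 + N * N * 10 + 29) _) _ (fun _ h => h); last by
  lia.
have hc memx : eval b inp memx (Const 0%:Z) = Some (Posz 0) by apply: eval_const => /=; lia.
apply: (wp_store_nxt bl1 _ (hc mem1)) => //; set mem2 := set_nth _ _ _ _ => bl2.
have n2 : nth 0%R mem2 (B + fsz) = Posz j by rewrite /mem2 nth_set_nth_neq //; lia.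
have s2 : nth 0%R mem2 (B + fsz).+1 = 0%R by rewrite /mem2 addn1 nth_set_nth_eq.
pose I1 (l1 : seq nat) mem' := [/\ below mem', nth 0%R mem' (B + fsz) = Posz j,
  nth 0%R mem' (B + fsz).+1 = 0%R &
  forall a, a \in l1 -> nth 0%R mem' (B + fsz + off_v a) = encv (bag_slot j a)].
apply: wp_mono (wp_seq (t1 := (N * 100).+1) (t2 := N * N * 10 + 28) _) _ (fun _ h => h); last by
  lia.
apply: wp_mono (@wp_forc_const _ _ _ _ 100 I1 _ _ _ _) _ _ => //; last first.
- move=> mem3 [bl3 n3 s3 v3].
  pose I2 (l1 : seq (nat * nat)) mem' := I1 (slots N) mem' /\
    forall x y, (x, y) \in l1 -> nth 0%R mem' (B + fsz + offt x y) = 0%R.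
  apply: wp_mono (wp_seq (t1 := (N * N * 10).+1) (t2 := 10) _) _ (fun _ h => h); last by lia.
  apply: wp_mono (@wp_forc_const _ _ _ _ 10 I2 _ _ _ _) _ _ => //; last first.
  + move=> mem4 [[bl4 n4 s4 v4] t4].
    apply: wp_mono (wp_store (k := 2) _ _ (eval_nxt bl4 (k := 0) _) _) _ (fun _ h => h) => //.
    * by apply: eval_const => /=; lia.
    * by rewrite bl4.1; lia.
    have nn k : k <> 2 -> nth 0%R (set_nth 0%R mem4 2 (Posz (B + fsz + 0))) k = nth 0%R mem4 k.
      exact: nth_set_nth_neq.
    apply: q.
    * by rewrite size_set_nth_lt bl4.1 //; lia.
    * by move=> k k2 lk; rewrite nn // bl4.2.
    * by rewrite nth_set_nth_eq addn0.
    split=> [||a la|x y lx ly].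
    * by rewrite nn //; lia.
    * by rewrite nn //; lia.
    * by rewrite nn; [apply: v4; rewrite mem_slots|lia].
    * by rewrite nn; [apply: t4; rewrite mem_pairs lx|lia].
  + by rewrite size_pairs.
  move=> l1 [x y] l2 mem4 el [[bl4 n4 s4 v4] t4].
  have := split_mem el; rewrite mem_pairs => /andP[lx ly]; have ot := off_t_bounds lx ly.
  apply: (wp_store_nxt bl4 _ (hc mem4)) => //=; [by lia|] => bl5; split; first split=> //.
  * by rewrite nth_set_nth_neq //; lia.
  * by rewrite nth_set_nth_neq //; lia.
  * move=> a ia; rewrite nth_set_nth_neq; first exact: v4.
    by move: ia; rewrite mem_slots => /off_v_lt; lia.
  move=> x' y'; rewrite mem_rcons inE => /orP[/eqP[-> ->]|hin]; first exact: nth_set_nth_eq.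
  by rewrite nth_set_nth /=; case: eqP => // _; apply: t4.
- by rewrite size_slots.
move=> l1 a l2 mem3 el [bl3 n3 s3 v3].
have la : a < N by rewrite -mem_slots; apply: split_mem el.
have ov := off_v_lt la; have F2 : 2 + N <= fsz by rewrite /fsize; lia.
have lj := ltn_ord j.
have hj : eval b inp mem3 (Cell (nxt N 0)) = Some (Posz j).
  rewrite -n3 -[B + fsz]addn0; apply: eval_cell.
  - by apply: eval_nxt => //; lia.
  - by rewrite bl3.1; lia.
  - by rewrite addn0 n3 /=; lia.
have h1 k : k <= b -> eval b inp mem3 (Const (Posz k)) = Some (Posz k).
  by move=> lk; apply: eval_const.
have hs := eval_bag_start (ltnW lj) hj.
have hj1 : eval b inp mem3 (Op OpAdd (Cell (nxt N 0)) (Const 1%:Z)) = Some (Posz j.+1).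
  rewrite (eval_op (o := OpAdd) hj (h1 1 _)) /=; [by congr Some; lia|by lia|by lia].
have hs1 := eval_bag_start lj hj1.
have lj' : j < size (bag_lists bag) by rewrite size_bag_lists.
have eS := list_startS lj'; rewrite bag_row in eS.
have bb := list_start_le (bag_lists bag) j.+1.
have hsa k : k <= N -> eval b inp mem3 (Op OpAdd (Input 7 (Cell (nxt N 0))) (Const (Posz k))) =
    Some (Posz (list_start (bag_lists bag) j + k)).
  move=> lk; rewrite (eval_op (o := OpAdd) hs (h1 k _)) //=; last by lia.
  by lia.
have fin v : nth 0%R (set_nth 0%R mem3 (B + fsz + off_v a) v) (B + fsz + off_v a) =
    encv (bag_slot j a) -> below (set_nth 0%R mem3 (B + fsz + off_v a) v) ->
    I1 (rcons l1 a) (set_nth 0%R mem3 (B + fsz + off_v a) v).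
  move=> hv bl4; split=> //; try by rewrite nth_set_nth_neq // /off_v; lia.
  move=> a'; rewrite mem_rcons inE => /orP[/eqP->|hin] //.
  by case: (eqVneq a' a) => [->|ne] //; rewrite nth_set_nth_neq ?v3 // /off_v; lia.
apply: wp_mono (wp_if (t := 50) (Q := I1 (rcons l1 a)) (eval_le b_gt0 (hsa a.+1 la) hs1) _ _) _
  (fun _ h => h) => //.
  move=> /Posz_bool_neq0; rewrite eS => lea.
  move: lea; rewrite lez_nat leq_add2l => las.
  have x0 : 'I_n by case: (enum (bag j)) las.
  have := @row_entry _ (bag_lists bag) x0 j a lj'; rewrite bag_row => /(_ las)[lt en].
  have h8 : eval b inp mem3 (Input 8 (Op OpAdd (Input 7 (Cell (nxt N 0))) (Const (Posz a)))) =
      Some (Posz (nth x0 (enum (bag j)) a)).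
    have e8 : nth 0%R (nth [::] inp 8) (list_start (bag_lists bag) j + a) =
        Posz (nth x0 (enum (bag j)) a).
      by rewrite /= (nth_map x0) // en.
    rewrite -e8; apply: eval_input (hsa a (ltnW la)) _ _; first by rewrite /= size_map.
    by rewrite e8 /=; apply: leq_trans (ltnW (ltn_ord _)) _; lia.
  have h9 : eval b inp mem3 (Op OpAdd (Input 8 (Op OpAdd (Input 7 (Cell (nxt N 0))) (Const (Posz
    a)))) (Const 1%:Z)) =
      Some (encv (bag_slot j a)).
    rewrite /bag_slot (onth_some x0 las) (eval_op (o := OpAdd) h8 (h1 1 _)) /=.
    - by congr Some; lia.
    - by lia.
    - apply: (@leq_trans n.+1); [rewrite addn1 ltnS; exact: ltnW|lia].
  apply: (wp_store_nxt bl3 _ h9) => //; first by lia.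
  by move=> bl4; apply: fin => //; apply: nth_set_nth_eq.
move=> /Posz_bool_eq0; rewrite eS => lea.
apply: (wp_store_nxt bl3 _ (hc mem3)) => //; first by lia.
move=> bl4; apply: fin => //; rewrite nth_set_nth_eq /bag_slot onth_none //; by move: lea;
  rewrite lez_nat leq_add2l ltnNge => /negbFE.
Qed.

End Push.

Lemma wp_push_top2 mem0 mem B c e3 e4 f e (j : 'I_m) Q :
  size mem0 = sp -> nth 0%R mem 3 = e3 -> nth 0%R mem 4 = e4 -> top N mem0 B c f mem ->
  B + fsz + fsz <= sp ->
  eval b inp mem e = Some (Posz j) -> expr_cost e <= 20 ->
  (forall mem', top2 N mem B c e3 e4 f (fresh j) mem' -> Q mem') ->
  wp b inp (push N e) push_cost Q mem.
Proof.
move=> szm h3 h4 [g0 g1 g2 g4 g5 g6 g7] fit he ce q; have F := fsize_gt1 N.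
have szm' : size mem = sp by rewrite g0.
apply: (wp_push szm' g2 fit g5 he ce) => mem' sz' un b' fr; apply: q; split=> //.
- by rewrite sz'.
- by rewrite sz'.
- by rewrite un //; lia.
- by rewrite un //; lia.
- by rewrite un //; lia.
- by apply: is_frame_ext g6 => k hk; rewrite un //; lia.
- by move=> k hk; rewrite un //; lia.
Qed.

Lemma wp_visit mem0 B c e3 e4 pf cf mem arr (ch : 'I_m -> option 'I_m) (i : 'I_m) s Q :
  size mem0 = sp -> nth [::] inp arr = [seq child_word (ch i) | i <- enum 'I_m] ->
  (0 <= s <= 2)%R -> fnode cf = Posz i -> top2 N mem0 B c e3 e4 pf cf mem ->
  (forall mem1, top2 N mem0 B c e3 e4 pf (set_state cf s) mem1 -> ch i = None -> Q mem1) ->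
  (forall j mem1 mem', top2 N mem0 B c e3 e4 pf (set_state cf s) mem1 -> ch i = Some j ->
     top2 N mem1 (B + fsz) c e3 e4 (set_state cf s) (fresh j) mem' -> Q mem') ->
  (forall j, ch i = Some j -> B + fsz + fsz + fsz <= sp) ->
  wp b inp (visit N arr s) (push_cost + 50) Q mem.
Proof.
move=> szm inp_ch hs ni H q0 q1 fit; have F := fsize_gt1 N.
have low := top2_low H; have fits := top2_fits H; have sz := top2_size H.
apply: wp_mono (wp_seq (t1 := 10) (t2 := push_cost + 40) _) _ (fun _ h => h); last by lia.
apply: wp_mono (wp_store (k := (B + fsz).+1) (z := s) _ _ _ _) _ (fun _ h => h) => //.
- by rewrite (eval_adr_nat inp b_sp b_M b_n szm H) ?addn1 //; lia.
- by lia.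
- by apply: eval_const; lia.
have {H} := top2_set_state s H; set mem1 := set_nth _ _ _ _ => H1.
have li := ltn_ord i.
have hn : eval b inp mem1 (cur 0) = Some (Posz i).
  by rewrite (eval_cur_node inp b_sp b_M b_n szm H1) /= ni //=; lia.
have earr : nth 0%R (nth [::] inp arr) i = child_word (ch i).
  by rewrite inp_ch (nth_map i) ?size_enum_ord // nth_ord_enum.
have hi : eval b inp mem1 (Input arr (cur 0)) = Some (child_word (ch i)).
  rewrite -earr; apply: eval_input hn _ _; first by rewrite inp_ch size_map size_enum_ord.
  by rewrite earr; case: (ch i) => [j|] /=; [have := ltn_ord j|]; lia.
have h0 : eval b inp mem1 (Const 0%:Z) = Some (Posz 0) by apply: eval_const => /=; lia.
apply: wp_mono (wp_if (t := push_cost + 10) (Q := Q) (eval_le b_gt0 h0 hi) _ _) _ (fun _ h => h).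
- case ej : (ch i) hi => [j|] hi; last by move=> /Posz_bool_neq0.
  move=> _; have T1 := top2_top H1.
  have fitj := fit j ej.
  have := wp_push_top2 (e3 := e3) (e4 := e4) (j := j) (Q := Q) _ _ _ T1.
  rewrite (top2_size H1) => h; apply: wp_mono (h _ szm (top2_3 H1) (top2_4 H1) _ hi _ _) _ (fun
    _ x => x) => //.
  + by move=> mem' H'; apply: q1 H1 ej H'.
  + by lia.
- case ej : (ch i) hi => [j|] hi; first by move=> /Posz_bool_eq0.
  by move=> _; apply: wp_mono (wp_skip _ _ (Q := Q) _) _ (fun _ x => x); [apply: q0|lia].
- by rewrite /=; lia.
Qed.

(** Length bound after [h] levels: a level treats [N] slots with [N * N] updates each, and every
    update doubles the bound. *)
Definition ell (h : nat) : nat := 2 ^ (h * (N * (N * N))).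

Definition node_cost : nat := 2 * (push_cost + 100) + finalize_cost N + 100.

Definition subtree_cost (i : 'I_m) : nat :=
  node_cost * #|subtree T i| + (N * 200 + 100) * \sum_(u in inner T bag i) degree G u.

Definition process_post h i mem0 B c pf mem' := exists c' pf',
  [/\ top N mem0 B c' pf' mem', improves pf pf' /\ sound (ell h) pf', csound Lm c',
     forall z, ole c z -> ole c' z &
     path_cover N G (inner T bag i) set0 pf' /\ cycle_cover G (inner T bag i) c'].

(** The run ends with the frame of [i] popped and its table merged into [pf]. The stack needs [h.+1]
    frames from [B], that of the parent included. The form with [steps] lets the runs of the
    children be chained inside the same loop. *)
Definition process_spec h := forall i pb mem0 B c e3 e4 pf mem,
  size mem0 = sp -> (forall p, path (child T) i p -> size p < h) ->
  B + h.+1 * fsz <= sp -> ell h <= Lm -> parent_bag T bag i pb -> represents N pf pb ->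
  sound (ell h) pf -> csound Lm c -> top2 N mem0 B c e3 e4 pf (fresh i) mem ->
  steps b inp loop_cond (loop_body N) (subtree_cost i) (process_post h i mem0 B c pf) mem.

Lemma eval_loop_cond mem0 B c e3 e4 pf cf mem : size mem0 = sp ->
  top2 N mem0 B c e3 e4 pf cf mem ->
  exists2 z, eval b inp mem loop_cond = Some z & z <> 0%R.
Proof.
move=> szm H; have F := fsize_gt1 N.
have low := top2_low H; have fits := top2_fits H; have sz := top2_size H.
have h2 : eval b inp mem (Cell (Const 2%:Z)) = Some (Posz (B + fsz)).
  by apply: (eval_var inp b_sp b_M b_n szm H) (top2_B H) _ _ => //=; lia.
have h5 : eval b inp mem (Const 5%:Z) = Some (Posz 5) by apply: eval_const => /=; lia.
by eexists; [apply: (eval_op (o := OpSub) h2 h5)|]; rewrite /=; lia.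
Qed.

Section Visit.
Variables (h : nat) (mem0 : seq int) (B : nat) (pf : frame n) (i : 'I_m).
Hypothesis IH : process_spec h.
Hypothesis szm : size mem0 = sp.
Hypothesis hgt : forall p, path (child T) i p -> size p < h.+1.
Hypothesis fitB : B + h.+2 * fsz <= sp.
Hypothesis ellh : ell h <= Lm.

Definition visit_post (o : option 'I_m) c (s : int) cf mem' := exists c' e3' e4' cf',
  [/\ top2 N mem0 B c' e3' e4' pf cf' mem', improves (set_state cf s) cf' /\ sound (ell h) cf',
      csound Lm c', forall z, ole c z -> ole c' z &
      path_cover N G (oinner T bag o) set0 cf' /\ cycle_cover G (oinner T bag o) c'].

(** Common to both children; the last hypothesis says that the state selects the branch of
    [loop_body] calling this [visit]. *)
Lemma steps_visit c e3 e4 cf mem arr (ch : 'I_m -> option 'I_m) (s : int) :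
  nth [::] inp arr = [seq child_word (ch i) | i <- enum 'I_m] ->
  (forall j, ch i = Some j -> child T i j) -> (0 <= s <= 2)%R -> fnode cf = Posz i ->
  fvs cf = bag_slot i -> sound (ell h) cf -> csound Lm c ->
  top2 N mem0 B c e3 e4 pf cf mem ->
  (forall Q, wp b inp (visit N arr s) (push_cost + 50) Q mem ->
     wp b inp (loop_body N) (push_cost + 90) Q mem) ->
  steps b inp loop_cond (loop_body N)
    (push_cost + 100 + ofold 0 subtree_cost (ch i)) (visit_post (ch i) c s cf) mem.
Proof.
move=> inp_ch chi hs ni ev scf sc H body.
have [z hz z0] := eval_loop_cond szm H.
apply: steps_mono (steps_trans (t1 := push_cost + 100) (t2 := ofold 0 subtree_cost (ch i)) _) _
  (fun _ x => x) => //.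
apply: steps_mono (steps_iter (t := push_cost + 90) hz z0 (body _ _)) _ (fun _ x => x); last by
  rewrite /=; lia.
apply: (wp_visit szm inp_ch hs ni H) => [mem1 H1 ej|j mem1 mem' H1 ej H'|j ej].
- rewrite ej; apply: steps_refl; exists c, e3, e4, (set_state cf s); split=> //.
  split=> [x y s' _ _|x s' _ /=]; last by rewrite inE.
  by case: s' => [|v s'] /=; rewrite !inE.
- rewrite ej /=; have ij := chi j ej.
  have szm1 : size mem1 = sp by rewrite (top2_size H1).
  have rcf : represents N (set_state cf s) (bag i) by apply: represents_bag.
  have := @IH j (bag i) mem1 (B + fsz) c e3 e4 (set_state cf s) mem' szm1 _ _ ellh
    (parent_bag_child rootedT decT ij) rcf scf sc H'.
  move=> st; apply: steps_mono (st _ _) _ _ => //.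
  + by move=> p pp; have := hgt (p := j :: p); rewrite /= ij pp => /(_ isT).
  + by lia.
  move=> mem2 [c' [pf' [T' [i' s'] sc' m' [pc cc]]]].
  exists c', (nth 0%R mem2 3), (nth 0%R mem2 4), pf'; split=> //.
  exact: top2_return H1 T'.
(* The existence of a child forces [h] to be positive, which leaves room for a third frame. *)
- have hj := hgt (p := [:: j]); rewrite /= (chi j ej) in hj; have := hj isT.
  by move: fitB; case: (h) => [//|h'] fitB' _; nia.
Qed.

End Visit.

(** Besides the runs of the two children, a node takes three rounds of the loop, one for each value
    of its state. *)
Lemma process h : process_spec h.
Proof.
elim: h => [|h IH] i pb mem0 B c e3 e4 pf mem szm hgt fitB eL hp rp sp' sc H.
  by have := hgt [::] isT.
have eS : ell h * 2 ^ (N * (N * N)) = ell h.+1 by rewrite /ell mulSn addnC expnD.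
have el0 : 0 < ell h by rewrite expn_gt0.
have ellh : ell h <= Lm by apply: leq_trans eL; rewrite -eS leq_pmulr // expn_gt0.
have hb k memx : k <= 10 -> eval b inp memx (Const (Posz k)) = Some (Posz k).
  by move=> lk; apply: eval_const => /=; lia.
have body mem1 B1 c1 (z3 z4 : int) pf1 cf1 : top2 N mem0 B1 c1 z3 z4 pf1 cf1 mem1 ->
    (0 <= fstate cf1 <= 2)%R -> eval b inp mem1 (cur 1) = Some (fstate cf1).
  by move=> H1 hs; apply: (eval_cur_state inp b_sp b_M b_n szm H1); lia.
have s0 : sound (ell h) (fresh i) by [].
have cost0 : subtree_cost i = push_cost + 100 + ofold 0 subtree_cost (bt_left T i) +
   ((push_cost + 100 + ofold 0 subtree_cost (bt_right T i)) +
    (finalize_cost N + (N * 200 + 100) * \sum_(u in bag i :\: pb) degree G u + 100)).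
  rewrite /subtree_cost (card_subtree rootedT) (sum_inner rootedT decT _ hp) /node_cost /oinner.
  case: (bt_left T i) => [j|] /=; case: (bt_right T i) => [k|] /=; rewrite ?big_set0;
    by rewrite ?/subtree_cost /node_cost; nia.
rewrite cost0; apply: steps_trans.
apply: steps_mono (steps_visit (arr := 9) (ch := bt_left T) (s := 1%:Z) IH szm hgt fitB ellh _ _
  _ _ _ s0 sc H _) _ _ => //.
- by move=> j ej; rewrite childE ej eqxx.
- move=> Q hv; have hs := body _ _ _ _ _ _ _ H isT.
  apply: wp_mono (wp_if (t := push_cost + 70) (Q := Q) (eval_eq b_gt0 hs (hb 2 mem isT)) _ _) _
    (fun _ x => x) => //; last by rewrite /=; lia.
  move=> _; apply: wp_mono (wp_if (t := push_cost + 50) (Q := Q) (eval_eq b_gt0 hs (hb 1 mem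
    isT)) _ _) _ (fun _ x => x) => //.
  by rewrite /=; lia.
move=> mem1 [c1 [f3 [f4 [cf1 [H1 [[n1 st1 v1 i1] s1] sc1 m1 [pc1 cc1]]]]]].
apply: steps_trans.
apply: steps_mono (steps_visit (arr := 10) (ch := bt_right T) (s := 2%:Z) IH szm hgt fitB ellh _
  _ _ _ _ s1 sc1 H1 _) _ _ => //.
- by move=> j ej; rewrite childE ej eqxx orbT.
- move=> Q hv; have := body _ _ _ _ _ _ _ H1; rewrite st1 => /(_ isT) hs.
  apply: wp_mono (wp_if (t := push_cost + 70) (Q := Q) (eval_eq b_gt0 hs (hb 2 mem1 isT)) _ _) _
    (fun _ x => x) => //; last by rewrite /=; lia.
  move=> _; apply: wp_mono (wp_if (t := push_cost + 50) (Q := Q) (eval_eq b_gt0 hs (hb 1 mem1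
    isT)) _ _) _ (fun _ x => x) => //.
  by rewrite /=; lia.
move=> mem2 [c2 [g3 [g4 [cf2 [H2 [imp2 s2] sc2 m2 [pc2 cc2]]]]]].
have [n2 st2 v2 i2] := imp2.
have [z hz z0] := eval_loop_cond szm H2.
have rc2 : represents N cf2 (bag i) by apply: represents_bag; rewrite v2 /= v1.
(* What the left child contributed survives the run of the right one, as entries only decrease. *)
have pc1' : path_cover N G (oinner T bag (bt_left T i)) set0 cf2.
  by apply: path_cover_improves imp2 _; exact: pc1.
have cc1' : cycle_cover G (oinner T bag (bt_left T i)) c2 by apply: cycle_cover_mono m2 cc1.
have fin := wp_finalize rootedT decT b_sp b_M b_n b_out b_in Lm_gt0 L_M szm H2 hp rp rc2 el0
  (eq_leq eS) eL s2 sp' sc2 pc1' pc2 cc1' cc2.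
apply: steps_mono (steps_iter hz z0 (wp_if (t := finalize_cost N + (N * 200 + 100) * \sum_(u in
  bag i :\: pb) degree G u) (eval_eq b_gt0 (body _ _ _ _ _ _ _ H2 _) (hb 2 mem2 isT)) _ _)) _ _.
- by rewrite st2.
- by move=> _; exact: fin.
- by rewrite st2.
- by rewrite /=; lia.
move=> mem3 [c3 [pf3 [T3 [i3 s3] sc3 m3 [pc3 cc3]]]]; exists c3, pf3; split=> //.
by move=> zz /m1/m2/m3.
Qed.

End Traversal.

(** * The complete program *)

Section Run.
Variables (n N b M sp Lm m H : nat) (G : wdigraph n) (T : btree m) (bag : 'I_m -> {set 'I_n}).
Local Notation inp := (encode G T bag).
Local Notation fsz := (fsize N).
Hypothesis rootedT : is_rooted T.
Hypothesis decT : is_tree_decomposition G (tree_adj T) bag.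
Hypothesis card_bag : forall i, #|bag i| <= N.
Hypothesis b_sp : sp + 2 * fsz + 10 <= b.
Hypothesis b_M : 4 * M + 4 <= b.
Hypothesis b_n : n + 2 <= b.
Hypothesis b_m : m + 2 <= b.
Hypothesis b_out : size (flatten (out_edges G)) + 2 <= b.
Hypothesis b_in : size (flatten (in_edges G)) + 2 <= b.
Hypothesis b_bag : size (flatten (bag_lists bag)) + N + 2 <= b.
Hypothesis Lm_gt0 : 0 < Lm.
Hypothesis L_M : Lm * max_abs_weight G <= M.
Hypothesis height : forall p, path (child T) (bt_root T) p -> size p < H.
Hypothesis fit : 5 + H.+1 * fsz <= sp.
Hypothesis ellH : ell N H <= Lm.

Lemma wp_program : wp b inp (program N)
  (subtree_cost N G T bag (bt_root T) + push_cost N + 60)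
  (fun mem => exists c, [/\ output mem = c, csound G Lm c & cycle_cover G setT c])
  (nseq sp 0%R).
Proof.
have F := fsize_gt1 N; have H0 : 0 < H by apply: leq_ltn_trans (height (p := [::]) isT).
have fit2 : 5 + fsz + fsz <= sp by move: fit; case: (H) H0 => // H' _; nia.
have hc memx k : k <= 9 -> eval b inp memx (Const (Posz k)) = Some (Posz k).
  by move=> lk; apply: eval_const => /=; lia.
pose mem1 : seq int := set_nth 0%R (nseq sp 0%R) 2 (Posz 5).
have sz0 : size (nseq sp 0%R : seq int) = sp by rewrite size_nseq.
have sz1 : size mem1 = sp by rewrite size_set_nth_lt sz0 //; lia.
have z1 k : k <> 2 -> nth 0%R mem1 k = 0%R.
  by move=> k2; rewrite /mem1 nth_set_nth_neq // nth_nseq; case: ifP.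
(* Zeroed memory reads as a frame with empty slots and infinite entries, which serves as the parent
   of the root. *)
pose f0 := Frame 0%R 0%R (fun=> None : option 'I_n) (fun _ _ => None).
have T1 : top N mem1 5 None f0 mem1.
  split=> //; try by [rewrite sz1; lia | rewrite z1].
    by rewrite /mem1 nth_set_nth_eq.
  by split=> *; rewrite z1 //= /off_v /off_t; lia.
apply: wp_mono (wp_seq (t1 := 5) (t2 := subtree_cost N G T bag (bt_root T) + push_cost N + 55)
  _) _ (fun _ x => x); last by lia.
apply: wp_mono (wp_store (hc _ 2 isT) _ (hc _ 5 isT) _) _ (fun _ x => x) => //; first by rewrite
  sz0; lia.
rewrite -/mem1.
apply: wp_mono (wp_seq (t1 := push_cost N) (t2 := subtree_cost N G T bag (bt_root T) + 55) _) _
  (fun _ x => x); last by lia.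
have hr : eval b inp mem1 (Input 0 (Const 2%:Z)) = Some (Posz (bt_root T)).
  by apply: eval_input (hc mem1 2 isT) _ _ => //=; have := ltn_ord (bt_root T); lia.
apply: (wp_push_top2 b_sp b_M b_n b_m b_out b_in b_bag Lm_gt0 L_M (e3 := 0%R) (e4 := 0%R) _ _ _
  T1 fit2 hr) => //; try by rewrite z1.
move=> mem2 H2.
have rp : represents N f0 set0 by split=> // x; rewrite inE.
have st := process rootedT decT card_bag b_sp b_M b_n b_m b_out b_in b_bag Lm_gt0 L_M
  sz1 height fit ellH (parent_bag_root rootedT bag) rp _ _ H2.
apply: wp_mono (wp_seq (t1 := subtree_cost N G T bag (bt_root T) + 5) (t2 := 50) _) _ (fun _ x
  => x); last by lia.
apply: wp_mono (wp_while_steps (st _ _) _) _ _ => //.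
- move=> mem3 [c' [pf' [T3 _ _ _ _]]].
  have sz3 := top_size T3.
  have h2 : eval b inp mem3 (Cell (Const 2%:Z)) = Some (Posz 5).
    rewrite -(top_B T3); apply: eval_cell; [exact: hc|by rewrite sz3 sz1; lia|].
    by rewrite (top_B T3) /=; lia.
  by rewrite (eval_op (o := OpSub) h2 (hc mem3 5 isT)) /= ?subrr.
move=> mem3 [c' [pf' [T3 [i3 s3] sc3 m3 [pc3 cc3]]]].
have sz3 : size mem3 = sp by rewrite (top_size T3).
have cb : obounded M c' by apply: csound_bounded sc3.
have e1 : nth 0%R mem3 1 = encz c' := top_c T3.
have ef : absz (encz c') <= b by case: (c') cb => [z|] //= /(_ z (erefl _)); lia.
have h1 : eval b inp mem3 (Cell (Const 1%:Z)) = Some (encz c').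
  by rewrite -e1; apply: eval_cell; rewrite ?sz3 ?e1 //; [apply: hc|lia].
(* All bags lie below the root, so every vertex has been eliminated. *)
have cc : cycle_cover G setT c'.
  move=> x s us _ ps; apply: cc3 => //; apply/allP => y _; exact: inner_root.
have e0 : nth 0%R mem3 0 = 0%R by rewrite (top_rest T3) ?z1 //; left.
apply: wp_mono (wp_if (t := 40) (Q := fun mem => exists c, [/\ output mem = c, csound G Lm c &
  cycle_cover G setT c]) h1 _ _) _ (fun _ x => x) => //.
- case ec : c' h1 cb e1 ef => [z|] //= h1 cb e1 ef _.
  apply: wp_mono (wp_seq (t1 := 10) (t2 := 30) _) _ (fun _ x => x) => //.
  apply: wp_mono (wp_store (hc mem3 0 isT) _ (hc mem3 1 isT) _) _ (fun _ x => x) => //; first by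
    rewrite sz3; lia.
  set mem4 := set_nth _ _ _ _.
  have sz4 : size mem4 = sp by rewrite size_set_nth_lt sz3 //; lia.
  have h4 : eval b inp mem4 (Cell (Const 1%:Z)) = Some (2 * z + 1)%R.
    have e4 : nth 0%R mem4 1 = (2 * z + 1)%R by rewrite /mem4 nth_set_nth_neq.
    by rewrite -e4; apply: eval_cell; rewrite ?sz4 ?e4 //; [apply: hc|lia].
  have zb := cb z (erefl _).
  have h5 : eval b inp mem4 (Op OpSub (Cell (Const 1%:Z)) (Const 1%:Z)) = Some (z * 2)%R.
    rewrite (eval_op (o := OpSub) h4 (hc mem4 1 isT)) /=; last by lia.
    by congr Some; lia.
  have h6 : eval b inp mem4 (Op OpDiv (Op OpSub (Cell (Const 1%:Z)) (Const 1%:Z)) (Const 2%:Z))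
    = Some z.
    have ez : eval_binop OpDiv (z * 2)%R 2%:Z = z by rewrite /= mulzK.
    by rewrite -ez; apply: eval_op h5 (hc mem4 2 isT) _; rewrite ez; lia.
  apply: wp_mono (wp_store (hc mem4 1 isT) _ h6 _) _ (fun _ x => x) => //; first by rewrite sz4;
    lia.
  exists (Some z); split; rewrite -?ec //.
  by rewrite /output nth_set_nth_neq // /mem4 nth_set_nth_eq /= nth_set_nth_eq ec.
case ec : c' h1 cb e1 ef => [z|] //= h1 cb e1 ef; first by lia.
move=> _; apply: wp_mono (wp_skip _ _ (Q := fun mem => exists c, [/\ output mem = c, csound G Lm
  c & cycle_cover G setT c]) _) _ (fun _ x => x) => //.
by exists None; split; rewrite -?ec // /output e0.
Qed.

End Run.

(** * Linear bounds on the input size and the total cost *)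

Section Counting.
Variables (n m N : nat) (G : wdigraph n) (T : btree m) (bag : 'I_m -> {set 'I_n}).
Hypothesis card_bag : forall i, #|bag i| <= N.
Hypothesis edge_bag : forall u v, edge G u v -> exists i, (u \in bag i) && (v \in bag i).

(** Each edge is a pair inside some bag, and a bag contains at most [N * N] pairs. *)
Lemma edge_count : \sum_(u < n) \sum_(v < n) edge G u v <= m * (N * N).
Proof.
apply: (@leq_trans (\sum_(u < n) \sum_(v < n) \sum_(i < m) (u \in bag i) * (v \in bag i))).
  apply: leq_sum => u _; apply: leq_sum => v _; case: (boolP (edge G u v)) => //.
  by case/edge_bag=> i /andP[ui vi]; rewrite (bigD1 i) //= ui vi.
have -> : \sum_(u < n) \sum_(v < n) \sum_(i < m) (u \in bag i) * (v \in bag i) =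
    \sum_(i < m) #|bag i| * #|bag i|.
  under eq_bigr do rewrite exchange_big /=; rewrite exchange_big /=.
  have cE i : #|bag i| = \sum_(u < n) (u \in bag i) by rewrite -sum1_card big_mkcond.
  apply: eq_bigr => i _; rewrite {1}cE big_distrl /=; apply: eq_bigr => u _.
  by rewrite cE big_distrr.
rewrite -[X in X * _](card_ord m) -sum_nat_const; apply: leq_sum => i _.
exact: leq_mul.
Qed.

Lemma size_edge_row (P : pred 'I_n) (A : Type) (f : 'I_n -> A) :
  size [seq f v | v <- enum 'I_n & P v] = \sum_(v < n) P v.
Proof.
rewrite size_map size_filter -[RHS]big_enum /=.
by elim: (enum _) => [|v s IH]; rewrite ?big_nil // big_cons /= IH.
Qed.

Lemma size_flatten_out : size (flatten (out_edges G)) <= m * (N * N).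
Proof.
apply: leq_trans edge_count; rewrite size_flatten sumnE /shape /out_edges /in_edges /bag_lists
  2!big_map big_enum /=.
by apply: leq_sum => u _; rewrite size_edge_row.
Qed.

Lemma size_flatten_in : size (flatten (in_edges G)) <= m * (N * N).
Proof.
apply: leq_trans edge_count; rewrite size_flatten sumnE /shape /out_edges /in_edges /bag_lists
  2!big_map big_enum /= exchange_big /=.
by apply: leq_sum => u _; rewrite size_edge_row.
Qed.

Lemma size_flatten_bags : size (flatten (bag_lists bag)) <= m * N.
Proof.
rewrite size_flatten sumnE /shape /out_edges /in_edges /bag_lists 2!big_map big_enum /= -[X in X
  * _](card_ord m) -sum_nat_const.
by apply: leq_sum => i _; rewrite -cardE.
Qed.

Lemma sum_degree : \sum_(u < n) degree G u <= 2 * (m * (N * N)).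
Proof.
rewrite big_split mul2n -addnn /=; apply: leq_add; apply: leq_trans edge_count.
  by apply: leq_sum => u _; rewrite out_row size_edge_row.
by rewrite exchange_big /=; apply: leq_sum => u _; rewrite in_row size_edge_row.
Qed.

Lemma subtree_cost_root : is_rooted T ->
  subtree_cost N G T bag (bt_root T) <=
  (node_cost N + (N * 200 + 100) * (2 * (N * N))) * m.
Proof.
move=> rootedT; rewrite /subtree_cost [leqRHS]mulnDl.
apply: leq_add; first by rewrite leq_mul2l -[leqRHS](card_ord m) max_card orbT.
rewrite -[leqRHS]mulnA leq_mul2l; apply/orP; right.
apply: leq_trans (_ : 2 * (m * (N * N)) <= _); last by nia.
apply: leq_trans sum_degree; rewrite [leqRHS](bigID (mem (inner T bag (bt_root T)))) /=.
exact: leq_addr.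
Qed.

End Counting.

(** * From the two bounds to the properties of the result *)

Section Weight.
Variables (n : nat) (G : wdigraph n).

Lemma simple_cycle_cover c u p : cycle_cover G setT c -> is_simple_cycle G u p ->
  ole c (path_weight G u p).
Proof.
move=> cc [[pp p0 lp] up]; case/lastP: p pp p0 lp up => // s x pp _.
rewrite last_rcons => ex; subst x; rewrite rcons_uniq => us.
by apply: cc => //; apply/allP => y _; rewrite inE.
Qed.

Lemma walk_cycle l x z : walk G l x x z ->
  exists p, [/\ is_cycle G x p, path_weight G x p = z & size p <= l].
Proof. by move=> [p [h1 h2 h3 h4 h5]]; exists p. Qed.

(** Coverage gives [c <= cstar]. Conversely [c] is the weight of a closed walk with at most [L]
    edges, compared with simple cycles by [simple_cycle_below] or by [cycle_weight_ge]. *)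
Lemma result_correct L c cstar : is_min_simple_cycle_weight G cstar ->
  csound G L c -> cycle_cover G setT c ->
  (~ has_negative_cycle G -> c = cstar) /\
  (has_negative_cycle G -> exists z zstar : int,
     [/\ c = Some z, cstar = Some zstar, (z <= zstar)%R &
         absz zstar <= absz z <= absz zstar * L]).
Proof.
move=> cmin sc cc; split=> [nneg|[u [p [cp neg]]]].
  case: cstar cmin => [zs|] /=.
    move=> [[u [p [sp wp]]] mn]; have := simple_cycle_cover cc sp; rewrite wp.
    case: c sc cc => [z|] //= sc cc le; have [x /walk_cycle[q [cq wq _]]] := sc z (erefl _).
    have [v [r [sr ler]]] := simple_cycle_below nneg cq.
    by have le2 := mn v r sr; congr Some; lia.
  case: c sc cc => [z|] // sc cc none; have [x /walk_cycle[q [cq wq _]]] := sc z (erefl _).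
  by have [v [r [sr _]]] := simple_cycle_below nneg cq; case: (none v r).
case: cstar cmin => [zs|] /= cmin; last first.
  (* Without simple cycles the bound holds vacuously with 0, against the negative cycle. *)
  have := @cycle_weight_ge n G 0%R (lexx _) (fun u p sp => False_ind _ (cmin u p sp)) u p cp.
  by lia.
have [[u' [p' [sp' wp']]] mn] := cmin.
have zs0 : (zs < 0)%R.
  case: (ltP zs 0%R) => // zs0.
  have mn0 v q : is_simple_cycle G v q -> (0 <= path_weight G v q)%R.
    by move/mn; apply: le_trans.
  by have := cycle_weight_ge (lexx _) mn0 cp; lia.
have := simple_cycle_cover cc sp'; rewrite wp'.
case: c sc cc => [z|] //= sc cc le; have [x /walk_cycle[q [cq wq sq]]] := sc z (erefl _).
exists z, zs; split=> //.
(* As [zs] is negative and [size q <= L], this yields [zs * L <= z]. *)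
have := cycle_weight_ge (ltW zs0) mn cq; rewrite wq => ge.
by apply/andP; split; [lia|nia].
Qed.

End Weight.

(** From [kappa < 2 ^ kappa], a constant factor adds at most [kappa] to the logarithm. *)
Lemma trunc_log_mul kappa n m : 0 < n -> m <= kappa * n ->
  (trunc_log 2 m).+1 <= kappa.+1 * (trunc_log 2 n).+1.
Proof.
move=> n0 mk; suff h : trunc_log 2 m <= kappa + trunc_log 2 n by nia.
case: (posnP m) => [->|m0]; first by rewrite trunc_log0.
have lo := trunc_logP (isT : 1 < 2) m0; have hi := trunc_log_ltn n (isT : 1 < 2).
rewrite -ltnS -(ltn_exp2l _ _ (isT : 1 < 2)); apply: leq_ltn_trans lo _.
apply: leq_ltn_trans mk _; rewrite -addnS expnD.
have k2 : kappa < 2 ^ kappa by apply: ltn_expl.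
by nia.
Qed.

Lemma four_mul_bound Y X V : 0 < Y -> 2 < X -> V <= Y * X -> 4 * V + 4 <= Y * X ^ 4.
Proof.
move=> Y0 X2 VX; rewrite expnS mulnA; have Z0 : 0 < Y * X by rewrite muln_gt0 Y0; lia.
have X3 : 3 ^ 3 <= X ^ 3 by rewrite leq_exp2r.
apply: leq_trans (leq_mul (leqnn (Y * X)) X3); lia.
Qed.

Theorem theorem2 (t w : nat) :
  exists P : cmd,
  forall beta kappa : nat,
  exists Kt Ks Kb d : nat,
  forall (n : nat) (G : wdigraph n) (k : nat),
    is_treewidth G k -> k <= t ->
  forall (m : nat) (T : btree m) (bag : 'I_m -> {set 'I_n}),
    is_rooted T ->
    is_tree_decomposition G (tree_adj T) bag ->
    width bag <= w ->
    is_balanced beta T ->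
    m <= kappa * n ->
  exists (time space : nat) (c cstar : option int),
    [/\ computes P (encode G T bag) (word_bound Kb G) space time c,
        time <= Kt * n,
        space <= Ks * (trunc_log 2 n).+1,
        is_min_simple_cycle_weight G cstar &
        (~ has_negative_cycle G -> c = cstar) /\
        (has_negative_cycle G ->
         exists z zstar : int,
           [/\ c = Some z, cstar = Some zstar,
               (z <= zstar)%R &
               absz zstar <= absz z <= absz zstar * maxn n 2 ^ d])].
Proof.
(* [N] is the largest bag size for width [w]. The program is fixed before [beta] and [kappa], which
   enter only the bounds. *)
pose N := w.+1; exists (program N) => beta kappa.
pose Kh := beta * kappa.+1 + 2.
pose Ks := 5 + Kh * fsize N.
(* [ell N H] has exponent at most [D * lg], where [2 ^ lg] is at most the square of [maxn n 2];
   hence the degree [2 * D]. *)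
pose D := Kh * (N * (N * N)).
(* Collects the coefficients, relative to [X], of all addresses, indices and array lengths that must
   fit in a word. *)
pose C := Ks + 2 * fsize N + 10 + kappa * (N * N) + kappa * N + kappa + N + 4.
exists ((node_cost N + (N * 200 + 100) * (2 * (N * N))) * kappa + push_cost N + 60).
(* In the word exponent, [2 * D + 4] accommodates the table entries, and [C + 1] the linear
   quantities, as [C * X <= X ^ (C + 1)] for [X > 1]. *)
exists Ks, (2 * D + 4 + C + 1), (2 * D).
move=> n G k _ _ m T bag rootedT decT wb bal mk.
have [[m0 _ _ _] _ cov _] := decT.
have n0 : 0 < n by lia.
have card_bag i : #|bag i| <= N.
  apply: leq_trans (leq_bigmax (F := fun i => #|bag i|) i) _.
  by move: wb; rewrite /width /N; case: (\max_(j < m) _).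
pose lg := (trunc_log 2 n).+1.
pose H := beta * (trunc_log 2 m).+1 + 1.
have lgm := trunc_log_mul n0 mk; rewrite -/lg in lgm.
have HK : H.+1 <= Kh * lg by rewrite /H /Kh; move: lgm; rewrite /lg; nia.
have height p : path (child T) (bt_root T) p -> size p < H.
  by move/bal => h; rewrite /H addn1 ltnS.
pose sp := 5 + H.+1 * fsize N.
have spK : sp <= Ks * lg by rewrite /sp /Ks; move: HK; rewrite {1}/lg; nia.
set W := max_abs_weight G.
pose X := n + W + 2.
pose Lm := ell N H.
have n2 : 2 ^ lg <= maxn n 2 ^ 2.
  have lo := trunc_logP (isT : 1 < 2) n0; rewrite /lg expnS expnS expn1.
  apply: leq_mul; first exact: leq_maxr.
  by apply: leq_trans lo _; apply: leq_maxl.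
have D0 : 0 < D by rewrite /D !muln_gt0 /Kh addn2.
have LmX : Lm <= maxn n 2 ^ (2 * D).
  rewrite expnM; apply: leq_trans (_ : (2 ^ lg) ^ D <= _); last by rewrite leq_exp2r.
  rewrite -expnM /Lm /ell leq_exp2l // /D.
  rewrite [leqRHS]mulnA; apply: leq_mul => //.
  by rewrite mulnC; apply: leq_trans HK.
have Xge : maxn n 2 <= X by rewrite geq_max /X; lia.
have X1 : 1 < X by rewrite /X; lia.
have X0 : 0 < X by lia.
have LmX' : Lm <= X ^ (2 * D) by apply: leq_trans LmX _; rewrite leq_exp2r // muln_gt0.
pose M := Lm * W.
have lgX : lg <= X.
  have : trunc_log 2 n < n by apply: leq_trans (ltn_expl _ (isT : 1 < 2)) (trunc_logP _ n0).
  by rewrite /lg /X; lia.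
have big v : v <= C * X -> v <= word_bound (2 * D + 4 + C + 1) G.
  move=> vC; apply: leq_trans vC _; rewrite /word_bound -/W -/X.
  apply: leq_trans (_ : X ^ (C + 1) <= _); last by rewrite leq_exp2l //; lia.
  rewrite expnD expn1 leq_mul2r; apply/orP; right.
  by apply: ltnW; apply: ltn_expl.
have mX : m <= kappa * X by apply: leq_trans mk _; rewrite leq_mul2l /X; lia.
have b_M : 4 * M + 4 <= word_bound (2 * D + 4 + C + 1) G.
  rewrite /word_bound -/W -/X; apply: leq_trans (_ : X ^ (2 * D + 4) <= _);
    last by rewrite leq_exp2l //; lia.
  rewrite expnD; apply: four_mul_bound; first by rewrite expn_gt0 X0.
    by rewrite /X; lia.
  by rewrite /M leq_mul // /X; lia.
have bigC v c : v <= c * X -> c <= C -> v <= word_bound (2 * D + 4 + C + 1) G.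
  by move=> vc cC; apply: big; apply: leq_trans vc _; apply: leq_mul.
have add_X v v' c c' : v <= c * X -> v' <= c' * X -> v + v' <= (c + c') * X.
  by move=> h h'; rewrite mulnDl leq_add.
have c_X c : c <= c * X by apply: leq_pmulr.
have mN R v : v <= m * R -> v <= kappa * R * X.
  by move=> h; apply: leq_trans h _; rewrite mulnAC; apply: leq_mul.
have spX : sp <= Ks * X by apply: leq_trans spK _; rewrite leq_mul2l lgX orbT.
have [C1 C2 C3 C4] : [/\ Ks + 2 * fsize N + 10 <= C, kappa + 2 <= C,
    kappa * (N * N) + 2 <= C & kappa * N + N + 2 <= C] by rewrite /C; split; lia.
have b_sp := bigC _ _ (add_X _ _ _ _ (add_X _ _ _ _ spX (c_X (2 * fsize N))) (c_X 10)) C1.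
have b_n : n + 2 <= word_bound (2 * D + 4 + C + 1) G.
  by apply: (bigC _ 1); rewrite ?mul1n /X /C; lia.
have b_m := bigC _ _ (add_X _ _ _ _ mX (c_X 2)) C2.
have b_out := bigC _ _ (add_X _ _ _ _ (mN _ _ (size_flatten_out card_bag cov)) (c_X 2)) C3.
have b_in := bigC _ _ (add_X _ _ _ _ (mN _ _ (size_flatten_in card_bag cov)) (c_X 2)) C3.
have b_bag := bigC _ _ (add_X _ _ _ _
  (add_X _ _ _ _ (mN _ _ (size_flatten_bags card_bag)) (c_X N)) (c_X 2)) C4.
have Lm0 : 0 < Lm by rewrite expn_gt0.
have [time [mem [ex le_t [c [out sc cc]]]]] := wp_program rootedT decT card_bag b_sp b_M b_n
  b_m b_out b_in b_bag Lm0 (leqnn _) height (leqnn _) (leqnn _).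
have [cstar cmin] := min_simple_cycle_weight_exists G.
exists time, sp, c, cstar; split=> //.
- by exists mem.
- apply: leq_trans le_t _; have := subtree_cost_root card_bag cov rootedT.
  move: (subtree_cost _ _ _ _ _) (push_cost N) (node_cost N + _) => a1 a2 a3 h.
  by move: h mk n0; clear; nia.
have [r1 r2] := result_correct cmin sc cc; split=> // neg.
have [z [zs [h1 h2 h3 /andP[h4 h5]]]] := r2 neg; exists z, zs; split=> //.
by rewrite h4 (leq_trans h5) // leq_mul2l LmX orbT.
Qed.
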